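(* Let $F$ be a holomorphic map from an open connected neighborhood $U$ of $0\in\mathbb{C}^n$ into $\mathbb{C}^N$ with $1<n<N$ and $F(0)=0$. Write $F=(\widetilde f,g)$ with $\widetilde f$ valued in $\mathbb{C}^{N-1}$ and $g$ the last component of $F$. Assume that $F$ maps $\mathbb{H}^n_\ell\cap U$ into $\mathbb{H}^N_{\ell'}$, with $\ell\le (n-1)/2$ and $\ell'\le (N-1)/2$. Then the following hold. (a) If $\frac{\partial g}{\partial w}(0)>0$, then $\ell\le \ell'$ and $n-\ell\le N-\ell'$. Moreover, if $\ell'<2\ell$, then there is $\gamma\in \mathrm{Aut}_0(\mathbb{H}^N_{\ell'})$ such that $$\gamma\circ F(z,w)=\big(z_1,\dots,z_\ell,\ \psi(z,w),\ z_{\ell+1},\dots,z_{n-1},\ \psi(z,w),0,\dots,0,\ w\big),$$ where $\psi=(\psi_1,\dots,\psi_{\ell'-\ell})$ is holomorphic near $0$ (with the understanding that this term is not present when $\ell'=\ell$). (b) If $\frac{\partial g}{\partial w}(0)<0$, then $\ell'\ge n-1-\ell$ and $N-1-\ell'\ge \ell$. Moreover, if $\ell'<n-1$, then there is $\gamma\in \mathrm{Aut}_0(\mathbb{H}^N_{\ell'})$ such that $$\gamma\circ F(z,w)=\big(z_{\ell+1},\dots,z_{n-1},\ \psi(z,w),\ z_1,\dots,z_\ell,\ \psi(z,w),0,\dots,0,\ -w\big),$$ where $\psi=(\psi_1,\dots,\psi_{\ell'-(n-1-\ell)})$ is holomorphic near $0$ (with the understanding that this term is not present when $\ell'=n-1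-\ell$).
   Context: Coordinates in $\mathbb{C}^n$ are $(z,w)=(z_1,\dots,z_{n-1},w)\in\mathbb{C}^{n-1}\times\mathbb{C}$, and $\mathbb{C}^N=\mathbb{C}^{N-1}\times\mathbb{C}$. For an integer $0\le\ell\le n-1$, the standard hyperquadric is $$\mathbb{H}^n_\ell=\Big\{(z,w)\in\mathbb{C}^n:\ \mathrm{Im}\,w=-\sum_{j=1}^{\ell}|z_j|^2+\sum_{j=\ell+1}^{n-1}|z_j|^2\Big\}$$ (the first sum is $0$ if $\ell=0$); $\mathbb{H}^N_{\ell'}\subset\mathbb{C}^N$ is defined in the same way with $n,\ell$ replaced by $N,\ell'$, where $0\le\ell'\le N-1$. $\mathrm{Aut}_0(\mathbb{H}^N_{\ell'})$ denotes the stability group of $\mathbb{H}^N_{\ell'}$ at $0$, i.e. the group of local biholomorphisms of $\mathbb{C}^N$ sending $0$ to itself and a piece of $\mathbb{H}^N_{\ell'}$ near $0$ into $\mathbb{H}^N_{\ell'}$. For a map $F=(\widetilde f,g)$ as in the claim, the derivative $\frac{\partial g}{\partial w}(0)$ is a real number.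
   Formalization: In (a), when N−n < 2(ℓ'−ℓ), the displayed vector has more than N entries and is ill-defined (e.g. n=6, ℓ=2, N=7, ℓ'=3); there the second copy of ψ is cut so that the first N−1 coordinates fit, and the cut components of ψ vanish. *)

(* Defs.v *)
From HB Require Import structures.
From mathcomp Require Import all_boot all_order all_algebra.
From mathcomp Require Import complex.
From mathcomp Require Import all_classical all_reals all_analysis.

Set Implicit Arguments.
Unset Strict Implicit.
Unset Printing Implicit Defensive.

Import Order.TTheory GRing.Theory Num.Theory.
Import numFieldNormedType.Exports.

Local Open Scope classical_set_scope.
Local Open Scope ring_scope.
Local Open Scope complex_scope.

(* The complex numbers R[i], packed as a numClosedFieldType because the topology
   and the norm of a numeric field are only inferred from such a structure. *)
Definition Cfield (R : realType) : numClosedFieldType := R[i].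

(* C^n as C^(n-1) x C, with points (z, w); meaningful for n >= 1. *)
Notation Cspace R n := ('rV[Cfield R]_n.-1 * Cfield R)%type.

(* Indices start at 0: z_1, ..., z_l are the p.1 0 j with j < l. *)
Definition hyperquadric (R : realType) (n l : nat) : set (Cspace R n) :=
  [set p : Cspace R n | 'Im p.2 = - (\sum_(j < n.-1 | (j < l)%N) `|p.1 0 j| ^+ 2)
                     + \sum_(j < n.-1 | (l <= j)%N) `|p.1 0 j| ^+ 2].

(* Complex (Cfield R-linear) Frechet differentiability at every point of A; this
   is holomorphy when A is open, the only case in which it is used. *)
Definition holomorphic_on (R : realType) (V W : normedModType (Cfield R))
    (A : set V) (f : V -> W) : Prop :=
  forall x, A x -> differentiable f x.

(* Local maps are total functions restricted to a neighborhood of 0: g maps A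
   biholomorphically onto B, with inverse h, and fixes 0. *)
Definition local_biholomorphism0 (R : realType) (V : normedModType (Cfield R))
    (g : V -> V) : Prop :=
  g 0 = 0 /\
  exists (A B : set V) (h : V -> V),
    [/\ [/\ open A, open B, A 0 & B 0],
        holomorphic_on A g,
        holomorphic_on B h,
        (forall x, A x -> B (g x) /\ h (g x) = x) &
        (forall y, B y -> A (h y) /\ g (h y) = y)].

Definition Aut0 (R : realType) (N l : nat) : set (Cspace R N -> Cspace R N) :=
  [set g | local_biholomorphism0 (g : (Cspace R N : normedModType _) -> _) /\
           (\forall p \near (0 : Cspace R N),
              hyperquadric l p -> hyperquadric l (g p))].

Definition coords (T : Type) (m : nat) (x : 'rV[T]_m) : seq T :=
  [seq x 0 j | j : 'I_m].

(* The vector of C^m whose entries are those of s followed by zeros (0 is the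
   default value of s`_k). If s has more than m entries, only the first m are
   kept: in the normal form (z_1..z_l, psi, z_{l+1}..z_{n-1}, psi, 0..0) this
   happens when N - n < 2 (l' - l), and cuts the second copy of psi. *)
Definition pad (R : realType) (m : nat) (s : seq (Cfield R)) :
    'rV[Cfield R]_m :=
  \row_(k < m) s`_k.

(* Main.v *)
(* The derivative dF(0) is conformal on the complex tangent space, with factor
   the derivative of g in the direction w, so that inertia gives the inequalities
   between the signatures; a negative factor is turned into a positive one by
   exchanging the two groups of coordinates and the sign of w.

   The inclusion of M, the source hyperquadric, into the target is equivalent to
   its polarization: rr Z W = 0 implies K Z W = 0, where K Z W = rr (F Z) (F W).
   On the Segre variety of a point X of M, an affine hyperplane through X, the map
   F therefore preserves orthogonality. Since l' < 2 l the residual part of F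
   along this hyperplane, orthogonal to its derivative, is totally null, and F
   is conformal there: K (u, v) = a u * conj (a v) * <u, v>.
   This is equivalent to an identity between four points of the Segre variety,
   which can again be polarized. With two of the four points equal to a fixed
   point off M it reads K Z W = h Z * conj (h W) * rr Z W with h holomorphic
   and h 0 <> 0. In homogeneous coordinates Z |-> F Z / h Z is thus an isometry
   onto its image for the Hermitian forms that define the two hyperquadrics, and
   Witt's theorem brings it to the normal form by a projective transformation. *)

Require Import Defs.
From mathcomp Require Import all_boot all_order all_algebra.
From mathcomp Require Import complex.
From mathcomp Require Import all_classical all_reals all_analysis.
From mathcomp Require Import ring lra zify.

Set Implicit Arguments.
Unset Strict Implicit.
Unset Printing Implicit Defensive.

Import Order.TTheory GRing.Theory Num.Theory.
Import numFieldNormedType.Exports.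

Local Open Scope classical_set_scope.
Local Open Scope ring_scope.

(** * Hermitian forms and their isometries *)

Section LinearAlgebra.
Variable C : numClosedFieldType.

(** The obstacle is that the conformal factor on a Segre variety is chosen point by point: neither
    its regularity nor its dependence on X is known, so it can never be differentiated. The residual
    part is therefore cut out by a constant matrix, and the passage from one X to another uses
    products of four values of K in which the factors cancel. Let the signatures be (a, b) and (a +
    m, b + k). Along a totally null subspace the residual values are null and orthogonal to the
    images of a negative directions, so they span at most m dimensions. A generic null vector lies
    in a null subspace of dimension m + 1 as soon as m < a and m < b, which is what l' < 2 l, or l'
    < n - 1 after the exchange, provides together with l <= n - 1 - l. Holomorphy in several
    variables is used along complex lines and curves of degree two, so the main tool is an identity
    theorem in one variable. It comes from Goursat's lemma on squares and a maximum principle, with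
    finite midpoint sums in place of integrals and without power series. *)

Definition adj p q (A : 'M[C]_(p, q)) : 'M[C]_(q, p) := (map_mx Num.conj A)^T.

Lemma adjE p q (A : 'M[C]_(p, q)) i j : adj A i j = (A j i)^*.
Proof. by rewrite !mxE. Qed.

Lemma adjK p q (A : 'M[C]_(p, q)) : adj (adj A) = A.
Proof. by apply/matrixP => i j; rewrite !adjE conjCK. Qed.

Lemma adjM p q r (A : 'M[C]_(p, q)) (B : 'M[C]_(q, r)) : adj (A *m B) = adj B *m adj A.
Proof. by rewrite /adj map_mxM trmx_mul. Qed.

Lemma adjD p q (A B : 'M[C]_(p, q)) : adj (A + B) = adj A + adj B.
Proof. by rewrite /adj map_mxD linearD. Qed.

Lemma adjN p q (A : 'M[C]_(p, q)) : adj (- A) = - adj A.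
Proof. by rewrite /adj map_mxN linearN. Qed.

Lemma adjZ p q (c : C) (A : 'M[C]_(p, q)) : adj (c *: A) = c^* *: adj A.
Proof. by rewrite /adj map_mxZ linearZ. Qed.

Lemma adj0 p q : adj (0 : 'M[C]_(p, q)) = 0.
Proof. by rewrite /adj map_mx0 trmx0. Qed.

Lemma adj1 p : adj (1%:M : 'M[C]_p) = 1%:M.
Proof. by rewrite /adj map_mx1 trmx1. Qed.

Lemma adj_col_mx p1 p2 q (A : 'M[C]_(p1, q)) (B : 'M[C]_(p2, q)) :
  adj (col_mx A B) = row_mx (adj A) (adj B).
Proof. by rewrite /adj map_col_mx tr_col_mx. Qed.

Lemma adj_row_mx p q1 q2 (A : 'M[C]_(p, q1)) (B : 'M[C]_(p, q2)) :
  adj (row_mx A B) = col_mx (adj A) (adj B).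
Proof. by rewrite /adj map_row_mx tr_row_mx. Qed.

Definition dot p (x y : 'rV[C]_p) : C := \sum_j x 0 j * (y 0 j)^*.

Lemma mulmx_adjE p q r (A : 'M[C]_(p, q)) (B : 'M[C]_(r, q)) i j :
  (A *m adj B) i j = dot (row i A) (row j B).
Proof. by rewrite mxE; apply: eq_bigr => k _; rewrite !mxE. Qed.

Lemma dotE p (x y : 'rV[C]_p) : dot x y = (x *m adj y) 0 0.
Proof. by rewrite mxE; apply: eq_bigr => k _; rewrite !mxE. Qed.

Lemma dot_ge0 p (x : 'rV[C]_p) : 0 <= dot x x.
Proof. by apply: sumr_ge0 => j _; rewrite -normCK exprn_ge0. Qed.

Lemma dot_eq0 p (x : 'rV[C]_p) : dot x x = 0 -> x = 0.
Proof.
move=> /eqP; rewrite psumr_eq0 => [/allP h|j _]; last by rewrite -normCK exprn_ge0.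
apply/rowP => j; rewrite mxE; have := h j (mem_index_enum _).
by rewrite /= -normCK expf_eq0 /= normr_eq0 => /eqP.
Qed.

Lemma dot_conj p (x y : 'rV[C]_p) : (dot x y)^* = dot y x.
Proof.
rewrite rmorph_sum; apply: eq_bigr => j _.
by rewrite rmorphM /= conjCK mulrC.
Qed.

(** Vectors are rows, so the Gram matrix of the rows of S is [S *m sgmx a b *m adj S]. The negative
    squares come first, as in [hyperquadric]. *)
Definition sgmx a b : 'M[C]_(a + b) := block_mx (- 1%:M) 0 0 1%:M.

Definition hf a b (x y : 'rV[C]_(a + b)) : C :=
  dot (rsubmx x) (rsubmx y) - dot (lsubmx x) (lsubmx y).

Lemma adj_block_mx p1 p2 q1 q2 (A : 'M[C]_(p1, q1)) (B : 'M[C]_(p1, q2))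
    (D : 'M[C]_(p2, q1)) (E : 'M[C]_(p2, q2)) :
  adj (block_mx A B D E) = block_mx (adj A) (adj D) (adj B) (adj E).
Proof. by rewrite /adj map_block_mx tr_block_mx. Qed.

Lemma adj_sgmx a b : adj (sgmx a b) = sgmx a b.
Proof. by rewrite /sgmx adj_block_mx adjN !adj1 !adj0. Qed.

Lemma sgmxK a b : sgmx a b *m sgmx a b = 1%:M.
Proof.
rewrite /sgmx mulmx_block !mulmx0 !mul0mx !mul1mx mulNmx mul1mx opprK !addr0 !add0r.
by rewrite -scalar_mx_block.
Qed.

Lemma hfE a b (x y : 'rV[C]_(a + b)) : hf x y = (x *m sgmx a b *m adj y) 0 0.
Proof.
rewrite -[x in RHS]hsubmxK -[y in RHS]hsubmxK /sgmx mul_row_block.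
rewrite !mulmx0 mulmx1 mulmxN mulmx1 addr0 add0r adj_row_mx mul_row_col.
by rewrite mulNmx mxE mxE -!dotE addrC.
Qed.

Lemma hf_conj a b (x y : 'rV[C]_(a + b)) : (hf x y)^* = hf y x.
Proof. by rewrite rmorphB /= !dot_conj. Qed.

Lemma hf_real a b (x : 'rV[C]_(a + b)) : hf x x \is Num.real.
Proof. by apply/CrealP; rewrite hf_conj. Qed.

Lemma mulmx3E p q r s (A : 'M[C]_(p, q)) (H : 'M[C]_(q, r)) (B : 'M[C]_(s, r)) i j :
  (A *m H *m adj B) i j = (row i A *m H *m adj (row j B)) 0 0.
Proof.
rewrite mulmx_adjE dotE; congr ((_ *m adj _) 0 0); first by rewrite row_mul.
Qed.

Lemma row_free_ker p q (A : 'M[C]_(p, q)) : row_free A ->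
  forall u : 'rV_p, u *m A = 0 -> u = 0.
Proof. by move=> Af u uA; apply: (row_free_inj Af); rewrite uA mul0mx. Qed.

Lemma exists_ker p q (A : 'M[C]_(p, q)) : (q < p)%N ->
  exists2 u : 'rV_p, u != 0 & u *m A = 0.
Proof.
move=> qp; have : kermx A != 0.
  rewrite kermx_eq0 /row_free; apply/eqP => h.
  by have := rank_leq_col A; rewrite h leqNgt qp.
by case/rowV0Pn => u /sub_kermxP uA u0; exists u.
Qed.

(** If k > a, some nontrivial combination of the rows has vanishing negative coordinates, and the
    form is positive definite on such vectors. *)
Lemma inertia_nonpos a b k (S : 'M[C]_(k, a + b)) : row_free S ->
  (forall u : 'rV_k, hf (u *m S) (u *m S) <= 0) -> (k <= a)%N.
Proof.
move=> Sf Sn; rewrite leqNgt; apply/negP => /(exists_ker (lsubmx S))[u u0 uS].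
have l0 : lsubmx (u *m S) = 0 by rewrite -mulmx_lsub.
have := Sn u; rewrite /hf l0 /dot.
rewrite [X in _ - X]big1 => [|j _]; last by rewrite mxE mul0r.
rewrite subr0 => h.
have r0 : rsubmx (u *m S) = 0 by apply: dot_eq0; apply/le_anti; rewrite dot_ge0 h.
have uS0 : u *m S = 0 by rewrite -[u *m S]hsubmxK l0 r0 row_mx0.
by have := row_free_ker Sf uS0; move/eqP; rewrite (negPf u0).
Qed.

Lemma inertia_nonneg a b k (S : 'M[C]_(k, a + b)) : row_free S ->
  (forall u : 'rV_k, 0 <= hf (u *m S) (u *m S)) -> (k <= b)%N.
Proof.
move=> Sf Sn; rewrite leqNgt; apply/negP => /(exists_ker (rsubmx S))[u u0 uS].
have r0 : rsubmx (u *m S) = 0 by rewrite -mulmx_rsub.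
have := Sn u; rewrite /hf r0 /dot.
rewrite [X in X - _]big1 => [|j _]; last by rewrite mxE mul0r.
rewrite sub0r oppr_ge0 => h.
have l0 : lsubmx (u *m S) = 0 by apply: dot_eq0; apply/le_anti; rewrite dot_ge0 h.
have uS0 : u *m S = 0 by rewrite -[u *m S]hsubmxK l0 r0 row_mx0.
by have := row_free_ker Sf uS0; move/eqP; rewrite (negPf u0).
Qed.

(** * Completing orthonormal families in an indefinite space *)

Section Extension.
Variables (p : nat) (H : 'M[C]_p) (b : nat).
Hypothesis Hherm : adj H = H.
Hypothesis Hb : forall k (S : 'M[C]_(k, p)), row_free S ->
  (forall u : 'rV_k, 0 <= (u *m S *m H *m adj (u *m S)) 0 0) -> (k <= b)%N.

Lemma form_real (x : 'rV[C]_p) : (x *m H *m adj x) 0 0 \is Num.real.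
Proof.
apply/CrealP; rewrite -adjE; congr (_ 0 0).
by rewrite !adjM adjK Hherm mulmxA.
Qed.

(* If the orthogonal complement of Tn and Tp carried no negative vector, its sum
   with Tp would be a nonnegative subspace of dimension at least p - i. *)
Lemma exists_negative i j (Tn : 'M[C]_(i, p)) (Tp : 'M[C]_(j, p)) : (i + b < p)%N ->
  Tp *m H *m adj Tp = 1%:M ->
  exists x : 'rV_p, [/\ x *m H *m adj Tn = 0, x *m H *m adj Tp = 0 &
    x *m H *m adj x = - 1%:M].
Proof.
move=> ib hTp.
pose A := H *m adj (col_mx Tn Tp).
have AE (x : 'rV_p) : x *m A = 0 -> x *m H *m adj Tn = 0 /\ x *m H *m adj Tp = 0.
  rewrite /A adj_col_mx mulmxA mul_mx_row => h; split.
    by have := congr1 lsubmx h; rewrite row_mxKl linear0.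
  by have := congr1 rsubmx h; rewrite row_mxKr linear0.
have [x xA xneg] : exists2 x : 'rV_p, x *m A = 0 & (x *m H *m adj x) 0 0 < 0.
  apply: contrapT => noneg.
  have [K Kf KA] : exists2 K : 'M[C]_(\rank (kermx A), p), row_free K &
      forall u : 'rV_(\rank (kermx A)), u *m K *m A = 0.
    exists (row_base (kermx A)) => [|u]; first exact: row_base_free.
    apply/sub_kermxP; rewrite (submx_trans (submxMl _ _)) //.
    by rewrite eq_row_base.
  pose S := col_mx K Tp.
  have cross (u : 'rV_(\rank (kermx A))) : u *m K *m H *m adj Tp = 0.
    by have [] := AE _ (KA u).
  have expand (u : 'rV_(\rank (kermx A))) (w : 'rV_j) :
      (row_mx u w *m S) *m H *m adj (row_mx u w *m S) =
      u *m K *m H *m adj (u *m K) + w *m adj w.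
    have c2 : w *m Tp *m H *m adj (u *m K) = 0.
      apply: (can_inj (@adjK _ _)).
      by rewrite !adjM !adjK Hherm adj0 !mulmxA cross mul0mx.
    have c1 : u *m K *m H *m adj (w *m Tp) = 0.
      by rewrite adjM mulmxA cross mul0mx.
    have c3 : w *m Tp *m H *m adj (w *m Tp) = w *m adj w.
      by rewrite adjM !mulmxA -(mulmxA w) -(mulmxA w) hTp mulmx1.
    by rewrite mul_row_col adjD !mulmxDl !mulmxDr c1 c2 c3 addr0 add0r.
  have form_ge0 (x : 'rV_p) : x *m A = 0 -> 0 <= (x *m H *m adj x) 0 0.
    move=> xA; rewrite real_leNgt ?real0 ?form_real //; apply/negP => neg.
    by apply: noneg; exists x.
  have Sf : row_free S.
    apply: inj_row_free => v; rewrite -[v]hsubmxK.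
    set u := lsubmx v; set w := rsubmx v => e0.
    have h : 0 = (u *m K *m H *m adj (u *m K)) 0 0 + dot w w.
      have := congr1 (fun M : 'M[C]_1 => M 0 0) (expand u w).
      by rewrite e0 !mul0mx dotE mxE [RHS]mxE.
    have w0 : w = 0.
      apply: dot_eq0; apply/le_anti; rewrite dot_ge0 andbT.
      by rewrite [X in _ <= X]h lerDr form_ge0.
    have u0 : u = 0.
      apply: (row_free_ker Kf).
      by move: e0; rewrite mul_row_col w0 mul0mx addr0.
    by rewrite u0 w0 row_mx0.
  have := Hb Sf; rewrite leqNgt => /(_ _)/negP; apply.
    move=> v; rewrite -[v]hsubmxK expand mxE addr_ge0 -?dotE ?dot_ge0 //.
    by rewrite dotE; apply: form_ge0; exact: KA.
  have := mxrank_ker A; have := rank_leq_col A; have := rank_leq_row A; lia.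
have n0 : 0 < - (x *m H *m adj x) 0 0 by rewrite oppr_gt0.
pose c := (sqrtC (- (x *m H *m adj x) 0 0))^-1.
have xT := AE _ xA.
exists (c *: x); split; rewrite -!scalemxAl ?xT.1 ?xT.2 ?scaler0 //.
have c0 : 0 <= c by rewrite invr_ge0 sqrtC_ge0 ltW.
rewrite adjZ -scalemxAr scalerA [x *m H *m _]mx11_scalar scale_scalar_mx -raddfN.
congr (_%:M); rewrite conj_Creal ?ger0_real // /c -expr2 exprVn sqrtCK.
by rewrite invrN mulNr mulVf // lt_eqF.
Qed.

(** Induction on m: the vectors already found join Tn, and the bound b on nonnegative subspaces
    leaves room for one more negative direction. *)
Lemma extend_negative m i j (Tn : 'M[C]_(i, p)) (Tp : 'M[C]_(j, p)) :
  (i + m + b <= p)%N -> Tn *m H *m adj Tn = - 1%:M -> Tp *m H *m adj Tp = 1%:M ->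
  exists S : 'M[C]_(m, p), [/\ S *m H *m adj S = - 1%:M,
    S *m H *m adj Tn = 0 & S *m H *m adj Tp = 0].
Proof.
move=> + hTn hTp; elim: m => [|m IH] imb.
  by exists 0; rewrite !mul0mx; split=> //; apply/matrixP => -[].
have [|S [SS Sn Sp]] := IH; first lia.
have [||x [xn xp xx]] := @exists_negative (i + m) j (col_mx Tn S) Tp => //; first lia.
move: xn; rewrite adj_col_mx mul_mx_row => h.
have x1 : x *m H *m adj Tn = 0 by have := congr1 lsubmx h; rewrite row_mxKl linear0.
have x2 : x *m H *m adj S = 0 by have := congr1 rsubmx h; rewrite row_mxKr linear0.
have x3 : S *m H *m adj x = 0.
  apply: (can_inj (@adjK _ _)).
  by rewrite !adjM !adjK Hherm adj0 mulmxA.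
suff : exists S' : 'M[C]_(1 + m, p), [/\ S' *m H *m adj S' = - 1%:M,
    S' *m H *m adj Tn = 0 & S' *m H *m adj Tp = 0] by [].
exists (col_mx x S); split.
- rewrite !mul_col_mx adj_col_mx !mul_mx_row xx x2 x3 SS.
  by rewrite [in RHS]scalar_mx_block opp_block_mx !oppr0.
- by rewrite !mul_col_mx x1 Sn col_mx0.
- by rewrite !mul_col_mx xp Sp col_mx0.
Qed.

End Extension.

(** Stands in for dimension arguments: P need not be stable under linear combinations, only the
    number of rows is bounded. *)
Lemma exists_max_rows (T : Type) p q (P : forall n, 'M[T]_(n, q) -> Prop) :
  (exists M : 'M[T]_(0, q), P 0%N M) -> (forall n M, P n M -> (n <= p)%N) ->
  exists n, exists2 M : 'M[T]_(n, q), P n M & forall M' : 'M[T]_(1 + n, q), ~ P _ M'.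
Proof.
move=> P0 Pp; pose b n := asbool (exists M : 'M[T]_(n, q), P n M).
have b0 : exists n, b n by exists 0%N; apply/asboolP.
have bp n : b n -> (n <= p)%N by move=> /asboolP[M /Pp].
case: (ex_maxnP b0 bp) => n /asboolP[M PM] nmax; exists n, M => // M' PM'.
have : b n.+1 by apply/asboolP; exists M'.
by move=> /nmax; rewrite ltnn.
Qed.

Lemma row_free_col_mx n q (x : 'rV[C]_q) (M : 'M[C]_(n, q)) : row_free M ->
  ~~ (x <= M)%MS -> row_free (col_mx x M).
Proof.
move=> Mf xM; apply: inj_row_free => v; rewrite -[v]hsubmxK mul_row_col.
set a := lsubmx v; set w := rsubmx v.
move=> e00; have e0 : a 0 0 *: x + w *m M = 0 by rewrite -mul_scalar_mx -mx11_scalar.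
have a0 : a 0 0 = 0.
  apply/eqP; apply: contraNT xM => a0.
  have -> : x = (- (a 0 0)^-1 *: w) *m M.
    rewrite -scalemxAl; apply: (scalerI a0); rewrite scalerA mulrN divff // scaleN1r.
    by apply/eqP; rewrite -addr_eq0 e0.
  exact: submxMl.
rewrite a0 scale0r add0r in e0.
have az : a = 0 by rewrite [LHS]mx11_scalar a0 raddf0.
by rewrite (row_free_ker Mf e0) az row_mx0.
Qed.

(** A maximal independent family inside A. Later on the basis vectors must themselves be values of a
    map, not merely elements of the span of its values. *)
Lemma spanning_rows q (A : 'rV[C]_q -> Prop) : exists n, exists M : 'M[C]_(n, q),
  [/\ row_free M, forall i, A (row i M) & forall x, A x -> (x <= M)%MS].
Proof.
pose P n (M : 'M[C]_(n, q)) := row_free M /\ forall i, A (row i M).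
have [||n [M [Mf MA] Mmax]] := @exists_max_rows C q q P.
- by exists 0; split=> [|[]//]; apply: inj_row_free => v _; apply/rowP => -[].
- by move=> n M [Mf _]; rewrite -(eqP Mf) rank_leq_col.
exists n, M; split=> // x Ax; apply/negPn/negP => xM.
apply: (Mmax (col_mx x M)); split; first exact: row_free_col_mx.
move=> i; rewrite -(splitK i); case: fintype.split => k /=.
  by rewrite rowKu; have -> : row k x = x by apply/rowP => j; rewrite mxE ord1.
by rewrite rowKd.
Qed.

(** The definite case of [extend_negative]: for the form [- 1%:M] a nonnegative subspace is zero, so
    b = 0. *)
Lemma orthonormal_extension r m1 q (X : 'M[C]_(r, q)) : (r + m1 <= q)%N ->
  X *m adj X = 1%:M ->
  exists S : 'M[C]_(m1, q), [/\ S *m adj S = 1%:M, S *m adj X = 0 & X *m adj S = 0].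
Proof.
move=> rq XX.
have [|||||S [SS SX _]] := @extend_negative q (- 1%:M) 0 _ _ m1 r 0 X 0.
- by rewrite adjN adj1.
- move=> k S Sf Sn; rewrite leqn0; apply/eqP.
  case: k S Sf Sn => // k S Sf Sn.
  have := Sn (delta_mx 0 0 : 'rV_k.+1); rewrite mulmxN mulmx1 mulNmx mxE -dotE oppr_ge0 => h.
  have : (delta_mx 0 0 : 'rV_k.+1) *m S = 0.
    by apply: dot_eq0; apply/le_anti; rewrite dot_ge0 h.
  move=> /(row_free_ker Sf)/rowP/(_ 0); rewrite !mxE eqxx => /eqP.
  by rewrite oner_eq0.
- by rewrite addn0.
- by rewrite mulmxN mulmx1 mulNmx XX.
- by rewrite mul0mx; apply/matrixP => -[].
move: SS SX; rewrite !mulmxN !mulmx1 !mulNmx => /oppr_inj SS /eqP; rewrite oppr_eq0 => /eqP SX.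
exists S; split=> //.
by apply: (can_inj (@adjK _ _)); rewrite adjM adjK adj0.
Qed.

Lemma unitary_completion r m1 (X : 'M[C]_(r, r + m1)) : X *m adj X = 1%:M ->
  exists U : 'M[C]_(r + m1), U *m adj U = 1%:M /\ usubmx U = X.
Proof.
move=> XX; have [S [SS SX XS]] := orthonormal_extension (leqnn _) XX.
exists (col_mx X S); split; last by rewrite col_mxKu.
by rewrite adj_col_mx mul_col_row XX SS SX XS -scalar_mx_block.
Qed.

(** Serves to place a given null vector in a totally null subspace of dimension d + 1, spanned by
    pairs of frame vectors. *)
Lemma orthonormal_frame d q (x : 'rV[C]_q) : (d < q)%N -> x != 0 ->
  exists A : 'M[C]_(1 + d, q),
    A *m adj A = 1%:M /\ x = row_mx (sqrtC (dot x x))%:M 0 *m A.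
Proof.
move=> dq x0; have q0 : 0 < dot x x.
  by rewrite lt_def dot_ge0 andbT; apply: contraNneq x0 => /dot_eq0 ->.
pose s := sqrtC (dot x x); have s0 : 0 < s by rewrite sqrtC_gt0.
pose X := s^-1 *: x.
have XX : X *m adj X = 1%:M.
  rewrite /X -scalemxAl adjZ -scalemxAr scalerA [x *m _]mx11_scalar -dotE.
  rewrite scale_scalar_mx conj_Creal ?ger0_real ?invr_ge0 ?ltW //.
  by rewrite -expr2 exprVn sqrtCK mulVf ?gt_eqF.
have [S [SS SX XS]] := @orthonormal_extension 1 d q X dq XX.
exists (col_mx X S); split.
  by rewrite adj_col_mx mul_col_row XX SS SX XS -scalar_mx_block.
by rewrite mul_row_col mul0mx addr0 mul_scalar_mx scalerA divff ?scale1r ?gt_eqF.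
Qed.

(** The residue z of y along x is orthogonal to x; by hypothesis y is then orthogonal to z, and so z
    is orthogonal to itself. *)
Lemma proportional q (x y : 'rV[C]_q) :
  (forall v : 'rV_q, x *m adj v = 0 -> y *m adj v = 0) -> exists k, y = k *: x.
Proof.
move=> H; pose k := dot y x / dot x x; exists k.
pose z := y - k *: x.
have xx0 : dot x x = 0 -> x = 0 by exact: dot_eq0.
have zx : z *m adj x = 0.
  rewrite /z mulmxBl -scalemxAl; have [->|x0] := eqVneq x 0.
    by rewrite adj0 !mulmx0 scaler0 subrr.
  rewrite [y *m _]mx11_scalar [x *m _]mx11_scalar -!dotE scale_scalar_mx /k divfK ?subrr //.
  by apply: contraNneq x0 => /xx0 ->.
have xz : x *m adj z = 0 by apply: (can_inj (@adjK _ _)); rewrite adjM adjK zx adj0.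
apply/eqP; rewrite -subr_eq0 -/z; apply/eqP/dot_eq0.
by rewrite dotE {1}/z mulmxBl H // -scalemxAl xz scaler0 subrr mxE.
Qed.

Lemma orthonormal_rows_leq r m (X : 'M[C]_(r, m)) : X *m adj X = 1%:M -> (r <= m)%N.
Proof.
move=> XX; have Xf : row_free X by apply/row_freeP; exists (adj X).
by rewrite -(eqP Xf) rank_leq_col.
Qed.

Lemma nth_row m (x : 'rV[C]_m) (i : 'I_m) : [seq x 0 i | i : 'I_m]`_i = x 0 i.
Proof.
have im : (i < size (enum 'I_m))%N by rewrite size_enum_ord.
by rewrite /image_mem (nth_map i) // nth_ord_enum.
Qed.

Lemma nth_row_out m (x : 'rV[C]_m) (k : nat) : (m <= k)%N ->
  [seq x 0 i | i : 'I_m]`_k = 0.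
Proof. by move=> mk; rewrite nth_default // size_map size_enum_ord. Qed.

(* Two families of vectors with the same Gram matrix differ by a partial isometry;
   in suitable orthonormal bases they become equal up to padding by zeros. *)
Lemma same_gram n m k (A : 'M[C]_(n, m)) (B : 'M[C]_(n, k)) :
  A *m adj A = B *m adj B ->
  exists U : 'M[C]_m, exists V : 'M[C]_k, [/\ U *m adj U = 1%:M, V *m adj V = 1%:M &
    forall c : 'rV_n, forall j : 'I_k,
      (c *m B *m adj V) 0 j = [seq (c *m A *m adj U) 0 i | i : 'I_m]`_j].
Proof.
move=> AB.
(* The rows of W are coefficients whose combinations of the rows of A are orthonormal. A maximal W
   gives an orthonormal basis of the row space of A and, the Gram matrices being equal, also of that
   of B. *)
pose P r (W : 'M[C]_(r, n)) := W *m A *m adj (W *m A) = 1%:M.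
have [||r [W PW Wmax]] := @exists_max_rows C m n P.
- by exists 0; rewrite /P !mul0mx; apply/matrixP => -[].
- by move=> r W /orthonormal_rows_leq.
pose X := W *m A; pose Y := W *m B.
have XX : X *m adj X = 1%:M by [].
have gram (D E : 'M[C]_(r, n)) : D *m A *m adj (E *m A) = D *m B *m adj (E *m B).
  by rewrite !adjM !mulmxA -!(mulmxA D) AB.
have YY : Y *m adj Y = 1%:M by rewrite -gram.
have rm := orthonormal_rows_leq XX; have rk := orthonormal_rows_leq YY.
have resid (c : 'rV_n) : c *m A = c *m A *m adj X *m X.
  pose d := c - c *m A *m adj X *m W.
  have dA : d *m A = c *m A - c *m A *m adj X *m X by rewrite mulmxBl -!mulmxA.
  have dX : d *m A *m adj X = 0 by rewrite dA mulmxBl -(mulmxA _ X) XX mulmx1 subrr.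
  apply/eqP; rewrite -subr_eq0 -dA; apply/negPn/negP => dA0.
  have q0 : 0 < dot (d *m A) (d *m A).
    by rewrite lt_def dot_ge0 andbT; apply: contraNneq dA0 => /dot_eq0 ->.
  pose s := (sqrtC (dot (d *m A) (d *m A)))^-1.
  apply: (Wmax (col_mx (s *: d) W)); rewrite /P mul_col_mx adj_col_mx mul_col_row.
  have c1 : s *: d *m A *m adj (W *m A) = 0 by rewrite -!scalemxAl dX scaler0.
  have c2 : W *m A *m adj (s *: d *m A) = 0.
    by apply: (can_inj (@adjK _ _)); rewrite adjM adjK c1 adj0.
  rewrite c1 c2 PW -scalemxAl adjZ -scalemxAl -scalemxAr scalerA.
  have s0 : 0 <= s by rewrite invr_ge0 sqrtC_ge0 dot_ge0.
  rewrite [d *m A *m _]mx11_scalar -dotE scale_scalar_mx conj_Creal ?ger0_real //.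
  rewrite /s -expr2 exprVn sqrtCK mulVf ?gt_eqF //.
  by rewrite -scalar_mx_block.
have residB (c : 'rV_n) : c *m B = c *m A *m adj X *m Y.
  pose d := c - c *m A *m adj X *m W.
  have dA : d *m A = 0.
    by rewrite mulmxBl -(mulmxA _ W) -resid subrr.
  have dB : d *m B = 0.
    apply: dot_eq0; rewrite dotE adjM !mulmxA -(mulmxA d) -AB mulmxA dA.
    by rewrite !mul0mx mxE.
  by move/eqP: dB; rewrite mulmxBl -(mulmxA _ W) subr_eq0 => /eqP.
clearbody X Y.
have [m1 Em] : exists m1, m = (r + m1)%N by exists (m - r)%N; rewrite subnKC.
have [k1 Ek] : exists k1, k = (r + k1)%N by exists (k - r)%N; rewrite subnKC.
clear PW Wmax gram; subst m; subst k.
have [U [UU UX]] := unitary_completion XX.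
have [V [VV VY]] := unitary_completion YY.
exists U, V; split=> // c j.
have top p1 (Q : 'M[C]_(r + p1)) (z : 'rV_r) : Q *m adj Q = 1%:M ->
    z *m usubmx Q *m adj Q = row_mx z 0.
  move=> QQ; rewrite -mulmxA mul_usub_mx QQ scalar_mx_block.
  by rewrite /block_mx col_mxKu mul_mx_row mulmx1 mulmx0.
have [z [-> ->]] : exists z, c *m B = z *m usubmx V /\ c *m A = z *m usubmx U.
  by exists (c *m A *m adj X); rewrite UX VY -residB -resid.
rewrite !top // -(splitK j); case: fintype.split => i /=.
  rewrite row_mxEl.
  have -> : nat_of_ord i = nat_of_ord (lshift m1 i) by [].
  by rewrite nth_row row_mxEl.
rewrite row_mxEr mxE.
(* Beyond the first r entries both sides vanish; if k > m the index may exceed m, and then the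
   default value 0 is read. *)
case: (ltnP (r + i)%N (r + m1)%N) => [h|h]; last by rewrite nth_row_out.
have him : (i < m1)%N by rewrite -(ltn_add2l r).
have -> : (r + i)%N = nat_of_ord (rshift r (Ordinal him)) by [].
by rewrite nth_row row_mxEr mxE.
Qed.

Lemma hf_mx a b n k (A : 'M[C]_(n, a + b)) (B : 'M[C]_(k, a + b)) i j :
  (A *m sgmx a b *m adj B) i j = hf (row i A) (row j B).
Proof. by rewrite mulmx3E hfE. Qed.

Lemma hf_mx1 a b (x y : 'rV[C]_(a + b)) : x *m sgmx a b *m adj y = (hf x y)%:M.
Proof. by rewrite [LHS]mx11_scalar hfE. Qed.

(** * Frames adapted to the form and Witt's theorem *)

Section Frame.
Variables (p : nat) (H : 'M[C]_p).
Hypothesis Hherm : adj H = H.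

Lemma ortho_sym n k (A : 'M[C]_(n, p)) (B : 'M[C]_(k, p)) :
  A *m H *m adj B = 0 -> B *m H *m adj A = 0.
Proof.
move=> AB; apply: (can_inj (@adjK _ _)).
by rewrite !adjM !adjK Hherm adj0 mulmxA.
Qed.

Lemma adj_form n k (A : 'M[C]_(n, p)) (B : 'M[C]_(k, p)) :
  adj (A *m H *m adj B) = B *m H *m adj A.
Proof. by rewrite !adjM adjK Hherm mulmxA. Qed.

End Frame.

(** The Gram matrix is Hermitian, so one block of each off-diagonal pair determines it. *)
Lemma gram_frame a b m k (P := ((a + m) + (b + k))%N) (J' := sgmx (a + m) (b + k))
    (Tn : 'M[C]_(a, P)) (Sn : 'M[C]_(m, P)) (Tp : 'M[C]_(b, P)) (Sp : 'M[C]_(k, P)) :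
  Tn *m J' *m adj Tn = - 1%:M -> Sn *m J' *m adj Sn = - 1%:M ->
  Tp *m J' *m adj Tp = 1%:M -> Sp *m J' *m adj Sp = 1%:M ->
  Sn *m J' *m adj Tn = 0 -> Tp *m J' *m adj Tn = 0 -> Sp *m J' *m adj Tn = 0 ->
  Sn *m J' *m adj Tp = 0 -> Sp *m J' *m adj Sn = 0 -> Sp *m J' *m adj Tp = 0 ->
  let G := col_mx (col_mx Tn Sn) (col_mx Tp Sp) in G *m J' *m adj G = J'.
Proof.
move=> h1 h2 h3 h4 h5 h6 h7 h8 h9 h10 G.
have J'h : adj J' = J' by exact: adj_sgmx.
rewrite /G !adj_col_mx !(mul_col_mx _ _ J') !mul_col_row h1 h2 h3 h4 h5 h6 h7 h8 h9 h10.
rewrite (ortho_sym J'h h5) (ortho_sym J'h h6) (ortho_sym J'h h7) (ortho_sym J'h h8).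
rewrite (ortho_sym J'h h9) (ortho_sym J'h h10) !block_mx0.
by rewrite /J' /sgmx !scalar_mx_block opp_block_mx !oppr0.
Qed.

Lemma mulmxA3 n1 n2 n3 n4 n5 (A : 'M[C]_(n1, n2)) (B : 'M[C]_(n2, n3))
    (D : 'M[C]_(n3, n4)) (E : 'M[C]_(n4, n5)) : A *m B *m D *m E = A *m (B *m D *m E).
Proof. by rewrite !mulmxA. Qed.

(** Yields the coordinates of a vector x in the frame G, as x = (x J' G^* J') G. *)
Lemma frame_expand P (J' : 'M[C]_P) (G : 'M[C]_P) : J' *m J' = 1%:M ->
  G *m J' *m adj G = J' -> J' *m adj G *m J' *m G = 1%:M.
Proof.
move=> JJ GG; have : G *m (J' *m adj G *m J') = 1%:M by rewrite !mulmxA GG JJ.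
by move=> /mulmx1C.
Qed.

(* Witt's theorem in the form needed: vectors v s with the same Gram matrix as
   vectors e s spanning a nondegenerate space differ from them, after an isometry
   of the target, by vectors of a totally null subspace. *)
Lemma isometric_normal_form a b m k (S : Type) (e : S -> 'rV[C]_(a + b))
    (v : S -> 'rV[C]_((a + m) + (b + k))) (s0 : S) :
  (forall s t, hf (v s) (v t) = hf (e s) (e t)) ->
  (forall w : 'cV_(a + b), (forall s, e s *m w = 0) -> w = 0) ->
  e s0 != 0 ->
  exists G : 'M[C]_((a + m) + (b + k)),
    G *m sgmx _ _ *m adj G = sgmx _ _ /\
    forall s, exists psi : 'rV[C]_m,
      v s = row_mx (row_mx (lsubmx (e s)) psi)
              (row_mx (rsubmx (e s)) (\row_j [seq psi 0 i | i : 'I_m]`_j)) *m G /\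
      (s = s0 -> psi = 0).
Proof.
move=> ve espan e0.
set J' := sgmx (a + m) (b + k); set J := sgmx a b.
have J'h : adj J' = J' by exact: adj_sgmx.
have Jh : adj J = J by exact: adj_sgmx.
have [n [M [Mf Me Mspan]]] := spanning_rows (fun x => exists s, x = e s).
have [pick pickE] : exists pick : 'I_n -> S, forall i, row i M = e (pick i).
  by have [f fP] := choice Me; exists f.
have [Mi MiM] : exists Mi, Mi *m M = 1%:M.
  apply/row_fullP; rewrite /row_full -mxrank_tr; apply: inj_row_free => w wM.
  suff wt : w^T = 0 by rewrite -[w]trmxK wt trmx0.
  apply: espan => s; have /submxP[c ->] := Mspan _ (ex_intro _ s erefl).
  rewrite -mulmxA; have -> : M *m w^T = 0 by rewrite -[M]trmxK -trmx_mul wM trmx0.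
  by rewrite mulmx0.
pose V0 : 'M[C]_(n, _) := \matrix_i v (pick i).
have vV s : v s *m J' *m adj V0 = e s *m J *m adj M.
  apply/matrixP => i j; rewrite (ord1 i) !hf_mx !row_id rowK pickE.
  exact: ve.
have VV : V0 *m J' *m adj V0 = M *m J *m adj M.
  by apply/matrixP => i j; rewrite !hf_mx !rowK !pickE; exact: ve.
(* T extends linearly the assignment of v to e on the basis M. It is isometric, and the residuals
   [r s] are orthogonal to its image and to one another. *)
pose T := Mi *m V0.
have TT : T *m J' *m adj T = J.
  have -> : T *m J' *m adj T = Mi *m (V0 *m J' *m adj V0) *m adj Mi.
    by rewrite /T adjM !mulmxA.
  rewrite VV.
  by rewrite !mulmxA MiM mul1mx -mulmxA -adjM MiM adj1 mulmx1.
have vT s : v s *m J' *m adj T = e s *m J.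
  by rewrite /T adjM mulmxA vV -mulmxA -adjM MiM adj1 mulmx1.
have Tv s : T *m J' *m adj (v s) = J *m adj (e s).
  by rewrite -(adj_form J'h) vT adjM Jh.
clearbody T.
pose r s := v s - e s *m T.
have rT s : r s *m J' *m adj T = 0.
  by rewrite /r !mulmxBl vT -!mulmxA (mulmxA T) TT subrr.
have rv s t : r s *m J' *m adj (v t) = 0.
  rewrite /r !mulmxBl -!mulmxA (mulmxA T) Tv !mulmxA !hf_mx1 ve.
  by rewrite -hf_mx1 subrr.
have rr s t : r s *m J' *m adj (r t) = 0.
  have -> : adj (r t) = adj (v t) - adj T *m adj (e t) by rewrite /r adjD adjN adjM.
  by rewrite mulmxBr rv mulmxA rT mul0mx subrr.
have rE s : r s = v s - e s *m T by [].
clearbody r.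
(* The residual at s0 is absorbed into T; this keeps T isometric because the residual is null and
   orthogonal to T. It makes psi vanish at s0, so that the automorphism obtained later fixes the
   origin. *)
have [l le] : exists l : 'cV_(a + b), e s0 *m l = 1%:M.
  exists ((dot (e s0) (e s0))^-1 *: adj (e s0)).
  rewrite -scalemxAr [e s0 *m _]mx11_scalar -dotE scale_scalar_mx mulVf //.
  by apply: contraNneq e0 => /dot_eq0 ->.
pose T' := T + l *m r s0.
have rT' s : r s *m J' *m adj T' = 0.
  by rewrite /T' adjD adjM mulmxDr rT mulmxA rr mul0mx addr0.
have TT' : T' *m J' *m adj T' = J.
  have -> : T' *m J' *m adj T' = T *m J' *m adj T' + l *m (r s0 *m J' *m adj T').
    by rewrite !(mulmxA l) -!mulmxDl.
  rewrite rT' mulmx0 addr0.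
  rewrite /T' adjD adjM mulmxDr TT mulmxA.
  by rewrite (ortho_sym J'h (rT s0)) mul0mx addr0.
pose r' s := v s - e s *m T'.
have r'E s : r' s = r s - (e s *m l) *m r s0.
  by rewrite /r' rE /T' mulmxDr opprD addrA mulmxA rE.
have r'v s : v s = e s *m T' + r' s by rewrite /r' addrC subrK.
clearbody r'.
have r'0 : r' s0 = 0 by rewrite r'E le mul1mx subrr.
have r'T s : r' s *m J' *m adj T' = 0.
  by rewrite r'E !mulmxBl rT' mulmxA3 rT' mulmx0 subrr.
have r'r s t : r' s *m J' *m adj (r' t) = 0.
  have rr' u : r u *m J' *m adj (r' t) = 0.
    by rewrite r'E adjD adjN adjM mulmxBr rr mulmxA rr mul0mx subrr.
  by rewrite r'E !mulmxBl rr' mulmxA3 rr' mulmx0 subrr.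
clearbody T'; clear T TT vT Tv rT rv rr rT' r'E rE r.
have TE : T' = col_mx (usubmx T') (dsubmx T') by rewrite vsubmxK.
set Tn := usubmx T' in TE; set Tp := dsubmx T' in TE.
move: TT'; rewrite {1 2}TE adj_col_mx mul_col_mx mul_col_row /J /sgmx.
move=> /eq_block_mx[t1 t2 t3 t4].
have [||||Sn [s1 s2 s3]] := @extend_negative _ J' (b + k) J'h _ m a b Tn Tp => //.
- move=> j X Xf Xn; apply: (inertia_nonneg Xf) => u; rewrite hfE; exact: Xn.
(* Positive vectors are negative for [- J'], for which the completed negative family Tn, Sn plays
   the role of Tp. *)
have [|||||Sp [p1 p2 p3]] :=
    @extend_negative _ (- J') (a + m) _ _ k b (a + m) Tp (col_mx Tn Sn).
- by rewrite adjN J'h.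
- move=> j X Xf Xn; apply: (inertia_nonpos Xf) => u; rewrite hfE.
  by have := Xn u; rewrite mulmxN mulNmx mxE oppr_ge0.
- by lia.
- by rewrite mulmxN mulNmx t4.
- rewrite mulmxN mulNmx mul_col_mx adj_col_mx mul_col_row t1 s1 s2.
  by rewrite (ortho_sym J'h s2) [in RHS]scalar_mx_block opp_block_mx !oppr0 !opprK.
move: p1 p2 p3; rewrite !mulmxN !mulNmx => /oppr_inj p1.
move=> /eqP; rewrite oppr_eq0 => /eqP p2.
rewrite adj_col_mx mul_mx_row => /eqP; rewrite oppr_eq0 => /eqP p3.
have p4 : Sp *m J' *m adj Tn = 0.
  by have := congr1 lsubmx p3; rewrite row_mxKl linear0.
have p5 : Sp *m J' *m adj Sn = 0.
  by have := congr1 rsubmx p3; rewrite row_mxKr linear0.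
have GG := gram_frame t1 s1 t4 p1 s2 t3 p4 s3 p5 p2.
have [n2 [M2 [M2f Mr2 M2span]]] := spanning_rows (fun x => exists s, x = r' s).
have M2T : M2 *m J' *m adj T' = 0.
  apply/row_matrixP => i; rewrite !row_mul row0.
  by have [s ->] := Mr2 i.
have M2M : M2 *m J' *m adj M2 = 0.
  apply/matrixP => i j; rewrite hf_mx mxE.
  have [s ->] := Mr2 i; have [t ->] := Mr2 j.
  by have := congr1 (fun Q : 'M[C]_1 => Q 0 0) (r'r s t); rewrite -hfE mxE.
have [M2n M2p] : M2 *m J' *m adj Tn = 0 /\ M2 *m J' *m adj Tp = 0.
  move: M2T; rewrite TE adj_col_mx mul_mx_row => h; split.
    by have := congr1 lsubmx h; rewrite row_mxKl linear0.
  by have := congr1 rsubmx h; rewrite row_mxKr linear0.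
(* Coordinates of the residuals along Sn and Sp, the only ones that survive. That the residuals are
   totally null means that A and B have the same Gram matrix; the rotations U and V then turn them
   into the two copies of psi. *)
pose A := - (M2 *m J' *m adj Sn); pose B := M2 *m J' *m adj Sp.
have M2E : M2 = A *m Sn + B *m Sp.
  rewrite -[LHS]mulmx1 -(frame_expand (sgmxK _ _) GG) !mulmxA.
  rewrite !adj_col_mx !mul_mx_row M2n M2p /J' /sgmx mul_row_block.
  rewrite !mulmx0 addr0 add0r mulmx1 mulmxN mulmx1.
  by rewrite opp_row_mx oppr0 !mul_row_col !mul0mx !add0r.
have AB : A *m adj A = B *m adj B.
  move: M2M; rewrite {2}M2E adjD !adjM mulmxDr !mulmxA -/B.
  have -> : M2 *m J' *m adj Sn = - A by rewrite /A opprK.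
  by rewrite mulNmx addrC => /eqP; rewrite subr_eq0 => /eqP.
have [U [V [UU VV' UV]]] := same_gram AB.
have G'G' : let G := col_mx (col_mx Tn (U *m Sn)) (col_mx Tp (V *m Sp)) in
    G *m J' *m adj G = J'.
  apply: gram_frame => //.
  - by rewrite adjM mulmxA -!mulmxA (mulmxA Sn) (mulmxA _ (adj Sn)) s1 mulNmx mul1mx mulmxN UU.
  - by rewrite adjM mulmxA -!mulmxA (mulmxA Sp) (mulmxA _ (adj Sp)) p1 mul1mx VV'.
  - by rewrite mulmxA3 s2 mulmx0.
  - by rewrite mulmxA3 p4 mulmx0.
  - by rewrite mulmxA3 s3 mulmx0.
  - by rewrite mulmxA3 adjM (mulmxA (Sp *m J')) p5 mul0mx mulmx0.
  - by rewrite mulmxA3 p2 mulmx0.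
exists (col_mx (col_mx Tn (U *m Sn)) (col_mx Tp (V *m Sp))); split=> // s.
have [c rc] : exists c, r' s = c *m M2.
  by apply/submxP; apply: M2span; exists s.
exists (c *m A *m adj U); split; last first.
  move=> ss0; rewrite ss0 r'0 in rc.
  by rewrite (row_free_ker M2f (esym rc)) !mul0mx.
have -> : \row_j [seq (c *m A *m adj U) 0 i | i : 'I_m]`_j = c *m B *m adj V.
  by apply/rowP => j; rewrite mxE -UV.
have UU' := mulmx1C UU; have VV'' := mulmx1C VV'.
rewrite !mul_row_col -!(mulmxA _ (adj _)) !(mulmxA (adj _)) UU' VV'' !mul1mx.
have TEs : e s *m T' = lsubmx (e s) *m Tn + rsubmx (e s) *m Tp.
  by rewrite -mul_row_col hsubmxK -TE.
rewrite r'v rc M2E TEs mulmxDr !mulmxA.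
by rewrite addrACA.
Qed.

(** * Linear maps conformal for two signature forms *)

Section ConformalMap.
Variables (a b a' b' : nat) (T : 'M[C]_(a + b, a' + b')) (c : C).
Hypothesis c_gt0 : 0 < c.
Hypothesis TT : T *m sgmx a' b' *m adj T = c *: sgmx a b.

Lemma conformal_form (u : 'rV[C]_(a + b)) :
  u *m T *m sgmx a' b' *m adj T = c *: (u *m sgmx a b).
Proof. by rewrite mulmxA3 TT -scalemxAr. Qed.

Lemma residual_form x k (u : 'rV[C]_(a + b)) :
  x *m sgmx a' b' *m adj T = k *: (u *m sgmx a b) ->
  (x - (c^-1 * k) *: (u *m T)) *m sgmx a' b' *m adj T = 0.
Proof.
move=> h; rewrite !mulmxBl h -!scalemxAl conformal_form scalerA mulrAC mulVf ?mul1r ?subrr //.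
by rewrite gt_eqF.
Qed.

(** Q is independent of x, k and u. Composition with Q thus preserves holomorphy, although nothing
    is known about the way k depends on u. *)
Lemma orthogonal_projection : exists Q : 'M[C]_(a' + b'),
  forall x k (u : 'rV[C]_(a + b)), x *m sgmx a' b' *m adj T = k *: (u *m sgmx a b) ->
  x *m Q = x - (c^-1 * k) *: (u *m T).
Proof.
exists (1%:M - c^-1 *: (sgmx a' b' *m adj T *m sgmx a b *m T)) => x k u h.
rewrite mulmxBr mulmx1 -scalemxAr !mulmxA h.
by rewrite -!scalemxAl -(mulmxA u) sgmxK mulmx1 scalerA.
Qed.

Lemma hf_residual x y k l (u v : 'rV[C]_(a + b)) :
  x *m sgmx a' b' *m adj T = k *: (u *m sgmx a b) ->
  y *m sgmx a' b' *m adj T = l *: (v *m sgmx a b) ->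
  hf x y = hf (x - (c^-1 * k) *: (u *m T)) (y - (c^-1 * l) *: (v *m T))
           + c^-1 * k * l^* * hf u v.
Proof.
move=> hx hy; have hx' := residual_form hx; have hy' := residual_form hy.
set x' := x - _ in hx' *; set y' := y - _ in hy' *.
have xE : x = x' + (c^-1 * k) *: (u *m T) by rewrite subrK.
have yE : y = y' + (c^-1 * l) *: (v *m T) by rewrite subrK.
clearbody x' y'; rewrite xE yE {hx hy xE yE x y}.
have h : (x' + (c^-1 * k) *: (u *m T)) *m sgmx a' b' *m adj (y' + (c^-1 * l) *: (v *m T)) =
    x' *m sgmx a' b' *m adj y' + (c^-1 * k * l^* * hf u v)%:M.
  rewrite adjD adjZ (adjM v T) !mulmxDl !mulmxDr -!scalemxAr -!scalemxAl.
  rewrite (mulmxA (x' *m sgmx a' b')) hx' mul0mx scaler0 addr0.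
  rewrite mulmxA3 (ortho_sym (adj_sgmx _ _) hy') mulmx0 scaler0 add0r.
  rewrite (mulmxA (u *m T *m _)) conformal_form -!scalemxAl (hf_mx1 u v) !scale_scalar_mx.
  congr (_ + _%:M); have cc : c^* = c by rewrite conj_Creal // gtr0_real.
  by rewrite rmorphM fmorphV /= cc; field; rewrite gt_eqF.
rewrite [LHS]hfE h mxE -hfE; congr (_ + _).
by rewrite mxE eqxx.
Qed.

(** Together with the images of the a negative basis vectors, the rows of M span a nonpositive
    subspace, whose dimension is at most a'. *)
Lemma null_rank_bound r (M : 'M[C]_(r, a' + b')) : row_free M ->
  M *m sgmx a' b' *m adj M = 0 -> M *m sgmx a' b' *m adj T = 0 -> (r + a <= a')%N.
Proof.
move=> Mf MM MT; have J'h := adj_sgmx a' b'; set J' := sgmx a' b' in MM MT J'h *.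
pose Tn := usubmx T.
have MTn : M *m J' *m adj Tn = 0.
  move: MT; rewrite -[T]vsubmxK adj_col_mx mul_mx_row => h.
  by have := congr1 lsubmx h; rewrite row_mxKl linear0.
have TnTn : Tn *m J' *m adj Tn = - c%:M.
  move: TT; rewrite -[T]vsubmxK adj_col_mx mul_col_mx mul_col_row [in RHS]/sgmx.
  rewrite scale_block_mx => /eq_block_mx[-> _ _ _].
  by rewrite scalerN scale_scalar_mx mulr1.
pose S := col_mx M Tn.
have SS (u : 'rV_(r + a)) : u *m S *m J' *m adj (u *m S) =
    (- (c * dot (rsubmx u) (rsubmx u)))%:M.
  rewrite -[u in u *m S]hsubmxK mul_row_col.
  set x := lsubmx u; set y := rsubmx u; rewrite adjD !mulmxDl !mulmxDr !adjM.
  rewrite !(mulmxA _ (adj M)) !(mulmxA _ (adj Tn)) !(mulmxA3 x) !(mulmxA3 y).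
  rewrite MM MTn (ortho_sym J'h MTn) TnTn !mulmx0 !mul0mx !add0r.
  rewrite mulmxN mulNmx mul_mx_scalar -scalemxAl [y *m _]mx11_scalar -dotE.
  by rewrite scale_scalar_mx raddfN.
have Sf : row_free S.
  apply: inj_row_free => u uS.
  have := SS u; rewrite uS !mul0mx => /matrixP/(_ 0 0); rewrite !mxE eqxx => /esym/eqP.
  rewrite oppr_eq0 mulf_eq0 gt_eqF //= => /eqP/dot_eq0 w0.
  move: uS; rewrite -[u]hsubmxK mul_row_col w0 mul0mx addr0 => /(row_free_ker Mf) ->.
  by rewrite row_mx0.
apply: (inertia_nonpos Sf) => u; rewrite hfE SS mxE eqxx oppr_le0.
by rewrite mulr_ge0 ?dot_ge0 // ltW.
Qed.

End ConformalMap.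

(** * Totally null subspaces *)

Section NullSubspace.
Variables (d a b : nat) (A : 'M[C]_(d, a)) (B : 'M[C]_(d, b)).
Hypothesis AA : A *m adj A = 1%:M.
Hypothesis BB : B *m adj B = 1%:M.

Lemma null_frame : row_mx A B *m sgmx a b *m adj (row_mx A B) = 0.
Proof.
rewrite /sgmx mul_row_block !mulmx0 mulmxN !mulmx1 addr0 add0r.
by rewrite adj_row_mx mul_row_col mulNmx AA BB addrC subrr.
Qed.

(** A nonzero covector on coefficients kills the r < d rows [p i]; w realizes it through the B half
    alone. *)
Lemma common_orthogonal r (p : 'I_r -> 'rV[C]_d) : (r < d)%N ->
  exists (e : 'rV[C]_d) (w : 'rV[C]_(a + b)),
    hf (e *m row_mx A B) w != 0 /\ forall i, hf (p i *m row_mx A B) w = 0.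
Proof.
move=> rd; pose M : 'M[C]_(r, d) := \matrix_(i < r) p i.
have [u u0 uM] := @exists_ker d r M^T rd.
pose be : 'cV[C]_d := u^T; pose w : 'rV[C]_(a + b) := row_mx 0 (adj be *m B).
have Mbe : M *m be = 0 by rewrite -[M]trmxK -trmx_mul uM trmx0.
have be0 : be != 0 by apply: contraNneq u0 => h; rewrite -[u]trmxK -/be h trmx0.
have Pw (x : 'rV[C]_d) : hf (x *m row_mx A B) w = (x *m be) 0 0.
  rewrite hfE /sgmx -(mulmxA x) mul_row_block !mulmx0 mulmxN !mulmx1 addr0 add0r.
  rewrite /w adj_row_mx adj0 -mulmxA mul_row_col mulmx0 add0r adjM adjK (mulmxA B).
  by rewrite BB mul1mx.
exists (adj be), w; split=> [|i]; rewrite Pw.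
  rewrite -[X in _ *m X]adjK -dotE.
  by apply: contraNneq be0 => /dot_eq0 h; rewrite -[be]adjK h adj0.
have -> : p i = row i M by rewrite rowK.
by rewrite -row_mul Mbe row0 mxE.
Qed.

End NullSubspace.

Lemma hf_line a b (x v w : 'rV[C]_(a + b)) t : hf (v + t *: w) x = hf v x + t * hf w x.
Proof. by rewrite !hfE !mulmxDl mxE -!scalemxAl [X in _ + X]mxE. Qed.

Lemma hfZ a b (x v : 'rV[C]_(a + b)) t : hf (t *: v) x = t * hf v x.
Proof. by rewrite !hfE -!scalemxAl mxE. Qed.

Lemma hfDl a b (x y z : 'rV[C]_(a + b)) : hf (x + y) z = hf x z + hf y z.
Proof. by rewrite !hfE !mulmxDl mxE. Qed.

Lemma hfDr a b (x y z : 'rV[C]_(a + b)) : hf z (x + y) = hf z x + hf z y.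
Proof. by rewrite -hf_conj hfDl rmorphD /= !hf_conj. Qed.

Lemma hfZr a b (x v : 'rV[C]_(a + b)) t : hf x (t *: v) = t^* * hf x v.
Proof. by rewrite -hf_conj hfZ rmorphM /= hf_conj. Qed.

Lemma hfNl a b (x z : 'rV[C]_(a + b)) : hf (- x) z = - hf x z.
Proof. by rewrite -scaleN1r hfZ mulN1r. Qed.

Lemma hfNr a b (x z : 'rV[C]_(a + b)) : hf z (- x) = - hf z x.
Proof. by rewrite -hf_conj hfNl rmorphN /= hf_conj. Qed.

Lemma hf0l a b (x : 'rV[C]_(a + b)) : hf 0 x = 0.
Proof. by rewrite -(scale0r (0 : 'rV[C]_(a + b))) hfZ mul0r. Qed.

Lemma hf0r a b (x : 'rV[C]_(a + b)) : hf x 0 = 0.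
Proof. by rewrite -hf_conj hf0l conjC0. Qed.

(** The conjugate parameter in the second argument makes the value a polynomial in t, hence
    holomorphic. *)
Lemma hf_quadratic a b (A B : 'rV[C]_(a + b)) t :
  hf (A + t *: B) (A + t^* *: B) = hf A A + t * (hf A B + hf B A) + t ^+ 2 * hf B B.
Proof.
rewrite hfDl !hfDr !hfZ !hfZr conjCK.
by move: (hf A A) (hf A B) (hf B A) (hf B B) => h1 h2 h3 h4; ring.
Qed.

(** Basis vectors being eigenvectors makes N diagonal; the sum of two of them equates their
    eigenvalues. *)
Lemma scalar_of_eigen q (N : 'M[C]_q) : (forall u : 'rV_q, exists k, u *m N = k *: u) ->
  exists c, N = c%:M.
Proof.
case: q N => [|q] N H; first by exists 0; apply/matrixP => -[].
have ent (u : 'rV[C]_q.+1) k i : u *m N = k *: u -> (u *m N) 0 i = k * u 0 i.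
  by move=> ->; rewrite mxE.
have dN i j : (delta_mx 0 i *m N : 'rV_q.+1) 0 j = N i j by rewrite -rowE mxE.
have off i j : i != j -> N i j = 0.
  move=> ij; have [k /ent h] := H (delta_mx 0 i); have := h j.
  by rewrite dN mxE eqxx /= eq_sym (negPf ij) mulr0.
exists (N 0 0); apply/matrixP => i j; rewrite mxE.
have [<-|ij] := eqVneq i j; rewrite ?mulr0n ?mulr1n; last exact: off.
have [->//|i0] := eqVneq i 0.
have [k /ent h] := H (delta_mx 0 i + delta_mx 0 0).
have eD j1 : ((delta_mx 0 i + delta_mx 0 0 : 'rV_q.+1) *m N) 0 j1 = N i j1 + N 0 j1.
  by rewrite mulmxDl mxE !dN.
have := h i; have := h 0; rewrite !eD !mxE !eqxx [0 == i]eq_sym (negPf i0) /=.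
by rewrite (off i 0 i0) (off 0 i) 1?eq_sym // !(add0r, addr0) !mulr1 => -> ->.
Qed.

Lemma conformal_of_orthogonal a b a' b' (T : 'M[C]_(a + b, a' + b')) :
  (forall u v, hf u v = 0 -> hf (u *m T) (v *m T) = 0) ->
  exists c, T *m sgmx a' b' *m adj T = c *: sgmx a b.
Proof.
move=> H; have [|c cE] := @scalar_of_eigen _ (T *m sgmx a' b' *m adj T *m sgmx a b).
  move=> u; have [|k kE] := @proportional _ (u *m sgmx a b) (u *m T *m sgmx a' b' *m adj T).
    move=> v uv; have uv0 : hf u v = 0 by rewrite hfE uv mxE.
    by rewrite -mulmxA -adjM hf_mx1 H // raddf0.
  exists k; rewrite !mulmxA kE -scalemxAl -(mulmxA u) sgmxK mulmx1 //.
exists c; rewrite -[LHS]mulmx1 -(sgmxK a b) mulmxA cE.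
by rewrite mul_scalar_mx.
Qed.

Lemma hf_delta a b (i : 'I_a) (x : 'rV[C]_(a + b)) :
  hf (delta_mx 0 (lshift b i)) x = - (x 0 (lshift b i))^*.
Proof.
rewrite /hf /dot [X in X - _]big1 => [|j _].
  rewrite sub0r; congr (- _); rewrite (bigD1 i) //= big1 => [|j ji].
    by rewrite addr0 !mxE !eqxx mul1r.
  by rewrite !mxE eqxx /= (inj_eq (@lshift_inj _ _)) (negPf ji) mul0r.
by rewrite !mxE eqxx /= eq_rlshift mul0r.
Qed.

Lemma hf_colE a b (x y : 'rV[C]_(a + b)) : hf x y = (x *m (sgmx a b *m adj y)) 0 0.
Proof. by rewrite hfE mulmxA. Qed.

End LinearAlgebra.

Arguments sgmx {C} a b.

(** * Homogeneous coordinates and the affine chart *)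

Section Projective.
Variable C : numClosedFieldType.

(* Homogeneous coordinates in which the hyperquadric becomes the null cone of a
   Hermitian form with one more square of each sign. *)
Definition hom a b (Z : 'rV[C]_(a + b) * C) : 'rV[C]_((1 + a) + (1 + b)) :=
  row_mx (row_mx ((Z.2 + 'i) / 2)%:M (lsubmx Z.1)) (row_mx ((Z.2 - 'i) / 2)%:M (rsubmx Z.1)).

(** The linear form equal to 1 on the image of [hom]; its kernel is the hyperplane at infinity of
    the chart. *)
Definition den a b (y : 'rV[C]_((1 + a) + (1 + b))) : C :=
  (lsubmx (lsubmx y) 0 0 - lsubmx (rsubmx y) 0 0) / 'i.

Definition dehom a b (y : 'rV[C]_((1 + a) + (1 + b))) : 'rV[C]_(a + b) * C :=
  ((den y)^-1 *: row_mx (rsubmx (lsubmx y)) (rsubmx (rsubmx y)),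
   (lsubmx (lsubmx y) 0 0 + lsubmx (rsubmx y) 0 0) / den y).

Lemma dot_row_mx p q (x x' : 'rV[C]_p) (y y' : 'rV[C]_q) :
  dot (row_mx x y) (row_mx x' y') = dot x x' + dot y y'.
Proof.
by rewrite /dot big_split_ord; congr (_ + _); apply: eq_bigr => i _;
  rewrite ?row_mxEl ?row_mxEr.
Qed.

Lemma dot_scalar (x y : C) : dot (x%:M : 'rV_1) (y%:M : 'rV_1) = x * y^*.
Proof. by rewrite /dot big_ord1 !mxE !eqxx !mulr1n. Qed.

(** Polarized form of |w - i|^2 / 4 - |w + i|^2 / 4 = - Im w, which explains the two extra
    coordinates. *)
Lemma hf_hom a b (Z W : 'rV[C]_(a + b) * C) :
  hf (hom Z) (hom W) = hf Z.1 W.1 - (Z.2 - W.2^*) / (2 * 'i).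
Proof.
have i0 : 'i != 0 :> C by exact: neq0Ci.
have ii : 'i * 'i = -1 :> C by rewrite -expr2 sqrCi.
have E : ((W.2 - 'i) / 2)^* = (W.2^* + 'i) / 2.
  by rewrite rmorphM rmorphB /= conjCi opprK fmorphV rmorph_nat.
have E' : ((W.2 + 'i) / 2)^* = (W.2^* - 'i) / 2.
  by rewrite rmorphM rmorphD /= conjCi fmorphV rmorph_nat.
rewrite /hf /hom !row_mxKl !row_mxKr !dot_row_mx !dot_scalar E E'.
have V : (2 * 'i)^-1 = - 'i / 2 :> C.
  have i20 : 2 * 'i != 0 :> C by rewrite mulf_neq0 ?pnatr_eq0.
  apply: (mulfI i20); rewrite mulfV //.
  have -> : 2 * 'i * (- 'i / 2) = - ('i * 'i) :> C by field.
  by rewrite ii opprK.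
rewrite V; move: (dot _ _) (dot _ _) (W.2^*) (Z.2) => x y w z.
have -> : (z - 'i) / 2 * ((w + 'i) / 2) = (z * w + z * 'i - 'i * w - 'i * 'i) / 4 by field.
have -> : (z + 'i) / 2 * ((w - 'i) / 2) = (z * w - z * 'i + 'i * w - 'i * 'i) / 4 by field.
by field.
Qed.

Lemma denZ a b c (y : 'rV[C]_((1 + a) + (1 + b))) : den (c *: y) = c * den y.
Proof. by rewrite /den !linearZ /= !mxE -mulrBr mulrA. Qed.

Lemma dehomZ a b c (y : 'rV[C]_((1 + a) + (1 + b))) : c != 0 -> dehom (c *: y) = dehom y.
Proof.
move=> c0; rewrite /dehom denZ; congr (_, _).
  rewrite !linearZ /= -scale_row_mx scalerA; congr (_ *: _).
  by rewrite invfM mulrC mulrA mulfV // mul1r.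
by rewrite !linearZ /= !mxE -mulrDr invfM mulrACA mulfV // mul1r.
Qed.

Lemma den_row_mx a b (x y : C) (u : 'rV_a) (v : 'rV_b) :
  den (row_mx (row_mx x%:M u) (row_mx y%:M v)) = (x - y) / 'i.
Proof. by rewrite /den !row_mxKl !row_mxKr !row_mxKl !mxE. Qed.

Lemma den_hom a b (Z : 'rV[C]_(a + b) * C) : den (hom Z) = 1.
Proof.
rewrite den_row_mx -mulrBl opprD addrACA subrr add0r opprK.
by have i0 : 'i != 0 :> C by [exact: neq0Ci]; field.
Qed.

Lemma dehom_row_mx a b (x y : C) (u : 'rV_a) (v : 'rV_b) : x - y = 'i ->
  dehom (row_mx (row_mx x%:M u) (row_mx y%:M v)) = (row_mx u v, x + y).
Proof.
move=> xy; have d1 : (x - y) / 'i = 1 by rewrite xy mulfV // neq0Ci.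
by rewrite /dehom den_row_mx d1 invr1 scale1r mulr1; congr (row_mx _ _, _ + _); rewrite ?(row_mxKl, row_mxKr) ?mxE ?mulr1n.
Qed.

Lemma hom_dehom a b (y : 'rV[C]_((1 + a) + (1 + b))) : den y != 0 ->
  hom (dehom y) = (den y)^-1 *: y.
Proof.
have dE : den y * 'i = lsubmx (lsubmx y) 0 0 - lsubmx (rsubmx y) 0 0.
  by rewrite /den divfK ?neq0Ci.
rewrite /dehom; move: (den y) dE => d dE d0.
rewrite -[y in RHS]hsubmxK -[lsubmx y in RHS]hsubmxK -[rsubmx y in RHS]hsubmxK.
rewrite !scale_row_mx /hom /= row_mxKl row_mxKr.
rewrite [lsubmx (lsubmx y) in RHS]mx11_scalar [lsubmx (rsubmx y) in RHS]mx11_scalar.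
rewrite !scale_scalar_mx.
move: (lsubmx (lsubmx y) 0 0) (lsubmx (rsubmx y) 0 0) dE => x z dE.
have xE : x = d * 'i + z by rewrite dE subrK.
by congr (row_mx (row_mx _%:M _) (row_mx _%:M _)); rewrite xE; field; rewrite d0.
Qed.

(** The sizes [(1 + a) + m] and [1 + (a + m)] are convertible, so the extra coordinate can be
    regrouped without a cast. *)
Lemma row_mxA1 a m (x : 'rV[C]_1) (y : 'rV[C]_a) (z : 'rV[C]_m) :
  row_mx (row_mx x y) z = row_mx x (row_mx y z) :> 'rV_(1 + (a + m)).
Proof. by rewrite row_mxA castmx_id. Qed.

(** The second psi is read with default value 0: it is followed by zeros if k > m and cut if k < m,
    in agreement with [pad]. *)
Definition normal_form a b m k (Z : 'rV[C]_(a + b) * C) (psi : 'rV[C]_m) :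
    'rV[C]_((a + m) + (b + k)) * C :=
  (row_mx (row_mx (lsubmx Z.1) psi)
     (row_mx (rsubmx Z.1) (\row_j [seq psi 0 i | i : 'I_m]`_j)), Z.2).

Lemma dehom_normal_form a b m k (Z : 'rV[C]_(a + b) * C) (psi : 'rV[C]_m) c :
  c != 0 ->
  let y : 'rV[C]_((1 + (a + m)) + (1 + (b + k))) := row_mx (row_mx (lsubmx (hom Z)) psi)
    (row_mx (rsubmx (hom Z)) (\row_j [seq psi 0 i | i : 'I_m]`_j)) in
  dehom (c *: y) = normal_form k Z psi /\ den (c *: y) = c.
Proof.
move=> c0 y; rewrite dehomZ // denZ.
have -> : y = row_mx (row_mx ((Z.2 + 'i) / 2)%:M (row_mx (lsubmx Z.1) psi))
    (row_mx ((Z.2 - 'i) / 2)%:M (row_mx (rsubmx Z.1) (\row_j [seq psi 0 i | i : 'I_m]`_j))).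
  by rewrite /y /hom row_mxKl row_mxKr !row_mxA1.
have h : (Z.2 + 'i) / 2 - (Z.2 - 'i) / 2 = 'i.
  by field.
rewrite dehom_row_mx // den_row_mx h mulfV ?neq0Ci // mulr1; split=> //.
congr (_, _); by field.
Qed.

End Projective.

(** * One complex variable *)

Definition toC (R : realType) (x : R) : Cfield R := real_complex R x.

(* The library norm of [Cfield R] takes values in [Cfield R] itself, whose order
   is only partial; [cabs] is the same modulus with values in R. *)
Definition cabs (R : realType) (z : Cfield R) : R := complex.Re `|z|.

Section Modulus.
Variable R : realType.
Local Notation C := (Cfield R).
Implicit Types (z w : C) (x y : R).

Lemma cabsE z : `|z| = toC (cabs z).
Proof. by rewrite /cabs /toC RRe_real // normr_real. Qed.

Lemma toC_le x y : (toC x <= toC y) = (x <= y).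
Proof. exact: lecR. Qed.

Lemma toC_lt x y : (toC x < toC y) = (x < y).
Proof. exact: ltcR. Qed.

Lemma toC_inj : injective (@toC R).
Proof. exact: complexI. Qed.

Lemma toCD x y : toC (x + y) = toC x + toC y.
Proof. exact: rmorphD. Qed.

Lemma toCM x y : toC (x * y) = toC x * toC y.
Proof. exact: rmorphM. Qed.

Lemma toCN x : toC (- x) = - toC x.
Proof. exact: rmorphN. Qed.

Lemma toC0 : toC (0 : R) = 0.
Proof. by []. Qed.

Lemma toCV x : toC (x^-1) = (toC x)^-1.
Proof. by rewrite /toC fmorphV. Qed.

Lemma toCX x n : toC (x ^+ n) = toC x ^+ n.
Proof. exact: rmorphXn. Qed.

Lemma toC_nat n : toC (n%:R : R) = n%:R.
Proof. by rewrite /toC rmorph_nat. Qed.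

Lemma cabs_ge0 z : 0 <= cabs z.
Proof. by rewrite -toC_le -cabsE normr_ge0. Qed.

Lemma cabs0 : cabs (0 : C) = 0.
Proof. by apply: toC_inj; rewrite -cabsE normr0. Qed.

Lemma cabs1 : cabs (1 : C) = 1.
Proof. by apply: toC_inj; rewrite -cabsE normr1. Qed.

Lemma cabs_eq0 z : (cabs z == 0) = (z == 0).
Proof. by rewrite -(inj_eq toC_inj) -cabsE normr_eq0. Qed.

Lemma cabs_gt0 z : (0 < cabs z) = (z != 0).
Proof. by rewrite lt_def cabs_eq0 cabs_ge0 andbT. Qed.

Lemma cabsD z w : cabs (z + w) <= cabs z + cabs w.
Proof. by rewrite -toC_le toCD -!cabsE ler_normD. Qed.

Lemma cabsM z w : cabs (z * w) = cabs z * cabs w.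
Proof. by apply: toC_inj; rewrite toCM -!cabsE normrM. Qed.

Lemma cabsN z : cabs (- z) = cabs z.
Proof. by apply: toC_inj; rewrite -!cabsE normrN. Qed.

Lemma cabsB z w : cabs (z - w) <= cabs z + cabs w.
Proof. by rewrite -[cabs w]cabsN cabsD. Qed.

Lemma cabsV z : cabs z^-1 = (cabs z)^-1.
Proof. by apply: toC_inj; rewrite toCV -!cabsE normfV. Qed.

Lemma cabsX z n : cabs (z ^+ n) = cabs z ^+ n.
Proof. by apply: toC_inj; rewrite toCX -!cabsE normrX. Qed.

Lemma cabs_conj z : cabs (z^*) = cabs z.
Proof. by apply: toC_inj; rewrite -!cabsE norm_conjC. Qed.

Lemma cabs_toC x : cabs (toC x) = `|x|.
Proof.
apply: toC_inj; rewrite -cabsE; case: (ger0P x) => hx.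
  by rewrite ger0_norm // (toC_le 0).
by rewrite ltr0_norm ?toCN // (toC_lt x 0).
Qed.

Lemma cabsi : cabs ('i : C) = 1.
Proof. by apply: toC_inj; rewrite -cabsE normCi. Qed.

Lemma cabs_nat n : cabs (n%:R : C) = n%:R.
Proof. by apply: toC_inj; rewrite -cabsE normr_nat /toC rmorph_nat. Qed.

Lemma conj_toC x : (toC x)^* = toC x.
Proof. by apply: conj_Creal; rewrite complex_real. Qed.

Lemma sqr_cabs z : toC (cabs z ^+ 2) = z * z^*.
Proof. by rewrite toCX -cabsE normCK. Qed.

End Modulus.

(** * Complex derivatives measured with real moduli *)

Section Derivable.
Variable R : realType.
Local Notation C := (Cfield R).
Implicit Types (f g : C -> C) (z : C).

Lemma near0P (P : C -> Prop) : (\forall h \near (0 : C), P h) <->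
  exists2 d : R, 0 < d & forall h, cabs h < d -> P h.
Proof.
split=> [/nbhs_ballP[e /= e0 eP]|[d d0 dP]].
  have ee : e = toC (complex.Re e) by rewrite /toC RRe_real // gtr0_real.
  exists (complex.Re e); first by rewrite -toC_lt -ee.
  move=> h hd; apply: eP; rewrite /ball /= sub0r normrN cabsE ee toC_lt.
  by [].
apply/nbhs_ballP; exists (toC d) => /=; first by rewrite (toC_lt 0).
by move=> h; rewrite /ball /= sub0r normrN cabsE toC_lt; exact: dP.
Qed.

(** Without a quotient h = 0 needs no separate case, and real moduli give access to linear
    arithmetic over an ordered field. *)
Definition cdiff f z (d : C) := forall e : R, 0 < e ->
  exists2 dl : R, 0 < dl & forall h, cabs h < dl ->
     cabs (f (z + h) - f z - d * h) <= e * cabs h.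

Lemma derivableP f z : derivable f z 1 -> cdiff f z (derive f z 1).
Proof.
move=> fz e e0.
have := fz; rewrite /derivable => /cvg_lim.
have : (fun h => h^-1 *: (f (h *: 1 + z) - f z)) @ 0^' --> 'D_1 f z by exact: fz.
move=> /cvgrPdist_lt /(_ (toC e)); rewrite (toC_lt 0) => /(_ e0) H _.
have {H} : \forall h \near (0 : C), h != 0 ->
  `|'D_1 f z - h^-1 *: (f (h *: 1 + z) - f z)| < toC e.
  exact: H.
move=> /near0P[d d0 dP]; exists d => // h hd.
have [->|h0] := eqVneq h 0.
  by rewrite addr0 subrr mulr0 subr0 cabs0 mulr0.
have := dP h hd h0; rewrite cabsE toC_lt => /ltW hh.
have hc : 0 < cabs h by rewrite cabs_gt0.
rewrite -ler_pdivrMr // -cabsV -cabsM -cabsN.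
apply: le_trans hh; rewrite le_eqVlt; apply/orP; left; apply/eqP; congr cabs.
rewrite [h *: 1]mulr1 [h + z]addrC -[_ *: _]/(_ * _).
by field.
Qed.

Lemma cdiff_derivable f z d : cdiff f z d -> derivable f z 1 /\ derive f z 1 = d.
Proof.
move=> H.
have H1 : (fun h => h^-1 *: (f (h *: 1 + z) - f z)) @ 0^' --> d.
  apply/cvgrPdist_le => e e0.
  have ee : e = toC (complex.Re e) by rewrite /toC RRe_real // gtr0_real.
  have e0' : 0 < complex.Re e by rewrite -toC_lt -ee.
  have [dl dl0 dlP] := H _ e0'.
  have : \forall h \near (0 : C), h != 0 ->
      `|d - h^-1 *: (f (h *: 1 + z) - f z)| <= e.
    apply/near0P; exists dl => // h hd h0.
    have hc : 0 < cabs h by rewrite cabs_gt0.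
    have := dlP h hd; rewrite -ler_pdivrMr // -cabsV -cabsM -cabsN.
    rewrite ee cabsE toC_le => hh; apply: le_trans hh.
    rewrite le_eqVlt; apply/orP; left; apply/eqP; congr cabs.
    rewrite [h *: 1]mulr1 [h + z]addrC -[_ *: _]/(_ * _).
    by field.
  by [].
split; first by apply/cvg_ex; exists d.
by apply/cvg_lim.
Qed.

Definition cder f z := exists d, cdiff f z d.

Lemma cder_derivable f z : cder f z <-> derivable f z 1.
Proof.
split=> [[d /cdiff_derivable[]] //|fz].
by exists ('D_1 f z); apply: derivableP.
Qed.

Lemma cderP f z : cder f z -> cdiff f z ('D_1 f z).
Proof. by move=> /cder_derivable; exact: derivableP. Qed.

Lemma cdiff_unique f z d : cdiff f z d -> 'D_1 f z = d.
Proof. by move=> /cdiff_derivable[]. Qed.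

Lemma cder_cont f z : cder f z ->
  forall e : R, 0 < e -> exists2 dl : R, 0 < dl &
    forall h, cabs h < dl -> cabs (f (z + h) - f z) < e.
Proof.
move=> fz e e0; have [dl dl0 dlP] := cderP fz ltr01.
set d := 'D_1 f z in dlP.
have k0 : 0 < 1 + cabs d by have := cabs_ge0 d; lra.
exists (Num.min dl (e / (1 + cabs d))).
  by rewrite lt_min dl0 divr_gt0.
move=> h; rewrite lt_min => /andP[h1 h2].
have -> : f (z + h) - f z = (f (z + h) - f z - d * h) + d * h by ring.
apply: (le_lt_trans (cabsD _ _)).
apply: (@le_lt_trans _ _ (1 * cabs h + cabs d * cabs h)).
  by rewrite lerD // ?dlP // cabsM.
by rewrite -mulrDl mulrC -ltr_pdivlMr.
Qed.

End Derivable.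

(** * Bisection of squares *)

Section Squares.
Variable R : realType.
Local Notation C := (Cfield R).
Implicit Types (a b s x y : R).

Lemma nested_intervals (a s : nat -> R) : (forall n, a n <= a n.+1) ->
  (forall n, a n.+1 + s n.+1 <= a n + s n) -> (forall n, 0 <= s n) ->
  exists x, forall n, a n <= x /\ x <= a n + s n.
Proof.
move=> aS bS s0.
have am k n : a n <= a (n + k)%N.
  by elim: k => [|k IH]; rewrite ?addn0 // addnS (le_trans IH).
have bm k n : a (n + k)%N + s (n + k)%N <= a n + s n.
  by elim: k => [|k IH]; rewrite ?addn0 // addnS (le_trans _ IH).
have ub n m : a m <= a n + s n.
  have h1 : a m <= a (maxn n m) by rewrite -[maxn n m](subnKC (leq_maxr n m)).
  have h2 : a (maxn n m) + s (maxn n m) <= a n + s n.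
    by rewrite -[maxn n m](subnKC (leq_maxl n m)).
  by have := s0 (maxn n m); lra.
have hs : has_sup (range a).
  split; first by exists (a 0); exists 0%N.
  by exists (a 0 + s 0) => _ [m _ <-].
exists (sup (range a)) => n; split.
  by apply: ub_le_sup; [case: hs | exists n].
by apply: ge_sup => [|_ [m _ <-]]; [exists (a 0); exists 0%N | ].
Qed.

(** A square where P fails has a quarter where P fails; the nested failures shrink to a point and
    contradict the local hypothesis there. Used for Goursat's lemma and also in place of
    compactness. *)
Lemma square_ind (P : R -> R -> R -> Prop) (a0 b0 s0 : R) : 0 < s0 ->
  (forall a b s, 0 < s -> P a b (s / 2) -> P (a + s / 2) b (s / 2) ->
     P a (b + s / 2) (s / 2) -> P (a + s / 2) (b + s / 2) (s / 2) -> P a b s) ->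
  (forall x y, a0 <= x <= a0 + s0 -> b0 <= y <= b0 + s0 ->
     exists2 d, 0 < d & forall a b s, 0 < s < d ->
       a <= x <= a + s -> b <= y <= b + s ->
       a0 <= a -> a + s <= a0 + s0 -> b0 <= b -> b + s <= b0 + s0 -> P a b s) ->
  P a0 b0 s0.
Proof.
move=> s00 split4 loc; apply: contrapT => nP.
(* Selects the first failing quarter; the fourth is not tested, since by [split4] it fails when the
   other three hold. *)
pose step (p : R * R) s : R * R :=
  if asbool (P p.1 p.2 (s / 2)) then
    if asbool (P (p.1 + s / 2) p.2 (s / 2)) then
      if asbool (P p.1 (p.2 + s / 2) (s / 2)) then (p.1 + s / 2, p.2 + s / 2)
      else (p.1, p.2 + s / 2)
    else (p.1 + s / 2, p.2)
  else p.
pose s n := s0 / 2 ^+ n.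
have sS n : s n.+1 = s n / 2 by rewrite /s exprS; field; rewrite expf_neq0.
have sp n : 0 < s n by rewrite /s divr_gt0 // exprn_gt0.
pose ab := fix ab n := if n is m.+1 then step (ab m) (s m) else (a0, b0).
have nPn n : ~ P (ab n).1 (ab n).2 (s n).
  elim: n => [|n IH]; first by rewrite /s expr0 divr1.
  rewrite sS /= /step.
  case: asboolP => // h1; case: asboolP => // h2; case: asboolP => // h3 h4.
  by apply: IH; apply: split4.
have bnd n : [/\ (ab n).1 <= (ab n.+1).1, (ab n.+1).1 + s n.+1 <= (ab n).1 + s n,
    (ab n).2 <= (ab n.+1).2 & (ab n.+1).2 + s n.+1 <= (ab n).2 + s n].
  rewrite sS /= /step; have := sp n.
  by case: ifP => _ /=; first case: ifP => _ /=; first case: ifP => _ /=;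
    move=> ?; split; lra.
have [x xP] : exists x, forall n, (ab n).1 <= x /\ x <= (ab n).1 + s n.
  by apply: nested_intervals => n; [case: (bnd n) | case: (bnd n) | exact: ltW].
have [y yP] : exists y, forall n, (ab n).2 <= y /\ y <= (ab n).2 + s n.
  by apply: nested_intervals => n; [case: (bnd n) | case: (bnd n) | exact: ltW].
have s0E : s 0 = s0 by rewrite /s expr0 divr1.
have inn n : [/\ a0 <= (ab n).1, (ab n).1 + s n <= a0 + s0, b0 <= (ab n).2 &
    (ab n).2 + s n <= b0 + s0].
  elim: n => [|n [h1 h2 h3 h4]]; first by rewrite s0E /=.
  by case: (bnd n) => ? ? ? ?; split; lra.
have [||d d0 dP] := loc x y.
- by have := xP 0; rewrite s0E /= => -[-> ->].
- by have := yP 0; rewrite s0E /= => -[-> ->].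
have [n nd] : exists n, s n < d.
  have [n hn] : exists n : nat, s0 / d < n%:R.
    exists (Num.truncn (s0 / d)).+1.
    by apply: truncnS_gt.
  exists n; rewrite /s ltr_pdivrMr ?exprn_gt0 // mulrC.
  rewrite -ltr_pdivrMr // (lt_le_trans hn) //.
  by rewrite -natrX ler_nat ltnW // ltn_expl.
apply: (nPn n); case: (inn n) => *; apply: dP => //.
- by rewrite sp nd.
- by apply/andP; exact: xP.
- by apply/andP; exact: yP.
Qed.

End Squares.

(** * Goursat's lemma for midpoint sums *)

Section Goursat.
Variable R : realType.
Local Notation C := (Cfield R).
Implicit Types (a b s x y : R).

Definition pt x y : C := toC x + 'i * toC y.

Fixpoint msum n (k : R -> C) a s : C :=
  if n is m.+1 then msum m k a (s / 2) + msum m k (a + s / 2) (s / 2)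
  else toC s * k (a + s / 2).

Lemma half2 a s : a + s / 2 + s / 2 = a + s.
Proof. by field. Qed.

Lemma msum_lin n (k k' : R -> C) (c c' : C) a s :
  msum n (fun x => c * k x + c' * k' x) a s = c * msum n k a s + c' * msum n k' a s.
Proof.
elim: n a s => [|n IH] a s /=; first by ring.
by rewrite !IH; ring.
Qed.

Lemma eq_msum n (k k' : R -> C) a s : 0 <= s ->
  (forall x, a <= x <= a + s -> k x = k' x) -> msum n k a s = msum n k' a s.
Proof.
elim: n a s => [|n IH] a s s0 kk /=.
  by rewrite kk //; apply/andP; split; lra.
by congr (_ + _); apply: IH; rewrite ?divr_ge0 // => x /andP[h1 h2];
  apply: kk; apply/andP; split; lra.
Qed.

Lemma msum_affine n (al be : C) a s :
  msum n (fun x => al + be * toC x) a s = toC s * (al + be * toC (a + s / 2)).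
Proof.
elim: n a s => [|n IH] a s //=; rewrite !IH !(toC_nat, toCD, toCM, toCV).
by field.
Qed.

Lemma cabs_msum n (k : R -> C) a s (M : R) : 0 <= s ->
  (forall x, a <= x <= a + s -> cabs (k x) <= M) -> cabs (msum n k a s) <= s * M.
Proof.
elim: n a s => [|n IH] a s s0 kM /=.
  rewrite cabsM cabs_toC ger0_norm // ler_wpM2l //.
  by apply: kM; apply/andP; split; lra.
apply: (le_trans (cabsD _ _)).
have h1 : cabs (msum n k a (s / 2)) <= s / 2 * M.
  by apply: IH; [lra|] => x /andP[h1 h2]; apply: kM; apply/andP; split; lra.
have h2 : cabs (msum n k (a + s / 2) (s / 2)) <= s / 2 * M.
  by apply: IH; [lra|] => x /andP[h2 h3]; apply: kM; apply/andP; split; lra.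
lra.
Qed.

Lemma Im_msum n (k : R -> C) a s (c : R) : 0 <= s ->
  (forall x, a <= x <= a + s -> c <= complex.Im (k x)) ->
  s * c <= complex.Im (msum n k a s).
Proof.
elim: n a s => [|n IH] a s s0 kM /=.
  have -> : complex.Im (toC s * k (a + s / 2)) = s * complex.Im (k (a + s / 2)).
    by case: (k _) => u v /=; rewrite /toC /= mul0r addr0.
  by rewrite ler_wpM2l //; apply: kM; apply/andP; split; lra.
rewrite raddfD /=.
have h1 : s / 2 * c <= complex.Im (msum n k a (s / 2)).
  by apply: IH; [lra|] => x /andP[h1 h2]; apply: kM; apply/andP; split; lra.
have h2 : s / 2 * c <= complex.Im (msum n k (a + s / 2) (s / 2)).
  by apply: IH; [lra|] => x /andP[h2 h3]; apply: kM; apply/andP; split; lra.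
lra.
Qed.

(* Midpoint approximation, with 2^n subintervals per side, of the contour
   integral of k along the boundary of the square. *)
Definition bsum n (k : C -> C) a b s : C :=
  msum n (fun x => k (pt x b)) a s - msum n (fun x => k (pt x (b + s))) a s
  + 'i * (msum n (fun y => k (pt (a + s) y)) b s - msum n (fun y => k (pt a y)) b s).

Lemma bsumS n k a b s : bsum n.+1 k a b s =
  bsum n k a b (s / 2) + bsum n k (a + s / 2) b (s / 2)
  + bsum n k a (b + s / 2) (s / 2) + bsum n k (a + s / 2) (b + s / 2) (s / 2).
Proof. by rewrite /bsum /= !half2; ring. Qed.

Lemma bsum_lin n (k k' : C -> C) (c c' : C) a b s :
  bsum n (fun z => c * k z + c' * k' z) a b s = c * bsum n k a b s + c' * bsum n k' a b s.
Proof. by rewrite /bsum !msum_lin; ring. Qed.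

Definition on_square (P : C -> Prop) a b s := forall x y,
  a <= x <= a + s -> b <= y <= b + s -> P (pt x y).

Definition on_boundary (P : C -> Prop) a b s :=
  [/\ forall x, a <= x <= a + s -> P (pt x b),
      forall x, a <= x <= a + s -> P (pt x (b + s)),
      forall y, b <= y <= b + s -> P (pt (a + s) y) &
      forall y, b <= y <= b + s -> P (pt a y)].

Lemma on_square_boundary (P : C -> Prop) a b s : 0 <= s ->
  on_square P a b s -> on_boundary P a b s.
Proof.
by move=> s0 sP; split=> t ht; apply: sP => //; rewrite ?lexx ?lerDl ?s0.
Qed.

Lemma on_boundaryW (P Q : C -> Prop) a b s : (forall z, P z -> Q z) ->
  on_boundary P a b s -> on_boundary Q a b s.
Proof. by move=> PQ [h1 h2 h3 h4]; split=> t ht; apply: PQ; auto. Qed.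

Lemma on_boundaryI (P Q : C -> Prop) a b s :
  on_boundary P a b s -> on_boundary Q a b s ->
  on_boundary (fun z => P z /\ Q z) a b s.
Proof.
by move=> [h1 h2 h3 h4] [g1 g2 g3 g4]; split=> t ht; split; auto.
Qed.

Lemma eq_bsum n (k k' : C -> C) a b s : 0 <= s ->
  on_boundary (fun z => k z = k' z) a b s -> bsum n k a b s = bsum n k' a b s.
Proof.
move=> s0 [h1 h2 h3 h4]; rewrite /bsum.
by congr (_ - _ + _ * (_ - _)); apply: eq_msum.
Qed.

Lemma cabs_bsum n (k : C -> C) a b s M : 0 <= s ->
  on_boundary (fun z => cabs (k z) <= M) a b s -> cabs (bsum n k a b s) <= 4 * s * M.
Proof.
move=> s0 [h1 h2 h3 h4]; rewrite /bsum; apply: (le_trans (cabsD _ _)).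
rewrite cabsM cabsi mul1r.
have := cabsB (msum n (fun x => k (pt x b)) a s)
              (msum n (fun x => k (pt x (b + s))) a s).
have := cabsB (msum n (fun y => k (pt (a + s) y)) b s)
              (msum n (fun y => k (pt a y)) b s).
have := cabs_msum n s0 h1; have := cabs_msum n s0 h2.
have := cabs_msum n s0 h3; have := cabs_msum n s0 h4.
lra.
Qed.

Lemma bsum_affine n (al be : C) a b s : bsum n (fun z => al + be * z) a b s = 0.
Proof.
rewrite /bsum.
have E1 y : (fun x => al + be * pt x y) =
    (fun x => (al + be * ('i * toC y)) + be * toC x).
  by apply/funext => x; rewrite /pt; ring.
have E2 x : (fun y => al + be * pt x y) =
    (fun y => (al + be * toC x) + (be * 'i) * toC y).
  by apply/funext => y; rewrite /pt; ring.
rewrite !E1 !E2 !msum_affine !(toC_nat, toCD, toCM, toCV).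
by field.
Qed.

Lemma cabs_pt x y : cabs (pt x y) <= `|x| + `|y|.
Proof. by rewrite (le_trans (cabsD _ _)) // cabsM cabsi mul1r !cabs_toC. Qed.

Lemma ptB x y x' y' : pt x y - pt x' y' = pt (x - x') (y - y').
Proof. by rewrite /pt !(toCD, toCN); ring. Qed.

(** Midpoint sums of affine functions around a square are exactly zero, so near a point of
    differentiability only the remainder counts: at most e / 8 times the diameter bound 2 s, along a
    perimeter 4 s, hence e s^2. This bound is additive over quarters, and no limit of the sums is
    taken. *)
Lemma goursat (k : C -> C) a0 b0 s0 : 0 < s0 ->
  on_square (fun z => cder k z) a0 b0 s0 ->
  forall e, 0 < e -> exists N, forall n, (N <= n)%N ->
    cabs (bsum n k a0 b0 s0) <= e * s0 ^+ 2.
Proof.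
move=> s00 kd e e0.
pose P a b s := exists N, forall n, (N <= n)%N -> cabs (bsum n k a b s) <= e * s ^+ 2.
apply: (@square_ind _ P a0 b0 s0) => //.
  move=> a b s sp [N1 P1] [N2 P2] [N3 P3] [N4 P4].
  exists (maxn (maxn N1 N2) (maxn N3 N4)).+1 => -[//|n].
  rewrite ltnS !geq_max => /andP[/andP[h1 h2] /andP[h3 h4]].
  rewrite bsumS.
  do !(apply: (le_trans (cabsD _ _))).
  have := cabsD (bsum n k a b (s / 2) + bsum n k (a + s / 2) b (s / 2))
    (bsum n k a (b + s / 2) (s / 2)).
  have := cabsD (bsum n k a b (s / 2)) (bsum n k (a + s / 2) b (s / 2)).
  have := P1 n h1; have := P2 n h2; have := P3 n h3; have := P4 n h4.
  have -> : (s / 2) ^+ 2 = s ^+ 2 / 4 by field.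
  lra.
move=> x y hx hy; have [d d0 dP] := cderP (kd x y hx hy) (divr_gt0 e0 (ltr0n _ 8)).
set D := 'D_1 k (pt x y) in dP.
exists (d / 2) => [|a b s /andP[s1 s2] /andP[x1 x2] /andP[y1 y2] _ _ _ _].
  by rewrite divr_gt0.
exists 0%N => n _.
pose aff z := (k (pt x y) - D * pt x y) + D * z.
pose r z := k z - k (pt x y) - D * (z - pt x y).
have -> : bsum n k a b s = bsum n r a b s.
  have -> : k = (fun z => 1 * r z + 1 * aff z).
    by apply/funext => z; rewrite /r /aff; ring.
  by rewrite bsum_lin bsum_affine; ring.
have -> : e * s ^+ 2 = 4 * s * (e / 8 * (2 * s)) by field.
apply: cabs_bsum; first exact: ltW.
apply: on_square_boundary; first exact: ltW.
move=> x' y' /andP[x1' x2'] /andP[y1' y2'].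
have hh : cabs (pt x' y' - pt x y) <= 2 * s.
  rewrite ptB (le_trans (cabs_pt _ _)) //.
  have : `|x' - x| <= s by rewrite ler_norml; apply/andP; split; lra.
  have : `|y' - y| <= s by rewrite ler_norml; apply/andP; split; lra.
  lra.
have := dP (pt x' y' - pt x y); rewrite [pt x y + _]addrC subrK => h.
rewrite /r (le_trans (h _)) //; first lra.
by rewrite ler_wpM2l // divr_ge0 // ltW.
Qed.

Lemma bounded_on_square (k : C -> C) a0 b0 s0 : 0 < s0 ->
  on_square (fun z => cder k z) a0 b0 s0 ->
  exists2 M, 0 < M & on_square (fun z => cabs (k z) <= M) a0 b0 s0.
Proof.
move=> s00 kd.
pose P a b s := exists2 M, 0 < M & on_square (fun z => cabs (k z) <= M) a b s.
apply: (@square_ind _ P a0 b0 s0) => //.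
  move=> a b s sp [M1 p1 P1] [M2 p2 P2] [M3 p3 P3] [M4 p4 P4].
  exists (M1 + M2 + M3 + M4); first lra.
  move=> x y /andP[x1 x2] /andP[y1 y2].
  have [hx|hx] := lerP x (a + s / 2); have [hy|hy] := lerP y (b + s / 2).
  - have : cabs (k (pt x y)) <= M1; last lra.
    by apply: P1; apply/andP; split; lra.
  - have : cabs (k (pt x y)) <= M3; last lra.
    by apply: P3; apply/andP; split; lra.
  - have : cabs (k (pt x y)) <= M2; last lra.
    by apply: P2; apply/andP; split; lra.
  - have : cabs (k (pt x y)) <= M4; last lra.
    by apply: P4; apply/andP; split; lra.
move=> x y hx hy; have [d d0 dP] := cder_cont (kd x y hx hy) ltr01.
exists (d / 2) => [|a b s /andP[s1 s2] /andP[x1 x2] /andP[y1 y2] _ _ _ _].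
  by rewrite divr_gt0.
exists (cabs (k (pt x y)) + 1); first by have := cabs_ge0 (k (pt x y)); lra.
move=> x' y' /andP[x1' x2'] /andP[y1' y2'].
have hh : cabs (pt x' y' - pt x y) <= 2 * s.
  rewrite ptB (le_trans (cabs_pt _ _)) //.
  have : `|x' - x| <= s by rewrite ler_norml; apply/andP; split; lra.
  have : `|y' - y| <= s by rewrite ler_norml; apply/andP; split; lra.
  lra.
have := dP (pt x' y' - pt x y); rewrite [pt x y + _]addrC subrK => h.
have := cabsD (k (pt x y)) (k (pt x' y') - k (pt x y)).
rewrite [X in cabs X]addrC subrK => h2.
have h3 : cabs (k (pt x' y') - k (pt x y)) < 1 by apply: h; lra.
lra.
Qed.

End Goursat.

(** * Differentiable and continuous functions, difference quotients *)

Section MaxPrinciple.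
Variable R : realType.
Local Notation C := (Cfield R).
Implicit Types (a b s x y : R) (z t : C).

Lemma cabs_sqrt z : cabs z = Num.sqrt (complex.Re z ^+ 2 + complex.Im z ^+ 2).
Proof. by rewrite /cabs normc_def. Qed.

Lemma Re_le_cabs z : `|complex.Re z| <= cabs z.
Proof. by rewrite cabs_sqrt -sqrtr_sqr ler_wsqrtr // lerDl sqr_ge0. Qed.

Lemma Im_le_cabs z : `|complex.Im z| <= cabs z.
Proof. by rewrite cabs_sqrt -sqrtr_sqr ler_wsqrtr // lerDr sqr_ge0. Qed.

Lemma ptE z : z = pt (complex.Re z) (complex.Im z).
Proof. by rewrite /pt /toC -complexiE -complexE. Qed.

Lemma pt_complex x y : pt x y = Complex x y.
Proof. by rewrite [RHS]ptE. Qed.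

Lemma inv_pt x y : (pt x y)^-1 = pt (x / (x ^+ 2 + y ^+ 2)) (- y / (x ^+ 2 + y ^+ 2)).
Proof. by rewrite !pt_complex mulNr. Qed.

Lemma mulri_pt x y : 'i * pt x y = pt (- y) x.
Proof.
rewrite /pt toCN; have := sqrCi C; rewrite expr2 => ii.
by rewrite mulrDr mulrA ii mulN1r addrC.
Qed.

Lemma dcst (c : C) z : cder (fun=> c) z.
Proof. by apply/cder_derivable; exact: derivable_cst. Qed.

Lemma did z : cder (fun t : C => t) z.
Proof. by apply/cder_derivable; exact: derivable_id. Qed.

Lemma dadd (f g : C -> C) z : cder f z -> cder g z ->
  cder (fun t => f t + g t) z.
Proof.
move=> /cder_derivable fz /cder_derivable gz; apply/cder_derivable.
exact: (derivableD fz gz).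
Qed.

Lemma dsub (f g : C -> C) z : cder f z -> cder g z ->
  cder (fun t => f t - g t) z.
Proof.
move=> /cder_derivable fz /cder_derivable gz; apply/cder_derivable.
exact: (derivableB fz gz).
Qed.

Lemma dmul (f g : C -> C) z : cder f z -> cder g z ->
  cder (fun t => f t * g t) z.
Proof.
move=> /cder_derivable fz /cder_derivable gz; apply/cder_derivable.
exact: (derivableM fz gz).
Qed.

Lemma dexp (f : C -> C) n z : cder f z -> cder (fun t => f t ^+ n) z.
Proof.
move=> fz; elim: n => [|n IH]; first exact: dcst.
have -> : (fun t => f t ^+ n.+1) = (fun t => f t * f t ^+ n).
  by apply/funext => t; rewrite exprS.
exact: dmul.
Qed.

Lemma dinv (f : C -> C) z : cder f z -> f z != 0 ->
  cder (fun t => (f t)^-1) z.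
Proof.
move=> /cder_derivable fz fz0; apply/cder_derivable.
exact: (derivableV fz0 fz).
Qed.

Lemma dsum (I : Type) (r : seq I) (f : I -> C -> C) z :
  (forall i, cder (f i) z) -> cder (fun t => \sum_(i <- r) f i t) z.
Proof.
move=> fz; elim: r => [|i r IH].
  have -> : (fun t => \sum_(i <- [::]) f i t) = (fun=> 0).
    by apply/funext => t; rewrite big_nil.
  exact: dcst.
have [g gE] : exists g : C -> C, g = (fun t => \sum_(j <- r) f j t) by exists (fun t => \sum_(j <- r) f j t).
have -> : (fun t => \sum_(j <- i :: r) f j t) = (fun t => f i t + g t).
  by apply/funext => t; rewrite big_cons gE.
by apply: dadd (fz i) _; rewrite gE.
Qed.

Lemma dext (f g : C -> C) z (d : R) : 0 < d ->
  (forall h, cabs h < d -> f (z + h) = g (z + h)) -> cder f z -> cder g z.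
Proof.
move=> d0 fg /cderP fz; have fgz : f z = g z.
  by have := fg 0; rewrite addr0; apply; rewrite cabs0.
exists ('D_1 f z) => e e0.
have [dl dl0 dlP] := fz e e0; exists (Num.min d dl); first by rewrite lt_min d0.
by move=> h; rewrite lt_min => /andP[h1 h2]; rewrite -fg // -fgz dlP.
Qed.

Definition ccont (f : C -> C) z := forall e : R, 0 < e -> exists2 dl : R, 0 < dl &
    forall h, cabs h < dl -> cabs (f (z + h) - f z) < e.

Lemma ccont_loc_bounded (f : C -> C) z : ccont f z -> exists2 dl : R, 0 < dl &
  forall h, cabs h < dl -> cabs (f (z + h)) <= cabs (f z) + 1.
Proof.
move=> /(_ 1 ltr01)[d d0 dP]; exists d => // h /dP hh.
have := cabsD (f (z + h) - f z) (f z); rewrite subrK; lra.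
Qed.

Lemma ccont_mul (f g : C -> C) z : ccont f z -> ccont g z -> ccont (fun t => f t * g t) z.
Proof.
move=> fz gz e e0; have [d1 d10 B1] := ccont_loc_bounded fz.
have c1 : 0 < cabs (f z) + 1 by have := cabs_ge0 (f z); lra.
have c2 : 0 < cabs (g z) + 1 by have := cabs_ge0 (g z); lra.
have [d2 d20 B2] := gz _ (divr_gt0 (divr_gt0 e0 (ltr0Sn _ 1)) c1).
have [d3 d30 B3] := fz _ (divr_gt0 (divr_gt0 e0 (ltr0Sn _ 1)) c2).
exists (Num.min d1 (Num.min d2 d3)); first by rewrite !lt_min d10 d20.
move=> h; rewrite !lt_min => /and3P[/B1 h1 /B2 h2 /B3 h3].
have -> : f (z + h) * g (z + h) - f z * g z =
  f (z + h) * (g (z + h) - g z) + (f (z + h) - f z) * g z by ring.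
apply: (le_lt_trans (cabsD _ _)); rewrite !cabsM.
have e1 : cabs (f (z + h)) * cabs (g (z + h) - g z) <= e / 2.
  apply: (@le_trans _ _ ((cabs (f z) + 1) * (e / 2 / (cabs (f z) + 1)))).
    by apply: ler_pM; rewrite ?cabs_ge0 // ltW.
  by rewrite mulrC divfK // gt_eqF.
have e2 : cabs (f (z + h) - f z) * cabs (g z) < e / 2.
  apply: (@le_lt_trans _ _ (e / 2 / (cabs (g z) + 1) * cabs (g z))).
    by rewrite ler_wpM2r ?cabs_ge0 // ltW.
  rewrite -mulrA [_ * cabs _]mulrC -[X in _ < X]mulr1 ltr_pM2l ?divr_gt0 //.
  by rewrite ltr_pdivrMr // mul1r; lra.
lra.
Qed.

Lemma ccont_exp (f : C -> C) n z : ccont f z -> ccont (fun t => f t ^+ n) z.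
Proof.
move=> fz; elim: n => [|n IH].
  by move=> e e0; exists 1 => // h _; rewrite !expr0 subrr cabs0.
have -> : (fun t => f t ^+ n.+1) = (fun t => f t * f t ^+ n).
  by apply/funext => t; rewrite exprS.
exact: ccont_mul.
Qed.

Lemma ccont_ext (f g : C -> C) z (d : R) : 0 < d ->
  (forall h, cabs h < d -> f (z + h) = g (z + h)) -> ccont f z -> ccont g z.
Proof.
move=> d0 fg fz e e0; have fgz : f z = g z.
  by have := fg 0; rewrite addr0; apply; rewrite cabs0.
have [dl dl0 dlP] := fz e e0; exists (Num.min d dl); first by rewrite lt_min d0.
by move=> h; rewrite lt_min => /andP[h1 h2]; rewrite -fg // -fgz dlP.
Qed.

(** The derivative is [u t], by continuity of u. Removable singularities are handled in this way,
    without an integral formula. *)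
Lemma dmul_zero (u : C -> C) t : ccont u t -> cder (fun z => (z - t) * u z) t.
Proof.
move=> ut; exists (u t) => e e0.
have [d d0 dP] := ut e e0; exists d => // h /dP hh.
have -> : (t + h - t) * u (t + h) - (t - t) * u t - u t * h =
  (u (t + h) - u t) * h by ring.
by rewrite cabsM ler_wpM2r ?cabs_ge0 // ltW.
Qed.

Definition dquot (f : C -> C) t z : C :=
  if z == t then 'D_1 f t else (f z - f t) / (z - t).

Lemma dquotE f t z : (z - t) * dquot f t z = f z - f t.
Proof.
rewrite /dquot; have [->|zt] := eqVneq z t; first by rewrite !subrr mul0r.
by rewrite mulrC divfK // subr_eq0.
Qed.

Lemma dquot_out f t z : z != t -> exists2 d : R, 0 < d & forall h, cabs h < d ->
  (f (z + h) - f t) / (z + h - t) = dquot f t (z + h).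
Proof.
move=> zt; exists (cabs (z - t)); first by rewrite cabs_gt0 subr_eq0.
move=> h hd; rewrite /dquot; case: eqP => // e.
by move: hd; rewrite -e opprD addNKr cabsN ltxx.
Qed.

Lemma dquot_derivable f t z : z != t -> cder f z -> cder (dquot f t) z.
Proof.
move=> zt fz; have [d d0 dP] := dquot_out f zt.
apply: (@dext (fun z => (f z - f t) * (z - t)^-1) _ _ d d0 dP).
apply: (@dmul (fun z => f z - f t) (fun z => (z - t)^-1)).
  exact: (@dsub f (fun=> f t) _ fz (@dcst _ _)).
apply: (@dinv (fun z => z - t)); last by rewrite subr_eq0.
exact: (@dsub id (fun=> t) _ (@did _) (@dcst _ _)).
Qed.

Lemma dquot_ccont_out f t z : z != t -> ccont f z -> ccont (dquot f t) z.
Proof.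
move=> zt fz; have [d d0 dP] := dquot_out f zt.
apply: (@ccont_ext (fun z => (f z - f t) * (z - t)^-1) _ _ d d0 dP).
apply: ccont_mul.
  move=> e /fz[dl dl0 dlP]; exists dl => // h /dlP.
  by rewrite opprB addrA subrK.
apply: cder_cont; apply: (@dinv (fun z => z - t)).
  exact: (@dsub id (fun=> t) _ (@did _) (@dcst _ _)).
by rewrite subr_eq0.
Qed.

Lemma dquot_ccont_at f t : cder f t -> ccont (dquot f t) t.
Proof.
move=> /cderP ft e e0; have e2 : 0 < e / 2 by lra.
have [d d0 dP] := ft _ e2; exists d => // h /dP hh.
rewrite /dquot eqxx; case: eqP => [_|/eqP th]; first by rewrite subrr cabs0.
have h0 : h != 0 by apply: contra th => /eqP ->; rewrite addr0.
have -> : (f (t + h) - f t) / (t + h - t) - 'D_1 f t =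
   (f (t + h) - f t - 'D_1 f t * h) / h.
  by rewrite [t + h]addrC addrK; field.
rewrite cabsM cabsV ltr_pdivrMr ?cabs_gt0 // (le_lt_trans hh) //.
by rewrite ltr_pM2r ?cabs_gt0 //; lra.
Qed.

(** By Bernoulli's inequality v > M would make (v / M)^p unbounded. Applied to powers of a function,
    it removes the constant from an estimate. *)
Lemma pow_le (c D M v : R) : 0 < c -> 0 < M -> 0 <= v ->
  (forall p : nat, c * v ^+ p <= D * M ^+ p) -> v <= M.
Proof.
move=> c0 M0 v0 H; rewrite leNgt; apply/negP => Mv.
set r := v / M - 1; have r0 : 0 < r by rewrite /r subr_gt0 ltr_pdivlMr // mul1r.
have bern p : 1 + p%:R * r <= (v / M) ^+ p.
  have -> : v / M = 1 + r by rewrite /r; ring.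
  elim: p => [|p IH]; first by rewrite mul0r addr0.
  rewrite exprS; apply: (@le_trans _ _ ((1 + r) * (1 + p%:R * r))).
    have -> : (p.+1%:R : R) = p%:R + 1 by rewrite -natr1.
    have : 0 <= p%:R * (r * r) by rewrite mulr_ge0 // mulr_ge0 // ltW.
    lra.
  by rewrite ler_pM2l //; lra.
have [p pP] : exists p : nat, D / (c * r) < p%:R.
  by exists (Num.truncn (D / (c * r))).+1; apply: truncnS_gt.
have := H p; rewrite -ler_pdivrMr ?exprn_gt0 // -mulrA -expr_div_n.
move: pP; rewrite ltr_pdivrMr ?mulr_gt0 // => pP h.
have := ler_wpM2l (ltW c0) (bern p); lra.
Qed.

Definition interior_square (z : C) a b s :=
  [/\ a < complex.Re z, complex.Re z < a + s, b < complex.Im z & complex.Im z < b + s].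

Lemma Re_pt x y : complex.Re (pt x y) = x.
Proof. by rewrite pt_complex. Qed.

Lemma Im_pt x y : complex.Im (pt x y) = y.
Proof. by rewrite pt_complex. Qed.

Lemma cabs_ptB_re x y z : `|x - complex.Re z| <= cabs (pt x y - z).
Proof. by rewrite [z]ptE ptB !Re_pt (le_trans _ (Re_le_cabs _)) // Re_pt. Qed.

Lemma cabs_ptB_im x y z : `|y - complex.Im z| <= cabs (pt x y - z).
Proof. by rewrite [z]ptE ptB !Im_pt (le_trans _ (Im_le_cabs _)) // Im_pt. Qed.

Lemma boundary_dist (z : C) a b s d : 
  a + d <= complex.Re z -> complex.Re z <= a + s - d ->
  b + d <= complex.Im z -> complex.Im z <= b + s - d ->
  on_boundary (fun u => d <= cabs (u - z)) a b s.
Proof.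
move=> h1 h2 h3 h4; split=> t _.
- by apply: le_trans (cabs_ptB_im _ _ _); rewrite ler_normr; apply/orP; right; lra.
- by apply: le_trans (cabs_ptB_im _ _ _); rewrite ler_normr; apply/orP; left; lra.
- by apply: le_trans (cabs_ptB_re _ _ _); rewrite ler_normr; apply/orP; left; lra.
- by apply: le_trans (cabs_ptB_re _ _ _); rewrite ler_normr; apply/orP; right; lra.
Qed.
End MaxPrinciple.

(** * Maximum principle, identity theorem and Cauchy estimate *)

Section IdentityTheorem.
Variable R : realType.
Local Notation C := (Cfield R).
Implicit Types (a b s x y : R) (z t : C).

Lemma ImN z : complex.Im (- z) = - complex.Im z.
Proof. by case: z. Qed.

Lemma square_diam a b s x y x' y' :
  a <= x <= a + s -> b <= y <= b + s -> a <= x' <= a + s -> b <= y' <= b + s ->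
  cabs (pt x y - pt x' y') <= 2 * s.
Proof.
move=> /andP[? ?] /andP[? ?] /andP[? ?] /andP[? ?].
rewrite ptB (le_trans (cabs_pt _ _)) //.
have : `|x - x'| <= s by rewrite ler_norml; apply/andP; split; lra.
have : `|y - y'| <= s by rewrite ler_norml; apply/andP; split; lra.
lra.
Qed.

(* The imaginary part of dz / (z - w) is the angle under which the boundary
   element is seen from w, so that each side contributes a positive amount. *)
Lemma bsum_inv_lower a b s d z n : 0 < d -> 0 < s ->
  a + d <= complex.Re z -> complex.Re z <= a + s - d ->
  b + d <= complex.Im z -> complex.Im z <= b + s - d ->
  d / s <= cabs (bsum n (fun u => (u - z)^-1) a b s).
Proof.
move=> d0 s0 h1 h2 h3 h4; apply: le_trans (Im_le_cabs _).
rewrite ler_normr; apply/orP; left.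
set x0 := complex.Re z in h1 h2 *; set y0 := complex.Im z in h3 h4 *.
have zE : z = pt x0 y0 by rewrite -ptE.
have q u v : `|u| <= s -> `|v| <= s -> d <= `|u| \/ d <= `|v| ->
    0 < u ^+ 2 + v ^+ 2 <= 2 * s ^+ 2.
  move=> us vs duv; rewrite -(real_normK (num_real u)) -(real_normK (num_real v)).
  apply/andP; split; last first.
    have : `|u| ^+ 2 <= s ^+ 2 by rewrite lerXn2r // nnegrE ?normr_ge0 // ltW.
    have : `|v| ^+ 2 <= s ^+ 2 by rewrite lerXn2r // nnegrE ?normr_ge0 // ltW.
    lra.
  case: duv => duv.
    by rewrite ltr_wpDr ?sqr_ge0 // exprn_gt0 // (lt_le_trans d0).
  by rewrite ltr_wpDl ?sqr_ge0 // exprn_gt0 // (lt_le_trans d0).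
have key u v e : d <= e -> 0 < u ^+ 2 + v ^+ 2 <= 2 * s ^+ 2 ->
    d / (2 * s ^+ 2) <= e / (u ^+ 2 + v ^+ 2).
  move=> de /andP[p1 p2]; apply: (@le_trans _ _ (e / (2 * s ^+ 2))).
    by rewrite ler_wpM2r // invr_ge0 mulr_ge0 // sqr_ge0.
  by rewrite ler_wpM2l ?lef_pV2 ?posrE ?mulr_gt0 ?exprn_gt0 //; lra.
have sc : s * (d / (2 * s ^+ 2)) = d / (2 * s).
  by field; rewrite gt_eqF.
have four : d / s <= 4 * (d / (2 * s)).
  have -> : 4 * (d / (2 * s)) = 2 * (d / s) by field; rewrite gt_eqF.
  have : 0 < d / s by rewrite divr_gt0.
  lra.
(* The four sides with their orientations; the summand [0 * 0] gives the last three integrands the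
   shape expected by [msum_lin]. *)
pose k1 x := (pt x b - z)^-1.
pose k2 x := -1 * (pt x (b + s) - z)^-1 + 0 * 0.
pose k3 y := 'i * (pt (a + s) y - z)^-1 + 0 * 0.
pose k4 y := - 'i * (pt a y - z)^-1 + 0 * 0.
have -> : bsum n (fun u => (u - z)^-1) a b s =
    msum n k1 a s + msum n k2 a s + (msum n k3 b s + msum n k4 b s).
  by rewrite /bsum /k2 /k3 /k4 !msum_lin; ring.
rewrite !raddfD /=.
have I1 : d / (2 * s) <= complex.Im (msum n k1 a s).
  rewrite -sc; apply: Im_msum => [|x /andP[x1 x2]]; first exact: ltW.
  rewrite /k1 zE ptB inv_pt Im_pt; apply: key; first lra.
  by apply: q; rewrite ?ler_norml ?ler_normr; [apply/andP; split; lra..|];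
     right; apply/orP; right; lra.
have I2 : d / (2 * s) <= complex.Im (msum n k2 a s).
  rewrite -sc; apply: Im_msum => [|x /andP[x1 x2]]; first exact: ltW.
  rewrite /k2 zE ptB inv_pt mulr0 addr0 mulN1r ImN Im_pt -mulNr opprK.
  apply: key; first lra.
  by apply: q; rewrite ?ler_norml ?ler_normr; [apply/andP; split; lra..|];
     right; apply/orP; left; lra.
have I3 : d / (2 * s) <= complex.Im (msum n k3 b s).
  rewrite -sc; apply: Im_msum => [|x /andP[x1 x2]]; first exact: ltW.
  rewrite /k3 zE ptB inv_pt mulr0 addr0 mulri_pt Im_pt.
  apply: key; first lra.
  by apply: q; rewrite ?ler_norml ?ler_normr; [apply/andP; split; lra..|];
     left; apply/orP; left; lra.
have I4 : d / (2 * s) <= complex.Im (msum n k4 b s).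
  rewrite -sc; apply: Im_msum => [|x /andP[x1 x2]]; first exact: ltW.
  rewrite /k4 zE ptB inv_pt mulr0 addr0 mulNr mulri_pt ImN Im_pt -mulNr.
  apply: key; first lra.
  by apply: q; rewrite ?ler_norml ?ler_normr; [apply/andP; split; lra..|];
     left; apply/orP; right; lra.
lra.
Qed.

(* Applied to (f - f z)^2 / (u - z), which is everywhere differentiable, the
   theorem of Goursat bounds f z by the values of f on the boundary. *)
Lemma max_crude a b s z : 0 < s -> interior_square z a b s ->
  exists2 A : R, 0 < A & forall f M, 0 < M ->
    on_square (fun u => cder f u) a b s ->
    on_boundary (fun u => cabs (f u) <= M) a b s -> cabs (f z) <= A * M.
Proof.
move=> s0 [i1 i2 i3 i4].
set x0 := complex.Re z in i1 i2; set y0 := complex.Im z in i3 i4.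
have [d d0 [d1 d2 d3 d4]] : exists2 d, 0 < d & [/\ a + d <= x0, x0 <= a + s - d,
    b + d <= y0 & y0 <= b + s - d].
  exists (Num.min (Num.min (x0 - a) (a + s - x0)) (Num.min (y0 - b) (b + s - y0))).
    by rewrite !lt_min !subr_gt0 i1 i2 i3 i4.
  set m := Num.min _ _.
  have : m <= x0 - a by rewrite !ge_min lexx.
  have : m <= a + s - x0 by rewrite !ge_min lexx orbT.
  have : m <= y0 - b by rewrite !ge_min lexx !orbT.
  have : m <= b + s - y0 by rewrite !ge_min lexx !orbT.
  by move=> *; split; lra.
have bd := boundary_dist d1 d2 d3 d4.
have lb n := bsum_inv_lower n d0 s0 d1 d2 d3 d4.
pose A := 4 * s / d / (d / s).
have ds : 0 < d / s by rewrite divr_gt0.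
have A0 : 0 < A by rewrite /A !divr_gt0 // mulr_gt0.
exists (2 * A + 1) => [|f M M0 fd fM]; first lra.
have zin : cder f z.
  by rewrite [z]ptE; apply: fd; apply/andP; split; rewrite ltW.
(* The square supplies a factor u - z that makes k differentiable at z, where the quotient itself is
   only known to be continuous. *)
pose k u := (u - z) * dquot f z u ^+ 2.
have kd : on_square (fun u => cder k u) a b s.
  move=> x y hx hy; have [e|ne] := eqVneq (pt x y) z.
    by rewrite e; apply: dmul_zero; apply: ccont_exp; exact: dquot_ccont_at.
  apply: (@dmul _ (fun u => u - z) (fun u => dquot f z u ^+ 2)).
    exact: (@dsub _ id (fun=> z) _ (@did _ _) (@dcst _ _ _)).
  by apply: (@dexp _ (dquot f z)); apply: dquot_derivable => //; apply: fd.
have G := goursat s0 kd.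
pose v := cabs (f z).
(* Expanding (f u - f z)^2 isolates f z ^ 2 times the sum of 1 / (u - z), bounded below by [lb],
   against terms of size M^2 + 2 M v. The quadratic inequality forces v <= (2 A + 1) M. *)
suff H : v ^+ 2 <= A * (M ^+ 2 + 2 * M * v).
  rewrite leNgt; apply/negP => hlt.
  rewrite -/v in hlt.
  have AM : 0 < A * M by rewrite mulr_gt0.
  have Mv : M < v by apply: le_lt_trans hlt; lra.
  have v0 : 0 < v by apply: lt_trans Mv.
  have H1 : M * M <= M * v by rewrite ler_pM2l // ltW.
  have H2 : (2 * A + 1) * M * v < v * v by rewrite ltr_pM2r.
  have H3 : 0 < M * v by rewrite mulr_gt0.
  have H4 : A * (M * M) <= A * (M * v) by rewrite ler_pM2l.
  move: H; rewrite !expr2; nra.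
apply/ler_addgt0Pr => e e0.
have e1 : 0 < e * (d / s) / s ^+ 2 by apply: divr_gt0; [exact: mulr_gt0 | exact: exprn_gt0].
have [n /(_ n (leqnn _))] := G _ e1; rewrite divfK ?gt_eqF ?exprn_gt0 // => hG.
pose k1 u := (f u ^+ 2 - 2 * f u * f z) * (u - z)^-1.
pose k2 u := (u - z)^-1.
have kE : bsum n k a b s = 1 * bsum n k1 a b s + f z ^+ 2 * bsum n k2 a b s.
  rewrite -bsum_lin; apply: eq_bsum; first exact: ltW.
  apply: on_boundaryW bd => u du.
  have uz : u - z != 0 by rewrite -cabs_gt0 (lt_le_trans d0).
  have uz' : u != z by rewrite -subr_eq0.
  by rewrite /k /k1 /k2 /dquot (negPf uz'); field.
have h1 : cabs (bsum n k1 a b s) <= 4 * s * ((M ^+ 2 + 2 * M * v) / d).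
  apply: cabs_bsum; first exact: ltW.
  apply: on_boundaryW (on_boundaryI bd fM) => u [du fu].
  rewrite /k1 cabsM cabsV; apply: ler_pM; rewrite ?cabs_ge0 ?invr_ge0 ?cabs_ge0 //.
    rewrite (le_trans (cabsB _ _)) // cabsX !cabsM cabs_nat -/v lerD //.
      by rewrite lerXn2r // nnegrE ?cabs_ge0 // ltW.
    by rewrite ler_wpM2r ?cabs_ge0 // ler_wpM2l.
  by rewrite lef_pV2 ?posrE // (lt_le_trans d0).
have h2 : v ^+ 2 * (d / s) <= cabs (f z ^+ 2 * bsum n k2 a b s).
  by rewrite cabsM cabsX ler_wpM2l ?sqr_ge0 // lb.
have h3 : cabs (f z ^+ 2 * bsum n k2 a b s) <=
    cabs (bsum n k a b s) + cabs (bsum n k1 a b s).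
  have -> : f z ^+ 2 * bsum n k2 a b s = bsum n k a b s - bsum n k1 a b s.
    by rewrite kE; ring.
  exact: cabsB.
have h4 : v ^+ 2 * (d / s) <= e * (d / s) + 4 * s * ((M ^+ 2 + 2 * M * v) / d).
  by lra.
rewrite -ler_pdivlMr // in h4; apply: (le_trans h4).
rewrite le_eqVlt; apply/orP; left; apply/eqP; rewrite /A.
by field; rewrite !gt_eqF.
Qed.

(* Isolated points of continuity E are removed by applying the case of fewer
   points to (u - t) g^p and letting p grow. *)
Lemma max_principle (E : seq C) a b s f M : 0 < s -> 0 < M ->
  on_square (fun u => u \notin E -> cder f u) a b s ->
  on_square (fun u => u \in E -> ccont f u) a b s ->
  on_boundary (fun u => cabs (f u) <= M) a b s ->
  forall z, interior_square z a b s -> z \notin E -> cabs (f z) <= M.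
Proof.
move=> s0; elim: E f M => [|t E IH] f M M0 fd fc fM z zin zE.
  (* The powers f^p satisfy the crude bound with the same A, which disappears when p grows. *)
  have [A A0 AP] := max_crude s0 zin.
  apply: (@pow_le _ 1 A) => // [|p]; first exact: cabs_ge0.
  rewrite mul1r -cabsX; apply: (AP (fun u => f u ^+ p)); first exact: exprn_gt0.
    by move=> x y hx hy; apply: (@dexp _ f); apply: fd.
  apply: on_boundaryW fM => u fu.
  by rewrite cabsX; apply: lerXn2r => //; rewrite nnegrE ?cabs_ge0 // ltW.
have [zt zE'] : z != t /\ z \notin E.
  by move: zE; rewrite inE negb_or => /andP[].
pose D := 2 * s + cabs (pt a b - t).
have D0 : 0 < D by rewrite /D; have := cabs_ge0 (pt a b - t); lra.
apply: (@pow_le _ (cabs (z - t)) D) => // [||p].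
- by rewrite cabs_gt0 subr_eq0.
- exact: cabs_ge0.
rewrite -cabsX -cabsM; apply: (IH (fun u => (u - t) * f u ^+ p)) => //.
- by rewrite mulr_gt0 // exprn_gt0.
- move=> x y hx hy uE; have [e|ne] := eqVneq (pt x y) t.
    rewrite e; apply: dmul_zero; apply: ccont_exp.
    by rewrite -e; apply: fc => //; rewrite e mem_head.
  apply: (@dmul _ (fun u => u - t) (fun u => f u ^+ p)).
    exact: (@dsub _ id (fun=> t) _ (@did _ _) (@dcst _ _ _)).
  by apply: (@dexp _ f); apply: fd => //; rewrite inE negb_or ne.
- move=> x y hx hy uE; apply: ccont_mul.
    apply: cder_cont.
    exact: (@dsub _ id (fun=> t) _ (@did _ _) (@dcst _ _ _)).
  by apply: ccont_exp; apply: fc => //; rewrite inE uE orbT.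
have bD : on_boundary (fun u => cabs (u - t) <= D) a b s.
  apply: on_square_boundary => [|x y hx hy]; first exact: ltW.
  have -> : pt x y - t = (pt x y - pt a b) + (pt a b - t) by ring.
  rewrite (le_trans (cabsD _ _)) // lerD2r.
  apply: (square_diam hx hy); first by rewrite lexx lerDl ltW.
  by rewrite lexx lerDl ltW.
apply: on_boundaryW (on_boundaryI bD fM) => u [uD fu].
rewrite cabsM cabsX; apply: ler_pM; rewrite ?cabs_ge0 ?exprn_ge0 ?cabs_ge0 //.
by apply: lerXn2r => //; rewrite nnegrE ?cabs_ge0 // ltW.
Qed.

Lemma interior_center (t0 z : C) (r : R) : cabs (z - t0) < r ->
  interior_square z (complex.Re t0 - r) (complex.Im t0 - r) (2 * r).
Proof.
move=> h; have := Re_le_cabs (z - t0); have := Im_le_cabs (z - t0).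
rewrite !raddfB /= !ler_norml => /andP[? ?] /andP[? ?].
by split; lra.
Qed.

Lemma square_center (t0 : C) (r x y : R) :
  complex.Re t0 - r <= x <= complex.Re t0 - r + 2 * r ->
  complex.Im t0 - r <= y <= complex.Im t0 - r + 2 * r ->
  cabs (pt x y - t0) <= 2 * r.
Proof.
move=> /andP[? ?] /andP[? ?]; rewrite {1}[t0]ptE ptB (le_trans (cabs_pt _ _)) //.
have : `|x - complex.Re t0| <= r by rewrite ler_norml; apply/andP; split; lra.
have : `|y - complex.Im t0| <= r by rewrite ler_norml; apply/andP; split; lra.
lra.
Qed.

Lemma boundary_center (t0 z : C) (r e : R) : cabs (z - t0) < e ->
  on_boundary (fun u => r - e <= cabs (u - z))
    (complex.Re t0 - r) (complex.Im t0 - r) (2 * r).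
Proof.
move=> h; have := Re_le_cabs (z - t0); have := Im_le_cabs (z - t0).
rewrite !raddfB /= !ler_norml => /andP[? ?] /andP[? ?].
by apply: boundary_dist; lra.
Qed.

(** Dividing out a zero t with |t - t0| < eta multiplies the boundary bound by at most 1 / (r -
    eta), and the value at z is recovered with a factor |z - t| <= |z - t0| + eta. Each division
    thus gains theta. E lists the zeros already divided out, where the quotient is known only to be
    continuous. *)
Lemma zeros_decay (t0 z : C) (r eta theta : R) (k : nat) :
  0 < eta -> eta < r -> cabs (z - t0) < r ->
  (cabs (z - t0) + eta) / (r - eta) <= theta ->
  let sq P := on_square P (complex.Re t0 - r) (complex.Im t0 - r) (2 * r) in
  forall (E : seq C) f M, 0 < M ->
  sq (fun u => u \notin E -> cder f u) ->
  sq (fun u => u \in E -> ccont f u) ->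
  (forall e, 0 < e -> exists t, [/\ 0 < cabs (t - t0), cabs (t - t0) < e, t \notin E & f t = 0]) ->
  on_boundary (fun u => cabs (f u) <= M) (complex.Re t0 - r) (complex.Im t0 - r) (2 * r) ->
  z \notin E -> cabs (f z) <= M * theta ^+ k.
Proof.
move=> eta0 etar zr hth sq.
have r2 : 0 < 2 * r by lra.
have re : 0 < r - eta by lra.
have th0 : 0 <= theta.
  apply: le_trans hth; apply: divr_ge0; last exact: ltW.
  by apply: addr_ge0; [exact: cabs_ge0 | exact: ltW].
elim: k => [|k IH] E f M M0 fd fc fz fM zE.
  rewrite expr0 mulr1; apply: (max_principle r2 M0 fd fc fM) => //.
  exact: interior_center.
have [t [t1 t2 tE ft]] := fz eta eta0.
have [->|fz0] := eqVneq (f z) 0; first by rewrite cabs0 mulr_ge0 ?exprn_ge0 // ltW.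
have zt : z != t by apply: contra fz0 => /eqP ->; rewrite ft.
have tsq : cder f t.
  have [? ? ? ?] := interior_center (lt_trans t2 etar).
  by rewrite [t]ptE; apply: fd; rewrite -?ptE //; apply/andP; split; exact: ltW.
have -> : f z = (z - t) * dquot f t z by rewrite dquotE ft subr0.
rewrite cabsM.
have : cabs (dquot f t z) <= M / (r - eta) * theta ^+ k.
  apply: (IH (t :: E)) => //.
  - by rewrite divr_gt0.
  - move=> x y hx hy; rewrite inE negb_or => /andP[h1 h2].
    by apply: dquot_derivable => //; apply: fd.
  - move=> x y hx hy; have [-> _|h1] := eqVneq (pt x y) t.
      exact: dquot_ccont_at.
    rewrite inE (negPf h1) /= => h2.
    by apply: dquot_ccont_out => //; apply: fc.
  - move=> e e0; have [|u [u1 u2 uE fu]] := fz (Num.min e (cabs (t - t0))).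
      by rewrite lt_min e0.
    move: u2; rewrite lt_min => /andP[u2 u3].
    have ut : u != t by apply/eqP => ee; rewrite ee ltxx in u3.
    exists u; split=> //; first by rewrite inE negb_or ut.
    by rewrite /dquot (negPf ut) fu ft subrr mul0r.
  - apply: on_boundaryW (on_boundaryI (boundary_center r t2) fM) => u [u1 u2].
    have ut : u != t by rewrite -subr_eq0 -cabs_gt0 (lt_le_trans re).
    rewrite /dquot (negPf ut) ft subr0 cabsM cabsV.
    apply: ler_pM; rewrite ?cabs_ge0 ?invr_ge0 ?cabs_ge0 //.
    by rewrite lef_pV2 ?posrE // (lt_le_trans re).
  - by rewrite inE negb_or zt.
move=> H.
have h1 : cabs (z - t) <= cabs (z - t0) + eta.
  have -> : z - t = (z - t0) - (t - t0) by ring.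
  by rewrite (le_trans (cabsB _ _)) // lerD2l ltW.
apply: (@le_trans _ _ ((cabs (z - t0) + eta) * (M / (r - eta) * theta ^+ k))).
  by apply: ler_pM; rewrite ?cabs_ge0.
have -> : (cabs (z - t0) + eta) * (M / (r - eta) * theta ^+ k) =
  (cabs (z - t0) + eta) / (r - eta) * (M * theta ^+ k) by ring.
rewrite exprS [X in _ <= X]mulrCA; apply: ler_wpM2r => //.
by rewrite mulr_ge0 ?exprn_ge0 // ltW.
Qed.

(** Accumulating zeros can be divided out any number of times, and theta < 1 makes M theta^k tend to
    0. The radius drops to rho / 3 because the estimates take place on a square of half side rho / 3
    inside the disc of radius rho. *)
Lemma identity_theorem (f : C -> C) (t0 : C) (rho : R) : 0 < rho ->
  (forall t, cabs (t - t0) < rho -> cder f t) ->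
  (forall e, 0 < e -> exists t, [/\ 0 < cabs (t - t0), cabs (t - t0) < e & f t = 0]) ->
  forall t, cabs (t - t0) < rho / 3 -> f t = 0.
Proof.
move=> rho0 fd fz z zr; pose r := rho / 3.
have r0 : 0 < r by rewrite /r; lra.
pose v := cabs (z - t0); have v0 : 0 <= v by exact: cabs_ge0.
have vr : v < r by [].
pose eta := (r - v) / 4.
pose theta := (v + eta) / (r - eta).
have eta0 : 0 < eta by rewrite /eta; lra.
have etar : eta < r by rewrite /eta; lra.
have th0 : 0 < theta by rewrite /theta divr_gt0 //; lra.
have th1 : theta < 1 by rewrite /theta ltr_pdivrMr /eta; lra.
have fsq : on_square (fun u => cder f u)
    (complex.Re t0 - r) (complex.Im t0 - r) (2 * r).
  move=> x y hx hy; apply: fd; apply: le_lt_trans (square_center hx hy) _.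
  by rewrite /r; lra.
have [M M0 fM] := bounded_on_square (mulr_gt0 (ltr0Sn _ 1) r0) fsq.
have main k : cabs (f z) <= M * theta ^+ k.
  apply: (@zeros_decay t0 z r eta theta k eta0 etar vr (lexx _) [::] f M) => //.
  - by move=> x y hx hy _; apply: fsq.
  - by move=> e /fz[t [? ? ?]]; exists t.
  - by apply: on_square_boundary => //; lra.
apply/eqP; rewrite -cabs_eq0; apply/negPn/negP => fz0.
have fzp : 0 < cabs (f z) by rewrite lt_def fz0 cabs_ge0.
have : theta^-1 <= 1.
  apply: (@pow_le _ (cabs (f z)) M) => // [|p]; first by rewrite invr_ge0 ltW.
  by rewrite expr1n mulr1 exprVn ler_pdivrMr ?exprn_gt0.
by rewrite invf_le1 // leNgt th1.
Qed.

(** Maximum principle for the difference quotient at 0, with 0 as exceptional point. On the boundary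
    of the square of half side rho / 3 the quotient is at most 2 M / (rho / 3). *)
Lemma schwarz (f : C -> C) (rho M : R) : 0 < rho -> 0 < M ->
  (forall t, cabs t < rho -> cder f t) ->
  (forall t, cabs t < rho -> cabs (f t) <= M) ->
  forall t, cabs t < rho / 3 -> cabs (f t - f 0) <= 6 * M / rho * cabs t.
Proof.
move=> rho0 M0 fd fM t tr.
have [->|t0] := eqVneq t 0; first by rewrite subrr !cabs0 mulr0.
pose r := rho / 3; have r0 : 0 < r by rewrite /r; lra.
rewrite -dquotE cabsM mulrC subr0 ler_wpM2r ?cabs_ge0 //.
have f00 : cder f 0 by apply: fd; rewrite cabs0.
have sqr x y : complex.Re (0 : C) - r <= x <= complex.Re (0 : C) - r + 2 * r ->
    complex.Im (0 : C) - r <= y <= complex.Im (0 : C) - r + 2 * r ->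
    cabs (pt x y) < rho.
  move=> hx hy; have := square_center hx hy.
  by rewrite subr0 => h; apply: le_lt_trans h _; rewrite /r; lra.
have r20 : 0 < 2 * r by lra.
have MM : 0 < 6 * M / rho by rewrite divr_gt0 // mulr_gt0.
apply: (@max_principle [:: 0] (complex.Re (0 : C) - r) (complex.Im (0 : C) - r) (2 * r)) => //.
- move=> x y hx hy; rewrite inE => h; apply: dquot_derivable => //.
  by apply: fd; apply: sqr.
- by move=> x y hx hy; rewrite inE => /eqP ->; exact: dquot_ccont_at.
- have b1 : on_boundary (fun u => cabs u < rho)
      (complex.Re (0 : C) - r) (complex.Im (0 : C) - r) (2 * r).
    by apply: on_square_boundary => //; lra.
  have : on_boundary (fun u => r <= cabs (u - 0))
      (complex.Re (0 : C) - r) (complex.Im (0 : C) - r) (2 * r).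
    by apply: boundary_dist; rewrite /=; lra.
  move=> /(on_boundaryI b1); apply: on_boundaryW => u [u1]; rewrite subr0 => u2.
  have u0 : u != 0 by rewrite -cabs_gt0 (lt_le_trans r0).
  rewrite /dquot (negPf u0) subr0 cabsM cabsV ler_pdivrMr ?cabs_gt0 //.
  apply: (@le_trans _ _ (2 * M)).
    rewrite (le_trans (cabsB _ _)) //.
    have := fM u u1; have : cabs (f 0) <= M by apply: fM; rewrite cabs0.
    by lra.
  have -> : 2 * M = 6 * M / rho * r by rewrite /r; field; rewrite gt_eqF.
  by rewrite ler_pM2l.
- by apply: interior_center; rewrite subr0.
- by rewrite inE.
Qed.

Lemma cauchy_estimate (f : C -> C) (rho M : R) : 0 < rho -> 0 < M ->
  (forall t, cabs t < rho -> cder f t) ->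
  (forall t, cabs t < rho -> cabs (f t) <= M) ->
  cabs ('D_1 f 0) <= 6 * M / rho.
Proof.
move=> rho0 M0 fd fM; apply/ler_addgt0Pr => e e0.
have f0 : cder f 0 by apply: fd; rewrite cabs0.
have [d d0 dP] := cderP f0 e0.
pose h := toC (Num.min d (rho / 3) / 2).
have h0 : 0 < Num.min d (rho / 3) by rewrite lt_min d0 divr_gt0.
have hE : cabs h = Num.min d (rho / 3) / 2.
  by rewrite cabs_toC gtr0_norm // divr_gt0.
have m1 : Num.min d (rho / 3) <= d by rewrite ge_min lexx.
have m2 : Num.min d (rho / 3) <= rho / 3 by rewrite ge_min lexx orbT.
have hd : cabs h < d by rewrite hE; lra.
have hr : cabs h < rho / 3 by rewrite hE; lra.
have := dP h hd; rewrite add0r => H1.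
have H2 := schwarz rho0 M0 fd fM hr.
have hp : 0 < cabs h by rewrite hE; lra.
rewrite -(ler_pM2r hp) -cabsM.
have -> : 'D_1 f 0 * h = (f h - f 0) - (f h - f 0 - 'D_1 f 0 * h) by ring.
apply: (le_trans (cabsB _ _)); rewrite mulrDl; lra.
Qed.

End IdentityTheorem.

(** * Local properties of functions of one variable *)

Section LocalBehaviour.
Variable R : realType.
Local Notation C := (Cfield R).
Implicit Types (P Q : C -> Prop) (f g : C -> C).

Definition evt P := exists2 d : R, 0 < d & forall t, cabs t < d -> P t.

Lemma evt_and P Q : evt P -> evt Q -> evt (fun t => P t /\ Q t).
Proof.
move=> [d d0 dP] [e e0 eP]; exists (Num.min d e); first by rewrite lt_min d0.
by move=> t; rewrite lt_min => /andP[/dP ? /eP ?].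
Qed.

Lemma evtW P Q : (forall t, P t -> Q t) -> evt P -> evt Q.
Proof. by move=> PQ [d d0 dP]; exists d => // t /dP /PQ. Qed.

Lemma evt_true P : (forall t, P t) -> evt P.
Proof. by move=> h; exists 1. Qed.

Lemma evt_all (I : finType) (P : I -> C -> Prop) : (forall i, evt (P i)) ->
  evt (fun t => forall i, P i t).
Proof.
move=> h; suff : evt (fun t => forall i, i \in enum I -> P i t).
  by apply: evtW => t ht i; apply: ht; rewrite mem_enum.
elim: (enum I) => [|i r IH]; first exact: evt_true.
apply: evtW (evt_and (h i) IH) => t [h1 h2] j.
by rewrite inE => /orP[/eqP ->|/h2].
Qed.

Lemma evt_conj P : evt P -> evt (fun t => P (t^*)).
Proof. by move=> [d d0 dP]; exists d => // t td; apply: dP; rewrite cabs_conj. Qed.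

Lemma evt_punctured P : evt P -> forall e : R, 0 < e -> exists t : C,
  [/\ 0 < cabs (t - 0), cabs (t - 0) < e & P t].
Proof.
move=> [d d0 dP] e e0; pose m := Num.min d e.
have m0 : 0 < m by rewrite lt_min d0.
have md : m <= d by rewrite ge_min lexx.
have me : m <= e by rewrite ge_min lexx orbT.
exists (toC (m / 2)); rewrite subr0 cabs_toC gtr0_norm; last lra.
by split; [lra|lra|apply: dP; rewrite cabs_toC gtr0_norm; lra].
Qed.

Lemma evt_ccont f z e : ccont f z -> 0 < e -> evt (fun h => cabs (f (z + h) - f z) < e).
Proof. by move=> fz /fz. Qed.

Lemma ccont_neq0 f z : ccont f z -> f z != 0 -> evt (fun h => f (z + h) != 0).
Proof.
move=> fz fz0; have f0 : 0 < cabs (f z) by rewrite cabs_gt0.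
apply: evtW (evt_ccont fz f0) => h hh; apply: contraTneq hh => ->.
by rewrite sub0r cabsN ltxx.
Qed.

Lemma ccont_cst (c : C) z : ccont (fun=> c) z.
Proof. by move=> e e0; exists 1 => // h _; rewrite subrr cabs0. Qed.

Lemma ccont_add f g z : ccont f z -> ccont g z -> ccont (fun t => f t + g t) z.
Proof.
move=> fz gz e e0; have e2 : 0 < e / 2 by lra.
apply: evtW (evt_and (fz _ e2) (gz _ e2)) => h [h1 h2].
have -> : f (z + h) + g (z + h) - (f z + g z) =
  (f (z + h) - f z) + (g (z + h) - g z) by ring.
by apply: (le_lt_trans (cabsD _ _)); lra.
Qed.

Lemma ccont_sum (I : Type) (r : seq I) (f : I -> C -> C) z :
  (forall i, ccont (f i) z) -> ccont (fun t => \sum_(i <- r) f i t) z.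
Proof.
move=> fz; elim: r => [|i r IH].
  by have -> : (fun t => \sum_(i <- [::]) f i t) = (fun=> 0);
    [apply/funext => t; rewrite big_nil | exact: ccont_cst].
have -> : (fun t => \sum_(j <- i :: r) f j t) =
    (fun t => f i t + \sum_(j <- r) f j t).
  by apply/funext => t; rewrite big_cons.
exact: ccont_add (fz i) IH.
Qed.

Lemma ccont_prod (I : Type) (r : seq I) (f : I -> C -> C) z :
  (forall i, ccont (f i) z) -> ccont (fun t => \prod_(i <- r) f i t) z.
Proof.
move=> fz; elim: r => [|i r IH].
  by have -> : (fun t => \prod_(i <- [::]) f i t) = (fun=> 1);
    [apply/funext => t; rewrite big_nil | exact: ccont_cst].
have -> : (fun t => \prod_(j <- i :: r) f j t) =
    (fun t => f i t * \prod_(j <- r) f j t).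
  by apply/funext => t; rewrite big_cons.
exact: ccont_mul (fz i) IH.
Qed.

Lemma ccont_det n (A : C -> 'M[C]_n) z : (forall i j, ccont (fun t => A t i j) z) ->
  ccont (fun t => \det (A t)) z.
Proof.
move=> Az; apply: ccont_sum => s; apply: ccont_mul; first exact: ccont_cst.
by apply: ccont_prod => i; exact: Az.
Qed.

Lemma ccont_conj f z : ccont f z -> ccont (fun t => (f t)^*) z.
Proof. by move=> fz e /fz; apply: evtW => h; rewrite -rmorphB /= cabs_conj. Qed.

Lemma ccont_comp f g z : ccont f z -> ccont g (f z) -> ccont (fun t => g (f t)) z.
Proof.
move=> fz gz e /gz[d d0 dP]; apply: evtW (fz d d0) => h /dP.
by rewrite [f z + _]addrC subrK.
Qed.

Lemma cder_ccont f z : cder f z -> ccont f z.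
Proof. exact: cder_cont. Qed.

Lemma cder_conj f z : cder f (z^*) -> cder (fun t => (f (t^*))^*) z.
Proof.
move=> /cderP fz; exists (('D_1 f (z^*))^*) => e /fz[d d0 dP].
exists d => // h; rewrite -cabs_conj => /dP; rewrite cabs_conj.
apply: le_trans; rewrite -cabs_conj le_eqVlt; apply/orP; left; apply/eqP; congr cabs.
by rewrite !rmorphB !rmorphD rmorphM /= !conjCK.
Qed.

Lemma cdiffD f g z c d : cdiff f z c -> cdiff g z d -> cdiff (fun t => f t + g t) z (c + d).
Proof.
move=> fz gz e e0; have e2 : 0 < e / 2 by lra.
apply: evtW (evt_and (fz _ e2) (gz _ e2)) => h [h1 h2].
have -> : f (z + h) + g (z + h) - (f z + g z) - (c + d) * h =
  (f (z + h) - f z - c * h) + (g (z + h) - g z - d * h) by ring.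
by apply: (le_trans (cabsD _ _)); lra.
Qed.

Lemma cdiffZ f z c k : cdiff f z c -> cdiff (fun t => f t * k) z (c * k).
Proof.
move=> fz e e0; have k0 : 0 < cabs k + 1 by have := cabs_ge0 k; lra.
apply: evtW (fz _ (divr_gt0 e0 k0)) => h h1.
have -> : f (z + h) * k - f z * k - c * k * h = (f (z + h) - f z - c * h) * k by ring.
rewrite cabsM; apply: (@le_trans _ _ (e / (cabs k + 1) * cabs h * (cabs k + 1))).
  by apply: ler_pM; rewrite ?cabs_ge0 // lerDl.
by rewrite mulrAC divfK ?gt_eqF.
Qed.

Lemma cdiff_cst z (c : C) : cdiff (fun=> c) z 0.
Proof.
by move=> e e0; exists 1 => // h _; rewrite subrr mul0r subrr cabs0 mulr_ge0 ?cabs_ge0 ?ltW.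
Qed.

Lemma cdiff_sum (I : Type) (r : seq I) (f : I -> C -> C) (d : I -> C) z :
  (forall i, cdiff (f i) z (d i)) ->
  cdiff (fun t => \sum_(i <- r) f i t) z (\sum_(i <- r) d i).
Proof.
move=> fz; elim: r => [|i r IH].
  rewrite big_nil.
  by have -> : (fun t => \sum_(i <- [::]) f i t) = (fun=> 0);
    [apply/funext => t; rewrite big_nil | exact: cdiff_cst].
have -> : (fun t => \sum_(j <- i :: r) f j t) =
    (fun t => f i t + \sum_(j <- r) f j t).
  by apply/funext => t; rewrite big_cons.
by rewrite big_cons; exact: cdiffD (fz i) IH.
Qed.

Lemma cdiff_mulmx q r (phi : C -> 'rV[C]_q) (x : 'rV[C]_q) (D : 'M[C]_(q, r)) z i j :
  (forall k, cdiff (fun t => phi t 0 k) z (x 0 k)) ->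
  cdiff (fun t => (phi t *m D) i j) z ((x *m D) i j).
Proof.
move=> h; rewrite (ord1 i) mxE.
have -> : (fun t => (phi t *m D) 0 j) = (fun t => \sum_k phi t 0 k * D k j).
  by apply/funext => t; rewrite mxE.
by apply: cdiff_sum => k; exact: cdiffZ.
Qed.

Lemma cder_mulmx q r (phi : C -> 'rV[C]_q) (D : 'M[C]_(q, r)) z i j :
  (forall k, cder (fun t => phi t 0 k) z) -> cder (fun t => (phi t *m D) i j) z.
Proof.
move=> h; exists (((\row_k 'D_1 (fun t => phi t 0 k) z) *m D) i j).
by apply: cdiff_mulmx => k; rewrite mxE; exact: cderP.
Qed.

Lemma cdiff_inj f z (c d : C) : cdiff f z c -> cdiff f z d -> c = d.
Proof. by move=> /cdiff_unique <- /cdiff_unique. Qed.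

Lemma cdiff_evt_cst f z (d c : C) : cdiff f z d -> evt (fun h => f (z + h) = c) -> d = 0.
Proof.
move=> fz [e e0 eP]; apply: (cdiff_inj fz) => e' e'0; exists e => // h /eP ->.
have := eP 0; rewrite addr0 => -> //; last by rewrite cabs0.
by rewrite subrr mul0r subrr cabs0 mulr_ge0 ?cabs_ge0 ?ltW.
Qed.

Definition vsmall q (r : R) (u : 'rV[C]_q) : bool := [forall j, cabs (u 0 j) < r].

Lemma vsmallW q (r s : R) (u : 'rV[C]_q) : r <= s -> vsmall r u -> vsmall s u.
Proof. by move=> rs /forallP h; apply/forallP => j; exact: lt_le_trans (h j) rs. Qed.

Lemma vsmall0 q (r : R) : 0 < r -> vsmall r (0 : 'rV[C]_q).
Proof. by move=> r0; apply/forallP => j; rewrite mxE cabs0. Qed.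

Lemma vsmall_evt q (r : R) (u v : 'rV[C]_q) (s : C -> C) : vsmall r u ->
  ccont s 0 -> s 0 = 0 -> evt (fun t => vsmall r (u + s t *: v)).
Proof.
move=> /forallP ur s0 s00.
suff : evt (fun t => forall j, cabs ((u + s t *: v) 0 j) < r).
  by apply: evtW => t ht; apply/forallP.
apply: evt_all => j.
have e0 : 0 < (r - cabs (u 0 j)) / (cabs (v 0 j) + 1).
  by rewrite divr_gt0 ?subr_gt0 //; have := cabs_ge0 (v 0 j); lra.
apply: evtW (evt_ccont s0 e0) => t; rewrite add0r s00 subr0 => ht.
rewrite !mxE; apply: (le_lt_trans (cabsD _ _)); rewrite -ltrBrDl cabsM.
have k0 : 0 < cabs (v 0 j) + 1 by have := cabs_ge0 (v 0 j); lra.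
apply: (@le_lt_trans _ _ (cabs (s t) * (cabs (v 0 j) + 1))).
  by rewrite ler_wpM2l ?cabs_ge0 // lerDl.
by rewrite -ltr_pdivlMr.
Qed.

End LocalBehaviour.

(** * Orthogonality preserving maps *)

Section Slice.
Variables (R : realType) (a b a' b' : nat).
Local Notation C := (Cfield R).
Variables (phi : 'rV[C]_(a + b) -> 'rV[C]_(a' + b')) (T : 'M[C]_(a + b, a' + b')).
Variables (r0 : R) (c : C).
Hypothesis r0_gt0 : 0 < r0.
Hypothesis c_gt0 : 0 < c.
Hypothesis phi_cder : forall u e t j, vsmall r0 (u + t *: e) ->
  cder (fun s => phi (u + s *: e) 0 j) t.
Hypothesis phi_ortho : forall u v, vsmall r0 u -> vsmall r0 v ->
  hf u v = 0 -> hf (phi u) (phi v) = 0.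
Hypothesis phi_T : forall u j, cdiff (fun s => phi (s *: u) 0 j) 0 ((u *m T) 0 j).
Hypothesis TT : T *m sgmx a' b' *m adj T = c *: sgmx a b.
Hypothesis a'_lt_2a : (a' < a + a)%N.
Hypothesis a'_lt_ab : (a' < a + b)%N.

Let J' := @sgmx C a' b'.
Let J := @sgmx C a b.
Let J'h : adj J' = J'. Proof. exact: adj_sgmx. Qed.
Let Jh : adj J = J. Proof. exact: adj_sgmx. Qed.

(** For v orthogonal to u, differentiating the orthogonality of phi (s v) and phi u at s = 0 shows
    that phi u is orthogonal to v T; [proportional] then applies. The smallness condition stands
    under the quantifier so that [al] is a total function. *)
Let al_ex u : exists k : C, vsmall r0 u -> phi u *m J' *m adj T = k *: (u *m J).
Proof.
have [us|us] := pselect (vsmall r0 u); last by exists 0.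
suff [k kE] : exists k : C, phi u *m J' *m adj T = k *: (u *m J) by exists k.
apply: proportional => v uv.
have vu : hf v u = 0.
  by rewrite -hf_conj hfE uv mxE conjC0.
have H : hf (v *m T) (phi u) = 0.
  apply: (@cdiff_evt_cst _ (fun s => hf (phi (s *: v)) (phi u)) 0 _ 0).
    have -> : (fun s => hf (phi (s *: v)) (phi u)) =
        (fun s => (phi (s *: v) *m (J' *m adj (phi u))) 0 0).
      by apply/funext => s; rewrite hfE mulmxA.
    rewrite hfE -(mulmxA (v *m T)); apply: cdiff_mulmx => j; exact: phi_T.
  have := @vsmall_evt _ _ r0 0 v id (@vsmall0 _ _ _ r0_gt0) (cder_ccont (@did R 0)) erefl.
  apply: evtW => t; rewrite !add0r => ht; apply: (phi_ortho ht us).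
  by rewrite hfE -!scalemxAl mxE -hfE vu mulr0.
by rewrite -mulmxA -adjM hf_mx1 -hf_conj H conjC0 raddf0.
Qed.

Let al u : C := projT1 (cid (al_ex u)).

Let alE u : vsmall r0 u -> phi u *m J' *m adj T = al u *: (u *m J).
Proof. by rewrite /al; case: cid. Qed.

Let c0 : c != 0. Proof. by rewrite gt_eqF. Qed.

Let Q : 'M[C]_(a' + b') := projT1 (cid (orthogonal_projection T c)).

Let phiQ u : vsmall r0 u -> phi u *m Q = phi u - (c^-1 * al u) *: (u *m T).
Proof. by move=> us; rewrite /Q; case: cid => Q1 Q1P; exact: (Q1P _ _ _ (alE us)). Qed.

Let QT u : vsmall r0 u -> phi u *m Q *m J' *m adj T = 0.
Proof. by move=> us; rewrite phiQ //; apply: residual_form => //; exact: alE. Qed.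

Let K u v := hf (phi u *m Q) (phi v *m Q).

Let KE u v : vsmall r0 u -> vsmall r0 v ->
  hf (phi u) (phi v) = K u v + c^-1 * al u * (al v)^* * hf u v.
Proof. by move=> us vs; rewrite /K !phiQ //; apply: hf_residual => //; exact: alE. Qed.

Let K_ortho u v : vsmall r0 u -> vsmall r0 v -> hf u v = 0 -> K u v = 0.
Proof.
by move=> us vs uv; have := KE us vs; rewrite phi_ortho // uv mulr0 addr0.
Qed.

Let K_conj u v : (K u v)^* = K v u. Proof. exact: hf_conj. Qed.

Let K_cder u e v t : vsmall r0 (u + t *: e) -> cder (fun s => K (u + s *: e) v) t.
Proof.
move=> us.
have -> : (fun s => K (u + s *: e) v) =
    (fun s => (phi (u + s *: e) *m (Q *m (J' *m adj (phi v *m Q)))) 0 0).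
  by apply/funext => s; rewrite /K hf_colE -(mulmxA _ Q).
by apply: cder_mulmx => j; exact: phi_cder.
Qed.

(** For v0 and v of size r1 the points v0 + t (v - v0) with |t| < 4 stay within 9 r1 < r0. The
    radius 4 puts t = 1 in the disc of radius 4 / 3 reached by [identity_theorem]. *)
Let r1 := r0 / 10.
Let r1_gt0 : 0 < r1. Proof. by rewrite /r1 divr_gt0. Qed.
Let r1r0 : r1 <= r0. Proof. by rewrite /r1; have := r0_gt0; lra. Qed.
Let small10 q (u : 'rV[C]_q) : vsmall r1 u -> vsmall r0 u.
Proof. exact: vsmallW r1r0. Qed.

(* Fewer than d values phi (p_i P) Q span all of them; the points p_i P have a
   common orthogonal v_0 which is not orthogonal to all of P, and the p_i can be
   adapted to any v close to v_0. *)
Let K_null d (A : 'M[C]_(d, a)) (B : 'M[C]_(d, b)) (P := row_mx A B) (p : 'rV_d) v :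
  A *m adj A = 1%:M -> B *m adj B = 1%:M -> (a' < d + a)%N ->
  vsmall r1 (p *m P) -> vsmall r1 v -> K (p *m P) v = 0.
Proof.
move=> AA BB da ps vs.
have PP : P *m J *m adj P = 0 by exact: null_frame.
have [r [M [Mf Mrow Mspan]]] := spanning_rows (fun x => exists q : 'rV_d,
  vsmall r1 (q *m P) /\ x = phi (q *m P) *m Q).
have [pf pfE] := choice Mrow.
have pfs i : vsmall r1 (pf i *m P) := (pfE i).1.
have pfM i : row i M = phi (pf i *m P) *m Q := (pfE i).2.
clear Mrow pfE.
(* The rows of M are null and orthogonal to the image of T, so there are at most a' - a < d of
   them. *)
have rd : (r < d)%N.
  have h : (r + a <= a')%N; last by move: da; clear -h; lia.
  apply: (null_rank_bound c_gt0 TT Mf).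
    apply/matrixP => i j; rewrite hf_mx [RHS]mxE !pfM.
    apply: K_ortho; [exact: (small10 (pfs i)) | exact: (small10 (pfs j)) |].
    rewrite hfE adjM mulmxA -(mulmxA _ P) -(mulmxA _ (P *m _)) PP.
    by rewrite mulmx0 mul0mx mxE.
  apply/row_matrixP => i; rewrite !row_mul row0 pfM.
  exact: (QT (small10 (pfs i))).
have [e [w0 [ew0 pw0]]] := common_orthogonal A BB pf rd.
rewrite -/P in ew0 pw0.
clearbody P; clear AA BB A B PP rd.
have [k k0 ks] : exists2 k : C, k != 0 & vsmall r1 (k *: w0).
  have := @vsmall_evt _ _ r1 0 w0 id (@vsmall0 _ _ _ r1_gt0) (cder_ccont (@did R 0)) erefl.
  move=> /evt_punctured/(_ 1 ltr01)[k [k1 _ k3]]; exists k; last by rewrite add0r in k3.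
  by rewrite -cabs_gt0; rewrite subr0 in k1.
pose v0 := k *: w0.
have ev0 : hf v0 (e *m P) != 0.
  by rewrite /v0 hfZ; apply: (mulf_neq0 k0); rewrite -hf_conj conjC_eq0.
have pv0 i : hf v0 (pf i *m P) = 0.
  by rewrite /v0 hfZ -[hf w0 _]hf_conj pw0 conjC0 mulr0.
have v0s : vsmall r1 v0 by [].
clearbody v0.
pose w := v - v0.
pose vt t := v0 + t *: w.
(* The coefficient for which [(pf i - s i t *: e) *m P] is orthogonal to [vt t]; it vanishes at t =
   0. *)
pose s i t := (hf (vt t) (pf i *m P) / hf (vt t) (e *m P))^*.
have hcont x : ccont (fun t => hf (vt t) x) 0.
  have -> : (fun t => hf (vt t) x) = (fun t => hf v0 x + t * hf w x).
    by apply/funext => t; rewrite /vt hf_line.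
  apply: cder_ccont; apply: dadd; first exact: dcst.
  by apply: (@dmul _ id (fun=> hf w x)); [exact: did | exact: dcst].
have vt0 : vt 0 = v0 by rewrite /vt scale0r addr0.
have ev0' : hf (vt 0) (e *m P) != 0 by rewrite vt0.
have scont i : ccont (s i) 0.
  apply: ccont_conj; apply: ccont_mul; first exact: hcont.
  have H1 : (fun t => (hf (vt t) (e *m P))^-1) =
     (fun t => (hf v0 (e *m P) + t * hf w (e *m P))^-1).
    by apply/funext => t; rewrite /vt hf_line.
  rewrite H1; apply: cder_ccont.
  apply: (@dinv _ (fun t => hf v0 (e *m P) + t * hf w (e *m P))).
    apply: dadd; first exact: dcst.
    by apply: (@dmul _ id (fun=> hf w (e *m P))); [exact: did | exact: dcst].
  by rewrite mul0r addr0; rewrite vt0 in ev0'.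
have s0 i : s i 0 = 0.
  by rewrite /s vt0 pv0 mul0r conjC0.
pose pt i t := pf i *m P + s i t *: (- (e *m P)).
have ptE i t : pt i t = (pf i - s i t *: e) *m P.
  by rewrite /pt scalerN mulmxBl -scalemxAl.
pose Mt t : 'M[C]_(r, a' + b') := \matrix_(i < r) (phi (pt i t) *m Q).
have MtK i t : row i (Mt t) = phi (pt i t) *m Q by rewrite rowK.
have [Bi MB] := row_freeP Mf.
have Mt0 : Mt 0 = M.
  by apply/row_matrixP => i; rewrite MtK /pt s0 scale0r addr0 pfM.
have detc : ccont (fun t => \det (Mt t *m Bi)) 0.
  apply: ccont_det => i j.
  have -> : (fun t => (Mt t *m Bi) i j) = (fun t => (phi (pt i t) *m (Q *m Bi)) 0 j).
    by apply/funext => t; rewrite mulmxA -MtK -row_mul [RHS]mxE.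
  apply: (@ccont_comp _ (s i)
    (fun x => (phi (pf i *m P + x *: - (e *m P)) *m (Q *m Bi)) 0 j)) => //.
  apply: cder_ccont; apply: cder_mulmx => l.
  apply: phi_cder; rewrite s0 scale0r addr0; exact: (small10 (pfs i)).
have det0 : \det (Mt 0 *m Bi) != 0 by rewrite Mt0 MB det1 oner_eq0.
have ptsm : evt (fun t => forall i, vsmall r1 (pt i t)).
  apply: evt_all => i; exact: (vsmall_evt _ (pfs i) (scont i) (s0 i)).
have vtsm : evt (fun t => vsmall r1 (vt t)).
  by apply: (@vsmall_evt _ _ r1 v0 w id v0s (cder_ccont (@did R 0)) erefl).
have evne : evt (fun t => hf (vt t) (e *m P) != 0).
  have := ccont_neq0 (hcont (e *m P)) ev0'.
  by apply: evtW => t; rewrite add0r.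
have dete := ccont_neq0 detc det0.
have zeros : evt (fun t => K (vt t) (p *m P) = 0).
  apply: evtW (evt_and (evt_and ptsm vtsm) (evt_and evne dete)) => t.
  rewrite add0r => -[[h1 h2] [h3 h4]].
  have orth i : hf (phi (vt t) *m Q) (row i (Mt t)) = 0.
    rewrite MtK; apply: K_ortho; [exact: (small10 h2)|exact: (small10 (h1 i))|].
    rewrite -hf_conj /pt hf_line -scaleN1r hfZ mulN1r mulrN rmorphB rmorphM /= hf_conj.
    by rewrite /s conjCK hf_conj divfK // subrr.
  (* The values at the moved points remain in the span of M, and the determinant condition makes D
     invertible, so they still span it. Hence phi (p P) Q is orthogonal to phi (vt t) Q as well. *)
  have [D MtD] : exists D, Mt t = D *m M.
    apply/submxP/row_subP => i; rewrite MtK; apply: Mspan.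
    exists (pf i - s i t *: e); rewrite -ptE; split; [exact: (h1 i) | reflexivity].
  have Du : D \in unitmx.
    by rewrite unitmxE unitfE; move: h4; rewrite MtD -mulmxA MB mulmx1.
  have [cc pE] : exists cc, phi (p *m P) *m Q = cc *m M.
    by apply/submxP; apply: Mspan; exists p.
  have -> : K (vt t) (p *m P) =
      (phi (vt t) *m Q *m J' *m adj (Mt t) *m adj (cc *m invmx D)) 0 0.
    rewrite /K hfE pE -(mulmxA _ (adj _)) -adjM; congr ((_ *m adj _) 0 0).
    by rewrite MtD mulmxA mulmxKV.
  have -> : phi (vt t) *m Q *m J' *m adj (Mt t) = 0.
    by apply/matrixP => i j; rewrite (ord1 i) hf_mx row_id orth mxE.
  by rewrite mul0mx mxE.
rewrite -K_conj.
have -> : K v (p *m P) = K (vt 1) (p *m P) by rewrite /vt scale1r /w addrC subrK.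
rewrite (@identity_theorem _ (fun t => K (vt t) (p *m P)) 0 4) ?conjC0 //.
- move=> t; rewrite subr0 => t4; apply: K_cder.
  have ws : vsmall (2 * r1) w.
    apply/forallP => j; rewrite !mxE; apply: (le_lt_trans (cabsB _ _)).
    by have := forallP vs j; have := forallP v0s j; lra.
  apply/forallP => j; rewrite [(v0 + _) 0 j]mxE [(t *: w) 0 j]mxE.
  apply: (le_lt_trans (cabsD _ _)); rewrite cabsM.
  have h1 := forallP v0s j; have h2 := forallP ws j.
  have h3 : cabs t * cabs (w 0 j) <= 4 * (2 * r1).
    by apply: ler_pM; rewrite ?cabs_ge0 ?ltW.
  have r0E : r0 = 10 * r1 by rewrite /r1; field.
  have := r1_gt0; lra.
- by move=> eps eps0; exact: (evt_punctured zeros).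
- by rewrite subr0 cabs1; lra.
Qed.

Lemma slice_kernel : exists (K : 'rV[C]_(a + b) -> 'rV[C]_(a + b) -> C)
    (al : 'rV[C]_(a + b) -> C),
  [/\ forall u v, vsmall r0 u -> vsmall r0 v ->
        hf (phi u) (phi v) = K u v + c^-1 * al u * (al v)^* * hf u v,
      forall u e v t, vsmall r0 (u + t *: e) -> cder (fun s => K (u + s *: e) v) t &
      forall d (A : 'M[C]_(d, a)) (B : 'M[C]_(d, b)) (p : 'rV_d) v,
        A *m adj A = 1%:M -> B *m adj B = 1%:M -> (a' < d + a)%N ->
        vsmall (r0 / 10) (p *m row_mx A B) -> vsmall (r0 / 10) v ->
        K (p *m row_mx A B) v = 0].
Proof. by exists K, al; split; [exact: KE | exact: K_cder | exact: K_null]. Qed.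

Lemma conformal_index : (a <= a')%N.
Proof.
apply: (@null_rank_bound _ _ _ _ _ _ _ c_gt0 TT 0 0); rewrite ?mul0mx //.
by apply: inj_row_free => w _; apply/rowP => -[].
Qed.

End Slice.

(* A kernel vanishing at the points of the special null subspaces row_mx A B
   vanishes on the null cone, a real hypersurface, hence everywhere. *)
Section NullCone.
Variables (R : realType) (a b a' : nat).
Local Notation C := (Cfield R).
Variables (K : 'rV[C]_(a + b) -> 'rV[C]_(a + b) -> C) (r0 : R).
Hypothesis r0_gt0 : 0 < r0.
Hypothesis K_cder : forall u e v t, vsmall r0 (u + t *: e) ->
  cder (fun s => K (u + s *: e) v) t.
Hypothesis K_null : forall d (A : 'M[C]_(d, a)) (B : 'M[C]_(d, b)) (p : 'rV_d) v,
  A *m adj A = 1%:M -> B *m adj B = 1%:M -> (a' < d + a)%N ->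
  vsmall (r0 / 10) (p *m row_mx A B) -> vsmall (r0 / 10) v ->
  K (p *m row_mx A B) v = 0.
Hypothesis aa' : (a <= a')%N.
Hypothesis a'_lt_2a : (a' < a + a)%N.
Hypothesis a'_lt_ab : (a' < a + b)%N.

Let r1 := r0 / 10.
Let r1_gt0 : 0 < r1. Proof. by rewrite /r1 divr_gt0. Qed.
Let D : R := (a + b).+1%:R.
Let D_ge1 : 1 <= D. Proof. by rewrite /D ler1n. Qed.
(** D converts coordinate bounds into Euclidean ones, and 16 is a generous margin. *)
Let r2 := r1 / (16 * D).
Let D0 : 0 < D. Proof. exact: lt_le_trans ltr01 D_ge1. Qed.
Let r2_gt0 : 0 < r2.
Proof. by rewrite /r2; apply: divr_gt0 => //; apply: mulr_gt0. Qed.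
Let Dr2 : 16 * (D * r2) = r1.
Proof. by rewrite /r2; field; rewrite gt_eqF. Qed.
Let r2_le : r2 <= D * r2.
Proof. by rewrite ler_peMl // ltW. Qed.
Let r2r1 : r2 <= r1.
Proof. by have := r2_le; have := Dr2; have := r2_gt0; lra. Qed.

Let sqnorm q (x : 'rV[C]_q) : R := \sum_j cabs (x 0 j) ^+ 2.

Let dot_sqnorm q (x : 'rV[C]_q) : dot x x = toC (sqnorm x).
Proof.
rewrite /sqnorm /toC rmorph_sum; apply: eq_bigr => j _ /=.
by rewrite -sqr_cabs.
Qed.

Let cabs_norm q (x : 'rV[C]_q) : cabs (sqrtC (dot x x)) ^+ 2 = sqnorm x.
Proof.
rewrite -cabsX sqrtCK dot_sqnorm cabs_toC ger0_norm //.
by apply: sumr_ge0 => j _; exact: sqr_ge0.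
Qed.

Let cabs_le_norm q (x : 'rV[C]_q) j : cabs (x 0 j) <= cabs (sqrtC (dot x x)).
Proof.
rewrite -(@ler_pXn2r _ 2) ?nnegrE ?cabs_ge0 // cabs_norm /sqnorm (bigD1 j) //= lerDl.
by apply: sumr_ge0 => i _; exact: sqr_ge0.
Qed.

Let norm_le q (x : 'rV[C]_q) : (q <= a + b)%N -> vsmall r2 x ->
  cabs (sqrtC (dot x x)) <= D * r2.
Proof.
move=> qab /forallP xs; have Dr0 : 0 <= D * r2 by rewrite mulr_ge0 // ltW.
rewrite -(@ler_pXn2r _ 2) ?nnegrE ?cabs_ge0 // cabs_norm /sqnorm.
apply: (@le_trans _ _ (\sum_(j < q) r2 ^+ 2)).
  by apply: ler_sum => j _; rewrite ler_pXn2r ?nnegrE ?cabs_ge0 ?ltW.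
rewrite sumr_const card_ord -mulr_natl [(D * r2) ^+ 2]exprMn ler_wpM2r ?sqr_ge0 //.
apply: (@le_trans _ _ D); first by rewrite /D ler_nat ltnW.
by rewrite expr2 ler_peMl // ltW.
Qed.

(** Cayley transforms of small real numbers are unimodular and accumulate at 1. *)
Let unit_dense e : 0 < e -> exists w : C, [/\ cabs w = 1, w != 1 & cabs (w - 1) < e].
Proof.
move=> e0; pose s := toC (Num.min e 1 / 4) : C.
have m0 : 0 < Num.min e 1 by rewrite lt_min e0 ltr01.
have me : Num.min e 1 <= e by rewrite ge_min lexx.
have m1 : Num.min e 1 <= 1 by rewrite ge_min lexx orbT.
have ss : cabs s = Num.min e 1 / 4 by rewrite cabs_toC gtr0_norm //; lra.
have is_ : cabs ('i * s) = Num.min e 1 / 4 by rewrite cabsM cabsi mul1r.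
have n1 : cabs (1 - 'i * s) = cabs (1 + 'i * s).
  rewrite -cabs_conj rmorphB rmorph1 rmorphM /= conjCi conj_toC; congr cabs.
  by rewrite mulNr opprK.
have dn : 3 / 4 <= cabs (1 - 'i * s).
  have := cabsD (1 - 'i * s) ('i * s); rewrite subrK cabs1; lra.
have dn0 : 0 < cabs (1 - 'i * s) by lra.
have d0 : 1 - 'i * s != 0 by rewrite -cabs_gt0.
have wE : (1 + 'i * s) / (1 - 'i * s) - 1 = 2 * ('i * s) / (1 - 'i * s).
  by apply: (mulIf d0); rewrite mulrBl !divfK //; ring.
have wc : cabs ((1 + 'i * s) / (1 - 'i * s) - 1) = Num.min e 1 / 2 / cabs (1 - 'i * s).
  by rewrite wE [LHS]cabsM cabsV; congr (_ / _); rewrite cabsM is_ cabs_nat; field.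
exists ((1 + 'i * s) / (1 - 'i * s)); split.
- by rewrite cabsM cabsV -n1 divff // gt_eqF.
- rewrite -subr_eq0 -cabs_gt0 wc divr_gt0 //; lra.
- rewrite wc ltr_pdivrMr //; nra.
Qed.

(** If |t| is the quotient of the norms of x and y, the vector (x, t y) is null and lies in a
    special null subspace, so K vanishes. These t fill a circle and accumulate at rho; the disc of
    radius 4 (1 + |rho|) around rho lets the identity theorem reach t = 1. *)
Let K_generic (x : 'rV[C]_a) (y : 'rV[C]_b) v : x != 0 -> y != 0 ->
  vsmall r2 (row_mx x y) -> vsmall r2 v -> K (row_mx x y) v = 0.
Proof.
move=> x0 y0 us vs; pose d := (a' - a)%N.
have xs : vsmall r2 x.
  by apply/forallP => j; have := forallP us (lshift b j); rewrite row_mxEl.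
have ys : vsmall r2 y.
  by apply/forallP => j; have := forallP us (rshift a j); rewrite row_mxEr.
have a_gt0 : (0 < a)%N by case: (a) a'_lt_2a.
have b_gt0 : (0 < b)%N.
  by rewrite lt0n; apply: contraNneq y0 => b0; apply/eqP/rowP => -[j jb]; exfalso; rewrite b0 in jb.
(* Frames of d + 1 = a' - a + 1 vectors are just large enough for [K_null]; they fit in both factors
   because a' < 2 a and a' < a + b. *)
have da : (d < a)%N by rewrite /d; move: a'_lt_2a a_gt0; clear; lia.
have db : (d < b)%N by rewrite /d; move: a'_lt_ab b_gt0; clear; lia.
have da' : (a' < (1 + d) + a)%N by rewrite /d; clear; lia.
have [A [AA xA]] := orthonormal_frame da x0.
have [B [BB yB]] := orthonormal_frame db y0.
set sx := sqrtC (dot x x) in xA; set sy := sqrtC (dot y y) in yB.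
have sx0 : sx != 0 by rewrite sqrtC_eq0; apply: contraNneq x0 => /dot_eq0 ->.
have sy0 : sy != 0 by rewrite sqrtC_eq0; apply: contraNneq y0 => /dot_eq0 ->.
have sxle : cabs sx <= D * r2 by apply: norm_le => //; rewrite leq_addr.
have cy0 : 0 < cabs sy by rewrite cabs_gt0.
pose rho := sx / sy; have rho0 : rho != 0 by rewrite mulf_neq0 ?invr_eq0.
have rhoy j : cabs rho * cabs (y 0 j) <= D * r2.
  apply: le_trans sxle; rewrite cabsM cabsV -mulrA ler_piMr ?cabs_ge0 //.
  by rewrite mulrC ler_pdivrMr // mul1r cabs_le_norm.
have line t : row_mx x (t *: y) = row_mx x 0 + t *: row_mx 0 y.
  by rewrite scale_row_mx add_row_mx scaler0 addr0 add0r.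
have small t s : (forall j, cabs t * cabs (y 0 j) < s) -> r2 <= s ->
    vsmall s (row_mx x (t *: y)).
  move=> h rs; apply/forallP => j; rewrite -[j]splitK; case: fintype.split => k /=.
    by rewrite row_mxEl; apply: lt_le_trans rs; exact: (forallP xs).
  by rewrite row_mxEr mxE cabsM; exact: h.
have Dr2' := Dr2; have r2_gt0' := r2_gt0; have r2_le' := r2_le.
have r0E : r0 = 10 * r1 by rewrite /r1; field.
have circle t : cabs t = cabs rho -> K (row_mx x (t *: y)) v = 0.
  move=> tr; pose w := t / rho.
  have w1 : cabs w = 1 by rewrite cabsM cabsV tr divff // cabs_eq0.
  have E : row_mx x (t *: y) = row_mx sx%:M 0 *m row_mx A (w *: B).
    rewrite mul_mx_row -xA -scalemxAr; congr row_mx.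
    rewrite yB; have -> : row_mx sy%:M 0 = (sy / sx) *: row_mx sx%:M 0 :> 'rV[C]_(1 + d).
      by rewrite scale_row_mx scaler0 scale_scalar_mx divfK.
    by rewrite -scalemxAl scalerA; congr (_ *: _); rewrite /w /rho; field; rewrite sx0 sy0.
  rewrite E; apply: K_null; [exact: AA | | exact: da' | |].
  - rewrite -scalemxAl adjZ -scalemxAr scalerA BB -sqr_cabs w1 expr1n.
    by rewrite scale1r.
  - rewrite -E; apply: small => [j|]; last exact: r2r1.
    by rewrite tr; apply: le_lt_trans (rhoy j) _; lra.
  - exact: vsmallW r2r1 vs.
have K1 : K (row_mx x y) v = K (row_mx x (1 *: y)) v by rewrite scale1r.
have crho := cabs_ge0 rho.
rewrite K1; apply: (@identity_theorem _ (fun t => K (row_mx x (t *: y)) v) rho (4 * (1 + cabs rho))).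
- by lra.
- move=> t tr.
  have -> : (fun t => K (row_mx x (t *: y)) v) = (fun t => K (row_mx x 0 + t *: row_mx 0 y) v).
    by apply/funext => s; rewrite line.
  apply: K_cder; rewrite -line; apply: small => [j|]; last by lra.
  have tt : cabs t <= 5 * cabs rho + 4.
    by have := cabsD (t - rho) rho; rewrite subrK; lra.
  apply: (@le_lt_trans _ _ ((5 * cabs rho + 4) * cabs (y 0 j))).
    by rewrite ler_wpM2r ?cabs_ge0.
  have := rhoy j; have := forallP ys j; rewrite mulrDl -mulrA; lra.
- move=> e e0; have [w [w1 w2 w3]] := @unit_dense (e / (cabs rho + 1)) (divr_gt0 e0 (ltr_wpDl crho ltr01)).
  have E : rho * w - rho = rho * (w - 1) by ring.
  have rp : 0 < cabs rho by rewrite cabs_gt0.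
  exists (rho * w); split.
  + by rewrite E cabs_gt0 mulf_neq0 // subr_eq0.
  + rewrite E cabsM; apply: (@le_lt_trans _ _ ((cabs rho + 1) * cabs (w - 1))).
      by rewrite ler_wpM2r ?cabs_ge0 // lerDl.
    by rewrite mulrC -ltr_pdivlMr // ltr_wpDl.
  + by apply: circle; rewrite cabsM w1 mulr1.
- have := cabsB 1 rho; rewrite cabs1; lra.
Qed.

(** The direction w makes both components of u + t w nonzero for t != 0, so the generic case gives
    zeros accumulating at t = 0. *)
Let K_zero u v : vsmall r2 u -> vsmall r2 v -> K u v = 0.
Proof.
move=> us vs.
have a_gt0 : (0 < a)%N by move: a'_lt_2a; clear; lia.
have b_gt0 : (0 < b)%N by move: a'_lt_ab aa'; clear; lia.
pose one q : 'rV[C]_q := const_mx 1.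
have one0 q : (0 < q)%N -> one q != 0.
  case: q => // q _; apply/eqP => /rowP/(_ 0); rewrite !mxE => /eqP.
  by rewrite oner_eq0.
pose pert q (x : 'rV[C]_q) := if x == 0 then one q else 0.
have pertP q (x : 'rV[C]_q) t : (0 < q)%N -> t != 0 -> x + t *: pert q x != 0.
  move=> q0 t0; rewrite /pert; have [->|x0] := eqVneq x 0.
    by rewrite add0r scaler_eq0 negb_or t0 one0.
  by rewrite scaler0 addr0.
have pert1 q (x : 'rV[C]_q) j : cabs (pert q x 0 j) <= 1.
  by rewrite /pert; case: ifP => _; rewrite !mxE ?cabs1 ?cabs0.
pose w : 'rV[C]_(a + b) := row_mx (pert a (lsubmx u)) (pert b (rsubmx u)).
have wle j : cabs (w 0 j) <= 1.
  by rewrite -[j]splitK; case: fintype.split => k /=; rewrite ?row_mxEl ?row_mxEr.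
have E : K u v = K (u + 0 *: w) v by rewrite scale0r addr0.
have Dr2' := Dr2; have r2_gt0' := r2_gt0; have r2_le' := r2_le; have r0p := r0_gt0.
have r0E : r0 = 10 * r1 by rewrite /r1; field.
rewrite E; apply: (@identity_theorem _ (fun t => K (u + t *: w) v) 0 (r0 / 2)).
- by lra.
- move=> t; rewrite subr0 => tr; apply: K_cder; apply/forallP => j.
  rewrite [(u + _) 0 j]mxE [(t *: w) 0 j]mxE; apply: (le_lt_trans (cabsD _ _)).
  rewrite cabsM; have := forallP us j.
  have : cabs t * cabs (w 0 j) <= r0 / 2 * 1.
    by apply: ler_pM; rewrite ?cabs_ge0 // ltW.
  by lra.
- move=> e e0.
  have := @vsmall_evt _ _ r2 u w id us (cder_ccont (@did R 0)) erefl.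
  move=> /evt_punctured/(_ e e0)[t [t1 t2 ts]]; exists t; split=> //.
  have t0 : t != 0 by rewrite -cabs_gt0 -[t]subr0.
  have tE : u + t *: w = row_mx (lsubmx u + t *: pert a (lsubmx u))
        (rsubmx u + t *: pert b (rsubmx u)).
    by rewrite -[u in LHS]hsubmxK /w scale_row_mx add_row_mx.
  rewrite tE; apply: K_generic; [exact: pertP | exact: pertP | | exact: vs].
  by rewrite -tE.
- by rewrite subr0 cabs0; lra.
Qed.

Lemma cone_kernel_zero u v : vsmall (r0 / (160 * (a + b).+1%:R)) u ->
    vsmall (r0 / (160 * (a + b).+1%:R)) v -> K u v = 0.
Proof.
have Dn : D != 0 by rewrite gt_eqF.
have -> : r0 / (160 * (a + b).+1%:R) = r2 by rewrite -/D /r2 /r1; field.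
exact: K_zero.
Qed.

End NullCone.

Lemma conformal_factor (R : realType) (a b a' b' : nat) (C := Cfield R)
    (phi : 'rV[C]_(a + b) -> 'rV[C]_(a' + b')) (T : 'M[C]_(a + b, a' + b'))
    (r0 : R) (c : C) : 0 < r0 -> 0 < c ->
  (forall u e t j, vsmall r0 (u + t *: e) -> cder (fun s => phi (u + s *: e) 0 j) t) ->
  (forall u v, vsmall r0 u -> vsmall r0 v -> hf u v = 0 -> hf (phi u) (phi v) = 0) ->
  (forall u j, cdiff (fun s => phi (s *: u) 0 j) 0 ((u *m T) 0 j)) ->
  T *m sgmx a' b' *m adj T = c *: sgmx a b ->
  (a' < a + a)%N -> (a' < a + b)%N ->
  exists al : 'rV[C]_(a + b) -> C,
  forall u v, vsmall (r0 / (160 * (a + b).+1%:R)) u ->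
    vsmall (r0 / (160 * (a + b).+1%:R)) v ->
    hf (phi u) (phi v) = c^-1 * al u * (al v)^* * hf u v.
Proof.
move=> r0_gt0 c_gt0 phi_cder phi_ortho phi_T TT h1 h2.
have [K [al [KE Kc Kn]]] := slice_kernel r0_gt0 c_gt0 phi_cder phi_ortho phi_T TT.
exists al => u v us vs.
have le : r0 / (160 * (a + b).+1%:R) <= r0.
  rewrite ler_pdivrMr; last by rewrite mulr_gt0 ?ltr0n.
  by rewrite ler_peMr ?(ltW r0_gt0) // -natrM ler1n.
rewrite (KE _ _ (vsmallW le us) (vsmallW le vs)).
by rewrite (cone_kernel_zero r0_gt0 Kc Kn (conformal_index c_gt0 TT) h1 h2 us vs) add0r.
Qed.

(** * Segre varieties and polarization *)

Section Geometry.
Variables (R : realType).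
Local Notation C := (Cfield R).
Local Notation Sp q := ('rV[C]_q * C)%type.

Definition psmall q (r : R) (p : Sp q) : bool := vsmall r p.1 && (cabs p.2 < r).

Lemma psmallW q (r s : R) (p : Sp q) : r <= s -> psmall r p -> psmall s p.
Proof.
by move=> rs /andP[h1 h2]; rewrite /psmall (vsmallW rs h1) (lt_le_trans h2 rs).
Qed.

(* Polarized defining function of the hyperquadric: (z, w) lies on it iff
   rr (z, w) (z, w) = 0, and rr Z W = 0 means that Z is in the Segre variety of W. *)
Definition rr a b (Z W : Sp (a + b)) : C := hf Z.1 W.1 - (Z.2 - W.2^*) / (2 * 'i).

Lemma i2_neq0 : 2 * 'i != 0 :> C.
Proof. by rewrite mulf_neq0 ?pnatr_eq0 // neq0Ci. Qed.

Lemma conj_2i : (2 * 'i : C)^* = - (2 * 'i).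
Proof. by rewrite rmorphM /= conjCi rmorph_nat mulrN. Qed.

Lemma ii : 'i * 'i = -1 :> C.
Proof. by rewrite -expr2 sqrCi. Qed.

Lemma rr_conj a b (Z W : Sp (a + b)) : (rr Z W)^* = rr W Z.
Proof.
rewrite /rr rmorphB /= hf_conj; congr (_ - _).
rewrite rmorphM fmorphV rmorphB /= conjCK conj_2i.
by rewrite invrN mulrN -mulNr opprB.
Qed.

(** The quadratic last coordinate lets such a curve follow the hyperquadric for real t, the form
    being quadratic in A + t B. Lines, slices of Segre varieties and the curves lying over another
    such curve all have this shape. *)
Definition qc q (A B : 'rV[C]_q) (w0 w1 w2 t : C) : Sp q :=
  (A + t *: B, w0 + t * w1 + t ^+ 2 * w2).

(** Holomorphy along these curves is what reduces the arguments to one variable. *)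
Definition hol1 q (r : R) (f : Sp q -> C) := forall A B w0 w1 w2 t,
  psmall r (qc A B w0 w1 w2 t) -> cder (fun s => f (qc A B w0 w1 w2 s)) t.

Definition holmap q p (r : R) (F : Sp q -> Sp p) :=
  (forall j, hol1 r (fun Z => (F Z).1 0 j)) /\ hol1 r (fun Z => (F Z).2).

Lemma holmap_id q r : @holmap q q r id.
Proof.
split=> [j|] A B w0 w1 w2 t _ /=.
  have -> : (fun s => (A + s *: B) 0 j) = (fun s => A 0 j + s * B 0 j).
    by apply/funext => s; rewrite !mxE.
  apply: dadd; first exact: dcst.
  by apply: (@dmul _ id (fun=> B 0 j)); [exact: did | exact: dcst].
apply: dadd; [apply: dadd; first exact: dcst|].
  by apply: (@dmul _ id (fun=> w1)); [exact: did | exact: dcst].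
by apply: (@dmul _ (fun t => t ^+ 2) (fun=> w2)); [apply: (@dexp _ id); exact: did | exact: dcst].
Qed.

Lemma dot_cder q (x y : C -> 'rV[C]_q) t :
  (forall j, cder (fun s => x s 0 j) t) -> (forall j, cder (fun s => y s 0 j) (t^*)) ->
  cder (fun s => dot (x s) (y (s^*))) t.
Proof.
move=> xt yt; apply: (@dsum _ _ _ (fun j s => x s 0 j * (y (s^*) 0 j)^*)) => j.
by apply: dmul (xt j) _; apply: (@cder_conj _ (fun s => y s 0 j)).
Qed.

Lemma hf_cder a b (x y : C -> 'rV[C]_(a + b)) t :
  (forall j, cder (fun s => x s 0 j) t) -> (forall j, cder (fun s => y s 0 j) (t^*)) ->
  cder (fun s => hf (x s) (y (s^*))) t.
Proof.
move=> xt yt; apply: dsub.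
  apply: (@dot_cder _ (fun s => rsubmx (x s)) (fun s => rsubmx (y s))) => j.
    have -> : (fun s => rsubmx (x s) 0 j) = (fun s => x s 0 (rshift a j)).
      by apply/funext => s; rewrite mxE.
    exact: xt.
  have -> : (fun s => rsubmx (y s) 0 j) = (fun s => y s 0 (rshift a j)).
    by apply/funext => s; rewrite mxE.
  exact: yt.
apply: (@dot_cder _ (fun s => lsubmx (x s)) (fun s => lsubmx (y s))) => j.
  have -> : (fun s => lsubmx (x s) 0 j) = (fun s => x s 0 (lshift b j)).
    by apply/funext => s; rewrite mxE.
  exact: xt.
have -> : (fun s => lsubmx (y s) 0 j) = (fun s => y s 0 (lshift b j)).
  by apply/funext => s; rewrite mxE.
exact: yt.
Qed.

(** The conjugate parameter compensates for the antiholomorphy of [rr] in its second argument. *)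
Lemma rr_cder a b q (F : Sp q -> Sp (a + b)) r A B w0 w1 w2 A' B' w0' w1' w2' t :
  holmap r F -> psmall r (qc A B w0 w1 w2 t) -> psmall r (qc A' B' w0' w1' w2' (t^*)) ->
  cder (fun s => rr (F (qc A B w0 w1 w2 s)) (F (qc A' B' w0' w1' w2' (s^*)))) t.
Proof.
move=> [F1 F2] h1 h2; apply: dsub.
  apply: (@hf_cder _ _ (fun s => (F (qc A B w0 w1 w2 s)).1)
    (fun s => (F (qc A' B' w0' w1' w2' s)).1)) => j.
    exact: F1.
  exact: F1.
apply: (@dmul _ _ (fun=> (2 * 'i)^-1)); last exact: dcst.
apply: dsub; first exact: F2.
by apply: (@cder_conj _ (fun s => (F (qc A' B' w0' w1' w2' s)).2)); exact: F2.
Qed.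

Lemma cabs_dot q (x y : 'rV[C]_q) (r s : R) : 0 <= r -> 0 <= s ->
  (forall j, cabs (x 0 j) <= r) -> (forall j, cabs (y 0 j) <= s) ->
  cabs (dot x y) <= q%:R * (r * s).
Proof.
move=> r0 s0 xr ys; rewrite /dot.
have H (I : Type) (l : seq I) (f : I -> C) (B : R) : (forall i, cabs (f i) <= B) ->
    cabs (\sum_(i <- l) f i) <= (size l)%:R * B.
  move=> fB; elim: l => [|i l IH]; first by rewrite big_nil cabs0 mul0r.
  rewrite big_cons (le_trans (cabsD _ _)) //= -natr1 mulrDl mul1r addrC.
  exact: lerD.
apply: le_trans (H _ _ _ (r * s) _) _.
  by move=> j; rewrite cabsM cabs_conj; apply: ler_pM; rewrite ?cabs_ge0.
by rewrite -[index_enum _]enumT size_enum_ord.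
Qed.

Lemma cabs_hf a b (x y : 'rV[C]_(a + b)) (r s : R) : 0 <= r -> 0 <= s ->
  (forall j, cabs (x 0 j) <= r) -> (forall j, cabs (y 0 j) <= s) ->
  cabs (hf x y) <= (a + b)%:R * (r * s).
Proof.
move=> r0 s0 xr ys; rewrite /hf (le_trans (cabsB _ _)) // addnC natrD mulrDl.
by apply: lerD; apply: cabs_dot => // j; rewrite mxE.
Qed.

(** For |t| < 4 the curve of [polarization] has coordinates up to 5 times the initial size, and its
    last coordinate contains a form with q terms; the factor 100 (q + 1) keeps it within r. *)
Definition polr q (r : R) : R := r / (100 * q.+1%:R).

Lemma polr_gt0 q r : 0 < r -> 0 < polr q r.
Proof. by move=> r0; rewrite /polr divr_gt0 // mulr_gt0 ?ltr0n. Qed.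

Lemma polr_mul q r : 100 * (q%:R * polr q r + polr q r) = r.
Proof.
have n0 : (q.+1%:R : R) != 0 by rewrite pnatr_eq0.
have -> : q%:R * polr q r + polr q r = q.+1%:R * polr q r by rewrite -natr1 mulrDl mul1r.
by rewrite /polr; field.
Qed.

Lemma polr_le q r : 0 < r -> polr q r <= r.
Proof.
move=> r0; have := polr_mul q r; have := polr_gt0 q r0.
have : 0 <= q%:R * polr q r by rewrite mulr_ge0 ?ler0n // ltW // polr_gt0.
lra.
Qed.

(* A pair Z, W with rr Z W = 0 is joined by a complex curve t |-> Z(t) of degree
   two with Z('i) = Z and Z(-'i) = W, whose points with real t are on M. *)
Lemma polarization a b (Phi : Sp (a + b) -> Sp (a + b) -> C) (r : R) : 0 < r -> r <= 1 ->
  (forall A B w0 w1 w2 t, let c := qc A B w0 w1 w2 in psmall r (c t) -> psmall r (c (t^*)) ->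
     cder (fun s => Phi (c s) (c (s^*))) t) ->
  (forall X, psmall r X -> rr X X = 0 -> Phi X X = 0) ->
  forall Z W, psmall (polr (a + b) r) Z -> psmall (polr (a + b) r) W ->
  rr Z W = 0 -> Phi Z W = 0.
Proof.
move=> r0 r1 Phic PhiM Z W; set q := polr _ _ => /andP[zs ws] /andP[xs ts] ZW.
have q0 : 0 < q by exact: polr_gt0.
have qr := polr_mul (a + b) r; rewrite -/q in qr.
have qle : q <= r by exact: polr_le.
clearbody q.
pose A := 2^-1 *: (Z.1 + W.1); pose B := (2 * 'i)^-1 *: (Z.1 - W.1).
pose s := (Z.2 + W.2^*) / 2.
pose sa : C := toC (complex.Re s); pose sb : C := toC (complex.Im s).
have sE : s = sa + 'i * sb by rewrite [LHS]ptE.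
have sc : s^* = sa - 'i * sb.
  by rewrite sE rmorphD rmorphM /= conjCi !conj_toC mulNr.
(* With these coefficients the last coordinate at real t is the real number sa + t sb plus 'i times
   [hf] of A + t B with itself, which is the equation of the hyperquadric. *)
pose w0 := sa + 'i * hf A A; pose w1 := sb + 'i * (hf A B + hf B A); pose w2 := 'i * hf B B.
pose c := qc A B w0 w1 w2.
have c1 t : (c t).1 = A + t *: B by [].
have c2 t : (c t).2 = sa + t * sb + 'i * hf (A + t *: B) (A + t^* *: B).
  rewrite hf_quadratic -[(c t).2]/(w0 + t * w1 + t ^+ 2 * w2) /w0 /w1 /w2.
  by move: (hf A A) (hf A B) (hf B A) (hf B B) => h1 h2 h3 h4; ring.
have i2 : 'i != 0 :> C by exact: neq0Ci.
have cNii : (- 'i : C)^* = 'i by rewrite rmorphN /= conjCi opprK.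
have AiB : A + 'i *: B = Z.1.
  by apply/rowP => j; rewrite !mxE; field.
have ANiB : A - 'i *: B = W.1.
  by apply/rowP => j; rewrite !mxE; field.
have wt : (Z.2 - W.2^*) / 2 = 'i * hf Z.1 W.1.
  by have /eqP := ZW; rewrite /rr subr_eq0 => /eqP ->; field.
have ci : c 'i = Z.
  rewrite [RHS]surjective_pairing; apply: injective_projections; first by rewrite c1 AiB.
  by rewrite c2 conjCi AiB scaleNr ANiB -wt -sE /s /=; field.
have cNi : c (- 'i) = W.
  rewrite [RHS]surjective_pairing; apply: injective_projections.
    by rewrite c1 scaleNr ANiB.
  rewrite c2 cNii AiB scaleNr ANiB mulNr -sc /=.
  have -> : 'i * hf W.1 Z.1 = ((W.2 - Z.2^*) / 2).
    have h : (('i * hf Z.1 W.1)^*)  = - ('i * hf W.1 Z.1).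
      by rewrite rmorphM /= conjCi hf_conj mulNr.
    have h2 : (((Z.2 - W.2^*) / 2)^*) = (Z.2^* - W.2) / 2.
      by rewrite rmorphM rmorphB /= conjCK fmorphV rmorph_nat.
    by rewrite -[LHS]opprK -h -wt h2; field.
  by rewrite /s rmorphM rmorphD /= conjCK fmorphV rmorph_nat; field.
have reM t : t^* = t -> rr (c t) (c t) = 0.
  move=> tt; rewrite /rr !c2 c1 tt.
  set h := hf _ _; have hh : h^* = h by rewrite /h hf_conj.
  rewrite !rmorphD !rmorphM /= !conj_toC hh conjCi tt; field; exact: i2.
have Aj j : cabs (A 0 j) <= q.
  rewrite /A !mxE cabsM cabsV cabs_nat; have := cabsD (Z.1 0 j) (W.1 0 j).
  have := forallP zs j; have := forallP xs j; lra.
have Bj j : cabs (B 0 j) <= q.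
  rewrite /B !mxE cabsM cabsV cabsM cabsi cabs_nat mulr1.
  have := cabsB (Z.1 0 j) (W.1 0 j).
  have := forallP zs j; have := forallP xs j; lra.
have sq : cabs s <= q.
  rewrite /s cabsM cabsV cabs_nat; have := cabsD Z.2 (W.2^*).
  rewrite cabs_conj; lra.
have saq : cabs sa <= q.
  by rewrite cabs_toC; apply: le_trans sq; exact: Re_le_cabs.
have sbq : cabs sb <= q.
  by rewrite cabs_toC; apply: le_trans sq; exact: Im_le_cabs.
clearbody A B s sa sb.
have nq : 0 <= (a + b)%:R * q by rewrite mulr_ge0 ?ler0n // ltW.
have small t : cabs t < 4 -> psmall r (c t).
  move=> t4.
  have line t' : cabs t' < 4 -> forall j, cabs ((A + t' *: B) 0 j) <= 5 * q.
    move=> t4' j; rewrite [(A + _) 0 j]mxE [(t' *: B) 0 j]mxE (le_trans (cabsD _ _)) // cabsM.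
    have : cabs t' * cabs (B 0 j) <= 4 * q by apply: ler_pM; rewrite ?cabs_ge0 // ltW.
    by have := Aj j; lra.
  apply/andP; split.
    rewrite c1; apply/forallP => j; have := line t t4 j; lra.
  rewrite c2; apply: (le_lt_trans (cabsD _ _)).
  have h1 : cabs (sa + t * sb) <= 5 * q.
    rewrite (le_trans (cabsD _ _)) // cabsM.
    have : cabs t * cabs sb <= 4 * q by apply: ler_pM; rewrite ?cabs_ge0 // ltW.
    lra.
  have h2 : cabs (hf (A + t *: B) (A + t^* *: B)) <= (a + b)%:R * ((5 * q) * (5 * q)).
    apply: cabs_hf; try exact: line; try lra.
    by apply: line; rewrite cabs_conj.
  have h3 : (a + b)%:R * ((5 * q) * (5 * q)) <= 25 * ((a + b)%:R * q).
    have -> : (a + b)%:R * ((5 * q) * (5 * q)) = 25 * ((a + b)%:R * q) * q by ring.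
    rewrite ler_piMr //; lra.
  rewrite cabsM cabsi mul1r; lra.
have E : Phi Z W = Phi (c 'i) (c ('i^*)) by rewrite conjCi ci cNi.
rewrite E; apply: (@identity_theorem _ (fun t => Phi (c t) (c (t^*))) 0 4).
- by lra.
- move=> t; rewrite subr0 => t4; apply: Phic; first exact: small.
  by apply: small; rewrite cabs_conj.
- move=> e e0; pose m := Num.min e 1.
  have m0 : 0 < m by rewrite lt_min e0 ltr01.
  have me : m <= e by rewrite ge_min lexx.
  have m1 : m <= 1 by rewrite ge_min lexx orbT.
  have ct : cabs (toC (m / 2) : C) = m / 2 by rewrite cabs_toC gtr0_norm; lra.
  exists (toC (m / 2)); rewrite subr0 ct conj_toC; split; [lra|lra|].
  apply: PhiM; first by apply: small; rewrite ct; lra.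
  by apply: reM; rewrite conj_toC.
- by rewrite subr0 cabsi; lra.
Qed.

End Geometry.

(** * Derivatives along lines and their continuity *)

Section Derivatives.
Variable R : realType.
Local Notation C := (Cfield R).
Local Notation Sp q := ('rV[C]_q * C)%type.

Lemma cdiff_zmul (u : C -> C) t : ccont u t -> cdiff (fun z => (z - t) * u z) t (u t).
Proof.
move=> ut e e0; have [d d0 dP] := ut e e0; exists d => // h /dP hh.
have -> : (t + h - t) * u (t + h) - (t - t) * u t - u t * h =
  (u (t + h) - u t) * h by ring.
by rewrite cabsM ler_wpM2r ?cabs_ge0 // ltW.
Qed.

Lemma cdiff_ext (f g : C -> C) z d : cdiff f z d -> evt (fun h => f (z + h) = g (z + h)) ->
  cdiff g z d.
Proof.
move=> fz [r r0 rP]; have e0 : f z = g z.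
  by have := rP 0; rewrite addr0; apply; rewrite cabs0.
move=> e /fz[dl dl0 dlP]; exists (Num.min r dl); first by rewrite lt_min r0.
by move=> h; rewrite lt_min => /andP[h1 h2]; rewrite -rP // -e0; exact: dlP.
Qed.

Lemma cdiff_mul0 (f g : C -> C) d : ccont f 0 -> cdiff g 0 d -> g 0 = 0 ->
  cdiff (fun t => f t * g t) 0 (f 0 * d).
Proof.
move=> fc gd g0; have gc : cder g 0 by exists d.
have dq : dquot g 0 0 = d by rewrite /dquot eqxx; exact: cdiff_unique.
rewrite -dq; have H := cdiff_zmul (ccont_mul fc (dquot_ccont_at gc)).
apply: (cdiff_ext H); apply: evt_true => h.
by rewrite mulrCA dquotE g0 subr0.
Qed.

Lemma cdiff_conj (f : C -> C) d : cdiff f 0 d -> cdiff (fun t => (f (t^*))^*) 0 (d^*).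
Proof.
move=> fz e /fz[dl dl0 dlP]; exists dl => // h; rewrite -cabs_conj => /dlP.
rewrite cabs_conj; apply: le_trans; rewrite -cabs_conj le_eqVlt; apply/orP; left.
by apply/eqP; congr cabs; rewrite !rmorphB rmorphM !rmorphD /= !conjCK conjC0.
Qed.

Lemma hf_cdiff0 a b (x y : C -> 'rV[C]_(a + b)) (d : 'rV[C]_(a + b)) :
  (forall j, ccont (fun t => x t 0 j) 0) -> (forall j, cdiff (fun t => y t 0 j) 0 (d 0 j)) ->
  y 0 = 0 -> cdiff (fun t => hf (x t) (y (t^*))) 0 (hf (x 0) d).
Proof.
move=> xc yd y0.
pose sg (j : 'I_(a + b)) : C := (sgmx a b) j j.
have hfsum (u v : 'rV[C]_(a + b)) : hf u v = \sum_j (u *m sgmx a b) 0 j * (v 0 j)^*.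
  by rewrite hfE -dotE.
have -> : (fun t => hf (x t) (y (t^*))) =
   (fun t => \sum_j (x t *m sgmx a b) 0 j * (y (t^*) 0 j)^*).
  by apply/funext => t; rewrite hfsum.
rewrite hfsum; apply: cdiff_sum => j.
apply: (@cdiff_mul0 (fun t => (x t *m sgmx a b) 0 j) (fun t => (y (t^*) 0 j)^*)).
- have -> : (fun t => (x t *m sgmx a b) 0 j) =
     (fun t => \sum_k x t 0 k * sgmx a b k j).
    by apply/funext => t; rewrite mxE.
  apply: ccont_sum => k; apply: ccont_mul; [exact: xc | exact: ccont_cst].
- exact: cdiff_conj (yd j).
- by rewrite conjC0 y0 mxE conjC0.
Qed.

Definition pline q (p d : Sp q) (t : C) : Sp q := (p.1 + t *: d.1, p.2 + t * d.2).

Lemma plineE q (p d : Sp q) t : pline p d t = qc p.1 d.1 p.2 d.2 0 t.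
Proof. by rewrite /pline /qc mulr0 addr0. Qed.

Lemma hol1_pline q r (f : Sp q -> C) p d t : hol1 r f -> psmall r (pline p d t) ->
  cder (fun s => f (pline p d s)) t.
Proof.
move=> fh; have -> : (fun s => f (pline p d s)) = (fun s => f (qc p.1 d.1 p.2 d.2 0 s)).
  by apply/funext => s; rewrite plineE.
by rewrite plineE; exact: fh.
Qed.

Definition ple q (r : R) (p : Sp q) := (forall j, cabs (p.1 0 j) <= r) /\ cabs p.2 <= r.

Lemma pline_small q r s (p d : Sp q) t : psmall r p -> ple s d ->
  psmall (r + cabs t * s) (pline p d t).
Proof.
move=> /andP[p1 p2] [d1 d2]; apply/andP; split=> /=.
  apply/forallP => j; rewrite !mxE (le_lt_trans (cabsD _ _)) // cabsM.
  by apply: ltr_leD; [exact: (forallP p1) | rewrite ler_wpM2l ?cabs_ge0].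
rewrite (le_lt_trans (cabsD _ _)) // cabsM.
by apply: ltr_leD => //; rewrite ler_wpM2l ?cabs_ge0.
Qed.

Section Bounded.
Variables (q : nat) (f : Sp q -> C) (r M : R).
Hypothesis r0 : 0 < r.
Hypothesis r1 : r <= 1.
Hypothesis M0 : 0 < M.
Hypothesis fh : hol1 r f.
Hypothesis fM : forall p, psmall r p -> cabs (f p) <= M.

(** Schwarz's lemma on the line from p to p', in a disc of radius r / 2: 6 M / (r / 2) = 12 M /
    r. *)
Lemma lipschitz (p p' : Sp q) (dl : R) : psmall (r / 2) p -> 0 < dl -> dl < r / 6 ->
  ple dl (p'.1 - p.1, p'.2 - p.2) -> cabs (f p' - f p) <= 12 * M / r * dl.
Proof.
move=> ps dl0 dlr [d1 d2]; have rr := r0.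
pose e : Sp q := ((toC dl)^-1 *: (p'.1 - p.1), (toC dl)^-1 * (p'.2 - p.2)).
have dn0 : toC dl != 0 :> C by rewrite -cabs_gt0 cabs_toC gtr0_norm.
have cdl : cabs (toC dl : C) = dl by rewrite cabs_toC gtr0_norm.
have e1 : ple 1 e.
  split=> [j|] /=.
    rewrite mxE cabsM cabsV cdl mulrC ler_pdivrMr // mul1r; exact: d1.
  by rewrite cabsM cabsV cdl mulrC ler_pdivrMr // mul1r.
have pe : p' = pline p e (toC dl).
  rewrite /pline /e /= scalerA mulrA mulfV // scale1r mul1r.
  by rewrite [p.1 + _]addrC subrK [p.2 + _]addrC subrK -surjective_pairing.
have p0 : p = pline p e 0 by rewrite /pline scale0r mul0r !addr0 -surjective_pairing.
have sm t : cabs t < r / 2 -> psmall r (pline p e t).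
  by move=> tr; apply: psmallW (pline_small t ps e1); lra.
have := @schwarz _ (fun t => f (pline p e t)) (r / 2) M.
move=> /(_ _ M0 _ _ (toC dl)); rewrite -pe -p0 cdl.
have -> : 6 * M / (r / 2) = 12 * M / r by field; rewrite gt_eqF.
apply; [lra| | |lra].
  by move=> t tr; apply: (hol1_pline fh); exact: sm.
by move=> t tr; apply: fM; exact: sm.
Qed.

(** Cauchy's estimate for the difference of the two restrictions, at most (12 M / r) (2 dl) on the
    disc of radius r / 4 by [lipschitz]; whence 576 = 6 * 12 * 2 * 4. *)
Lemma derivative_continuous (X d d0 : Sp q) (dl : R) D D0 :
  0 < dl -> dl < r / 12 -> psmall dl X -> ple 1 d -> ple 1 d0 ->
  ple (2 * dl) (d.1 - d0.1, d.2 - d0.2) ->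
  cdiff (fun t => f (pline X d t)) 0 D -> cdiff (fun t => f (pline 0 d0 t)) 0 D0 ->
  cabs (D - D0) <= 576 * M / r ^+ 2 * dl.
Proof.
move=> dl0 dlr Xs d1 d01 [dd1 dd2] fD fD0; have rr := r0; have r1' := r1.
pose h t := f (pline X d t) + f (pline 0 d0 t) * (-1).
have hD : cdiff h 0 (D - D0).
  by rewrite -[- D0]mulrN1; apply: cdiffD fD _; apply: cdiffZ fD0.
have z0 : psmall (r / 4) (0 : Sp q).
  by apply/andP; split; [apply: vsmall0; lra | rewrite cabs0; lra].
have sm t : cabs t < r / 4 -> psmall (r / 2) (pline X d t) /\ psmall (r / 2) (pline 0 d0 t).
  move=> tr; split; [apply: psmallW (pline_small t Xs d1); lra|].
  by apply: psmallW (pline_small t z0 d01); lra.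
have hb t : cabs t < r / 4 -> cabs (h t) <= 12 * M / r * (2 * dl).
  move=> tr; have [s1 s2] := sm t tr; rewrite /h mulrN1.
  apply: lipschitz => //; [lra|lra|].
  have q1 (x e e0 : C) : cabs x <= dl -> cabs (e - e0) <= 2 * dl -> 
      cabs (x + t * e - (0 + t * e0)) <= 2 * dl.
    move=> hx he; have -> : x + t * e - (0 + t * e0) = x + t * (e - e0) by ring.
    rewrite (le_trans (cabsD _ _)) // cabsM.
    have : cabs t * cabs (e - e0) <= r / 4 * (2 * dl).
      by apply: ler_pM; rewrite ?cabs_ge0 //; exact: ltW.
    have : r / 4 * (2 * dl) <= dl.
      have -> : r / 4 * (2 * dl) = r / 2 * dl by field.
      by apply: ler_piMl; lra.
    lra.
  move/andP: Xs => [X1 X2]; split=> [j|] /=.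
    rewrite !mxE; apply: q1; first by apply: ltW; exact: (forallP X1).
    by have := dd1 j; rewrite !mxE.
  by apply: q1 => //; exact: ltW.
have B0 : 0 < 12 * M / r * (2 * dl).
  by apply: mulr_gt0; [apply: divr_gt0 => //; apply: mulr_gt0 | apply: mulr_gt0].
have r40 : 0 < r / 4 by lra.
have := @cauchy_estimate _ h (r / 4) _ r40 B0.
rewrite (cdiff_unique hD).
have -> : 6 * (12 * M / r * (2 * dl)) / (r / 4) = 576 * M / r ^+ 2 * dl.
  by field; rewrite gt_eqF.
apply=> // t tr; have [s1 s2] := sm t tr.
have r2r : r / 2 <= r by lra.
apply: dadd; first by apply: (hol1_pline fh); exact: psmallW r2r s1.
apply: (@dmul _ (fun t => f (pline 0 d0 t)) (fun=> -1)); last exact: dcst.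
by apply: (hol1_pline fh); exact: psmallW r2r s2.
Qed.

End Bounded.
End Derivatives.

(** * Holomorphic maps between hyperquadrics *)

Section Maps.
Variables (R : realType) (a b a' b' : nat).
Local Notation C := (Cfield R).
Local Notation Sp q := ('rV[C]_q * C)%type.

Lemma mul_half_lt (c e dl : R) : 0 < c -> 0 < e -> dl <= e / (2 * c) -> c * dl < e.
Proof.
move=> c0 e0 h; apply: (le_lt_trans (y := c * (e / (2 * c)))).
  by rewrite ler_pM2l.
have -> : c * (e / (2 * c)) = e / 2 by field; rewrite gt_eqF.
lra.
Qed.

Lemma der_bound_gt0 (x y : R) : 0 < x -> 0 < y -> 0 < 576 * y / x ^+ 2.
Proof. by move=> x0 y0; apply: divr_gt0; [rewrite mulr_gt0 ?ltr0n | exact: exprn_gt0]. Qed.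

Lemma cdiff_scale (f : C -> C) d k : cdiff f 0 d -> cdiff (fun t => f (t * k)) 0 (d * k).
Proof.
move=> fd e e0; have k0 : 0 < cabs k + 1 by have := cabs_ge0 k; lra.
have [dl dl0 dlP] := fd _ (divr_gt0 e0 k0).
exists (dl / (cabs k + 1)); first exact: divr_gt0.
move=> h; rewrite ltr_pdivlMr // => hh.
have hk : cabs (h * k) <= cabs h * (cabs k + 1).
  by rewrite cabsM ler_wpM2l ?cabs_ge0 //; lra.
have := dlP (h * k) (le_lt_trans hk hh).
rewrite !add0r mul0r => H.
have -> : d * k * h = d * (h * k) by ring.
apply: (le_trans H); rewrite -mulrA ler_wpM2l //; first exact: ltW.
by rewrite mulrC ler_pdivrMr.
Qed.

(* The shift u |-> sh X u parametrizes the Segre variety of a point X of the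
   hyperquadric, with sh X 0 = X. *)
Definition sh q1 q2 (X : Sp (q1 + q2)) (u : 'rV[C]_(q1 + q2)) : Sp (q1 + q2) :=
  (X.1 + u, X.2 + 2 * 'i * hf u X.1).

(** Turns preservation of [rr = 0] on the Segre variety of a point X of the hyperquadric into
    preservation of orthogonality for [hf]. *)
Lemma rr_sh (X : Sp (a + b)) u v : rr (sh X u) (sh X v) = rr X X + hf u v.
Proof.
have E : (X.2 + 2 * 'i * hf v X.1)^* = X.2^* - 2 * 'i * hf X.1 v.
  by rewrite rmorphD [X in _ + X]rmorphM /= conj_2i hf_conj mulNr.
rewrite /rr /sh /= E !hfDl !hfDr.
by move: (hf X.1 X.1) (hf X.1 v) (hf u X.1) (hf u v) => h1 h2 h3 h4;
  field; exact: neq0Ci.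
Qed.

Lemma sh0 (X : Sp (a + b)) : sh X 0 = X.
Proof. by rewrite /sh addr0 hf0l mulr0 addr0 -surjective_pairing. Qed.

Lemma sh_qc (X : Sp (a + b)) u e s :
  sh X (u + s *: e) = qc (X.1 + u) e (X.2 + 2 * 'i * hf u X.1) (2 * 'i * hf e X.1) 0 s.
Proof.
rewrite /sh /qc addrA hfDl hfZ mulr0 addr0; congr (_, _).
by move: (hf u X.1) (hf e X.1) => h1 h2; ring.
Qed.

Lemma hf_diff (P Q Y : Sp (a' + b')) :
  hf (P.1 - Y.1) (Q.1 - Y.1) = rr P Q - rr P Y - rr Y Q + rr Y Y.
Proof.
rewrite /rr hfDl !hfDr !hfNl !hfNr.
move: (hf P.1 Q.1) (hf P.1 Y.1) (hf Y.1 Q.1) (hf Y.1 Y.1) => h1 h2 h3 h4.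
by field; exact: neq0Ci.
Qed.

Lemma conformal_derivative (phi : 'rV[C]_(a + b) -> 'rV[C]_(a' + b'))
    (T : 'M[C]_(a + b, a' + b')) (r0 : R) : 0 < r0 ->
  (forall u v, vsmall r0 u -> vsmall r0 v -> hf u v = 0 -> hf (phi u) (phi v) = 0) ->
  (forall u j, cdiff (fun s => phi (s *: u) 0 j) 0 ((u *m T) 0 j)) ->
  exists c, T *m sgmx a' b' *m adj T = c *: sgmx a b.
Proof.
move=> r00 phio phiT; apply: conformal_of_orthogonal => u v uv.
have H x y w : hf x w = 0 -> (forall t, vsmall r0 (t *: x) -> hf (phi (t *: x)) y = 0) ->
    hf (x *m T) y = 0.
  move=> xw xy; apply: (@cdiff_evt_cst _ (fun s => hf (phi (s *: x)) y) 0 _ 0).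
    have -> : (fun s => hf (phi (s *: x)) y) =
        (fun s => (phi (s *: x) *m (sgmx a' b' *m adj y)) 0 0).
      by apply/funext => s; rewrite hf_colE.
    rewrite hf_colE; apply: cdiff_mulmx => j; exact: phiT.
  have := @vsmall_evt _ _ r0 0 x id (@vsmall0 _ _ _ r00) (cder_ccont (@did R 0)) erefl.
  by apply: evtW => t; rewrite !add0r => ht; exact: xy.
have vu : hf v u = 0 by rewrite -hf_conj uv conjC0.
apply: (H u (v *m T) v uv) => t ts; rewrite -hf_conj; apply/eqP; rewrite conjC_eq0; apply/eqP.
apply: (H v (phi (t *: u)) u vu) => s ss; apply: phio; [exact: ss | exact: ts |].
by rewrite hfZ hfZr vu !mulr0.
Qed.

(** [qm_diff] is kept beside [qm_hol] because linearity of the derivative in the direction cannot be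
    read off from single curves. *)
Record quadric_map (F : Sp (a + b) -> Sp (a' + b')) (r M : R) : Prop := QuadricMap {
  qm_r0 : 0 < r;
  qm_r1 : r <= 1;
  qm_M0 : 0 < M;
  qm_hol : holmap r F;
  qm_F0 : F 0 = 0;
  qm_bound : forall p, psmall r p -> ple M (F p);
  qm_quadric : forall X, psmall r X -> rr X X = 0 -> rr (F X) (F X) = 0;
  qm_diff : forall X, psmall r X ->
    exists (T1 : 'M[C]_(a + b, a' + b')) (T2 : 'rV[C]_(a' + b')), forall d j,
      cdiff (fun t => (F (pline X d t)).1 0 j) 0 ((d.1 *m T1 + d.2 *: T2) 0 j)
}.

Variables (F : Sp (a + b) -> Sp (a' + b')) (r M : R).
Hypothesis HF : quadric_map F r M.

Let r0 : 0 < r. Proof. exact: qm_r0 HF. Qed.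
Let r1 : r <= 1. Proof. exact: qm_r1 HF. Qed.
Let M0 : 0 < M. Proof. exact: qm_M0 HF. Qed.
Let Fh : holmap r F. Proof. exact: qm_hol HF. Qed.
Let F0 : F 0 = 0. Proof. exact: qm_F0 HF. Qed.
Let Fb p : psmall r p -> ple M (F p). Proof. by move=> h; exact: (qm_bound HF h). Qed.
Let FM X : psmall r X -> rr X X = 0 -> rr (F X) (F X) = 0. Proof. by move=> h1 h2; exact: (qm_quadric HF h1 h2). Qed.

Lemma segre Z W : psmall (polr (a + b) r) Z -> psmall (polr (a + b) r) W ->
  rr Z W = 0 -> rr (F Z) (F W) = 0.
Proof.
apply: (@polarization _ _ _ (fun Z W => rr (F Z) (F W))) => //.
move=> A B w0 w1 w2 t /=; exact: rr_cder.
Qed.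

Lemma psmall0 q (s : R) : 0 < s -> psmall s (0 : Sp q).
Proof. by move=> s0; apply/andP; split; [exact: vsmall0 | rewrite cabs0]. Qed.

Lemma vsmall_line q (v : 'rV[C]_q) (s : R) : 0 < s -> evt (fun t => vsmall s (t *: v)).
Proof.
move=> s0; have := @vsmall_evt _ _ s 0 v id (@vsmall0 _ _ _ s0) (cder_ccont (@did R 0)) erefl.
by apply: evtW => t; rewrite !add0r.
Qed.

Lemma psmall_line q (d : Sp q) (s : R) : 0 < s -> evt (fun t => psmall s (pline 0 d t)).
Proof.
move=> s0; have h2 : evt (fun t => cabs (t * d.2) < s).
  have : ccont (fun t => t * d.2) 0.
    by apply: cder_ccont; apply: (@dmul _ id (fun=> d.2)); [exact: did | exact: dcst].
  move=> /(@evt_ccont _ _ _ s) /(_ s0).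
  by apply: evtW => t; rewrite add0r mul0r subr0.
apply: evtW (evt_and (vsmall_line d.1 s0) h2) => t [h3 h4].
by apply/andP; rewrite /pline !add0r.
Qed.

(** The Segre variety of 0 gives g (x, 0) = 0. The points (s v, k t) and (t^* u, 0) satisfy [rr = 0]
    for k = 2 i s [hf v u]; the relation between their images is differentiated at t = 0 and then at
    s = 0. Continuity of [gw], the derivative of g in the direction w at (s v, 0), takes the place
    of a second derivative. *)
Lemma levi_form T1 T2 gm :
  (forall d j, cdiff (fun t => (F (pline 0 d t)).1 0 j) 0 ((d.1 *m T1 + d.2 *: T2) 0 j)) ->
  cdiff (fun t => (F (pline 0 (0, 1) t)).2) 0 gm ->
  T1 *m sgmx a' b' *m adj T1 = gm *: sgmx a b.
Proof.
move=> FT Fgm; have q0 : 0 < polr (a + b) r by exact: polr_gt0.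
have qr : polr (a + b) r <= r by exact: polr_le.
have seg := segre; set q := polr _ _ in q0 qr seg; clearbody q.
suff H u v : hf (v *m T1) (u *m T1) = gm * hf v u.
  apply/matrixP => i j; rewrite hf_mx [RHS]mxE !rowE H; congr (_ * _).
  have := hf_mx (1%:M : 'M[C]_(a + b)) 1%:M i j.
  by rewrite adj1 mulmx1 mul1mx !rowE !mulmx1.
have g0 x : vsmall q x -> (F (x, 0)).2 = 0.
  move=> xs; have xs' : psmall q (x, 0 : C) by apply/andP; split=> //=; rewrite cabs0.
  have := seg _ _ xs' (psmall0 _ q0); rewrite F0 /rr /= !hf0r conjC0 !subr0 mul0r oppr0.
  rewrite sub0r addr0 => /(_ erefl)/eqP.
  by rewrite oppr_eq0 mulf_eq0 invr_eq0 (negPf (i2_neq0 R)) orbF => /eqP.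
pose gw s := 'D_1 (fun t => (F (pline (s *: v, 0) (0, 1) t)).2) 0.
have gwP s : vsmall q (s *: v) ->
    cdiff (fun t => (F (pline (s *: v, 0) (0, 1) t)).2) 0 (gw s).
  move=> hs; apply: cderP; apply: (@hol1_pline _ _ r (fun X => (F X).2)).
    by case: Fh.
  rewrite /pline scale0r mul0r !addr0; apply: (psmallW qr).
  by apply/andP; split=> //=; rewrite cabs0.
have slice s : vsmall q (s *: v) -> hf (F (s *: v, 0)).1 (u *m T1) = s * (gw s * hf v u).
  move=> sv; pose k := 2 * 'i * s * hf v u.
  pose x t := (F (s *: v, k * t)).1; pose y t := (F (t *: u, 0)).1.
  have curve t : (s *: v, k * t) = pline (s *: v, 0) (0, 1) (t * k).
    by rewrite /pline /= scaler0 addr0 mulr1 add0r mulrC.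
  have := gwP s sv; move/(@cdiff_scale _ _ k) => /(@cdiffZ _ _ _ _ (2 * 'i)^-1).
  have -> : gw s * k / (2 * 'i) = s * (gw s * hf v u).
    by rewrite /k; move: (hf v u) (gw s) => h1 h2; field; exact: neq0Ci.
  have xc j : cder (fun t => x t 0 j) 0.
    have -> : (fun t => x t 0 j) = (fun t => (F (qc (s *: v) 0 0 k 0 t)).1 0 j).
      apply/funext => t; rewrite /x; congr ((F (_, _)).1 0 j).
        by rewrite scaler0 addr0.
      by rewrite mulr0 addr0 add0r mulrC.
    case: Fh => Fh1 _; apply: Fh1; apply: (psmallW qr); apply/andP.
    by rewrite /qc scale0r mul0r !addr0 expr0n mul0r /= addr0 cabs0.
  have yd j : cdiff (fun t => y t 0 j) 0 ((u *m T1) 0 j).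
    have := FT (u, 0) j; rewrite /= scale0r addr0.
    have -> // : (fun t => (F (pline 0 (u, 0) t)).1 0 j) = (fun t => y t 0 j).
    by apply/funext => t; rewrite /y /pline /= !add0r mulr0.
  have y0 : y 0 = 0 by rewrite /y scale0r F0.
  have x0 : x 0 = (F (s *: v, 0)).1 by rewrite /x mulr0.
  have := hf_cdiff0 (fun j => cder_ccont (xc j)) yd y0; rewrite x0.
  move=> H1 H2; apply: (cdiff_inj (f := fun t => (F (s *: v, k * t)).2 / (2 * 'i)) (z := 0)).
    apply: (cdiff_ext H1).
    have e1 := @vsmall_line _ u q q0.
    have e2 : evt (fun t => cabs (k * t) < q).
      have : ccont (fun t => k * t) 0.
        by apply: cder_ccont; apply: (@dmul _ (fun=> k) id); [exact: dcst | exact: did].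
      move=> /(@evt_ccont _ _ _ q) /(_ q0).
      by apply: evtW => t; rewrite add0r mulr0 subr0.
    apply: evtW (evt_and (evt_conj e1) e2) => t [t1 t2]; rewrite !add0r.
    have p1 : psmall q (s *: v, k * t) by apply/andP.
    have p2 : psmall q (t^* *: u, 0 : C) by apply/andP; split=> //=; rewrite cabs0.
    have := seg _ _ p1 p2; rewrite /rr (g0 _ t1) conjC0 !subr0 /=.
    move=> E; apply/eqP; rewrite -subr_eq0; apply/eqP; apply: E.
    rewrite hfZ hfZr conjCK /k.
    by move: (hf v u) => h; field; exact: neq0Ci.
  apply: (cdiff_ext H2); apply: evt_true => t.
  by rewrite !add0r curve.
have gwc : ccont gw 0.
  move=> e e0; case: Fh => _ Fh2.
  have [K [K0 KE]] : exists K, 0 < K /\ 576 * M / r ^+ 2 = K.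
    by exists (576 * M / r ^+ 2); split; [exact: der_bound_gt0 | by []].
  pose dl := Num.min q (Num.min (r / 24) (e / (2 * K))).
  have dl0 : 0 < dl.
    by rewrite !lt_min q0 (divr_gt0 r0) ?ltr0n // divr_gt0 // mulr_gt0.
  have dlq : dl <= q by rewrite ge_min lexx.
  have dlr : dl <= r / 24 by rewrite !ge_min lexx orbT.
  have dle : dl <= e / (2 * K) by rewrite !ge_min lexx !orbT.
  move: (vsmall_line v dl0); apply: evtW => t ts; rewrite add0r.
  have r0' := r0.
  have Xs : psmall dl (t *: v, 0 : C) by apply/andP; split=> //=; rewrite cabs0.
  have d1 : @ple R (a + b) 1 (0, 1).
    by split=> [j|] /=; rewrite ?mxE ?cabs0 ?cabs1.
  have dd (d : Sp (a + b)) : ple (2 * dl) (d.1 - d.1, d.2 - d.2).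
    by rewrite /= !subrr; split=> [j|] /=; rewrite ?mxE cabs0; lra.
  have w0 : (0 *: v, 0 : C) = 0 :> Sp (a + b) by rewrite scale0r.
  have gw0P := gwP 0; rewrite w0 in gw0P.
  have v0 : vsmall q (0 *: v) by rewrite scale0r; exact: vsmall0.
  have fM p : psmall r p -> cabs (F p).2 <= M by case/Fb.
  have dlr' : dl < r / 12 by lra.
  have H := derivative_continuous r0 r1 M0 Fh2 fM dl0 dlr' Xs d1 d1 (dd _)
    (gwP t (vsmallW dlq ts)) (gw0P v0).
  rewrite KE in H; apply: (le_lt_trans H).
  exact: mul_half_lt.
have gw0 : gw 0 = gm.
  by apply: cdiff_unique; rewrite scale0r; exact: Fgm.
rewrite -gw0.
apply: (cdiff_inj (f := fun s => hf (F (s *: v, 0)).1 (u *m T1)) (z := 0)).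
  have -> : (fun s => hf (F (s *: v, 0)).1 (u *m T1)) =
      (fun s => ((F (s *: v, 0)).1 *m (sgmx a' b' *m adj (u *m T1))) 0 0).
    by apply/funext => s; rewrite hf_colE.
  rewrite hf_colE; apply: cdiff_mulmx => j.
  have := FT (v, 0) j; rewrite /= scale0r addr0.
  have -> // : (fun t => (F (pline 0 (v, 0) t)).1 0 j) = (fun t => (F (t *: v, 0)).1 0 j).
  by apply/funext => t; rewrite /pline /= !add0r mulr0.
have cc : ccont (fun s => gw s * hf v u) 0 by apply: ccont_mul gwc _; exact: ccont_cst.
apply: (cdiff_ext (cdiff_zmul cc)).
apply: evtW (vsmall_line v q0) => s ss; rewrite add0r subr0.
by rewrite slice.
Qed.

End Maps.

(** * Conformality on the Segre varieties of points near the origin *)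

Section Conformality.
Variables (R : realType) (a b a' b' : nat).
Local Notation C := (Cfield R).
Local Notation Sp q := ('rV[C]_q * C)%type.

Lemma cabs_shift (s : R) (w : C) (x u : 'rV[C]_(a + b)) : 0 < s -> s <= 1 ->
  cabs w < s -> vsmall s u -> vsmall s x ->
  cabs (w + 2 * 'i * hf u x) < 2 * (a + b).+1%:R * s.
Proof.
move=> s0 s1 ws us xs; have n0 : 0 <= (a + b)%:R :> R by exact: ler0n.
have ns : 0 <= (a + b)%:R * s :> R by rewrite mulr_ge0 // ltW.
have nE : (a + b).+1%:R = (a + b)%:R + 1 :> R by rewrite natr1.
rewrite (le_lt_trans (cabsD _ _)) // !cabsM cabs_nat cabsi mulr1.
have h : cabs (hf u x) <= (a + b)%:R * (s * s).
  by apply: cabs_hf; rewrite ?(ltW s0) // => j; apply: ltW; [exact: (forallP us) | exact: (forallP xs)].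
have h2 : (a + b)%:R * (s * s) <= (a + b)%:R * s by rewrite ler_wpM2l // ler_piMl // ltW.
rewrite nE; have -> : 2 * ((a + b)%:R + 1) * s = 2 * ((a + b)%:R * s) + s + s :> R by ring.
lra.
Qed.

Lemma two_le_shift (s : R) : 0 < s -> s + s <= 2 * (a + b).+1%:R * s.
Proof.
move=> s0; have ns : 0 <= (a + b)%:R * s :> R by rewrite mulr_ge0 ?ler0n // ltW.
have nE : (a + b).+1%:R = (a + b)%:R + 1 :> R by rewrite natr1.
rewrite nE; have -> : 2 * ((a + b)%:R + 1) * s = 2 * ((a + b)%:R * s) + s + s :> R by ring.
lra.
Qed.

Lemma sh_small (s : R) (X : Sp (a + b)) u : 0 < s -> s <= 1 -> psmall s X -> vsmall s u ->
  psmall (2 * (a + b).+1%:R * s) (sh X u).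
Proof.
move=> s0 s1 /andP[X1 X2] us; apply/andP; split; last exact: cabs_shift.
apply/forallP => j; rewrite mxE (le_lt_trans (cabsD _ _)) //.
have := forallP X1 j; have := forallP us j; have := two_le_shift s0.
by lra.
Qed.

Lemma hf_near (D0 : 'rV[C]_(a' + b')) (g : R) : 0 < g -> exists2 eta : R, 0 < eta &
  forall D : 'rV[C]_(a' + b'), (forall j, cabs (D 0 j - D0 0 j) <= eta) -> cabs (hf D D - hf D0 D0) < g.
Proof.
move=> g0; pose B : R := \sum_j cabs (D0 0 j).
have B0 : 0 <= B by apply: sumr_ge0 => j _; exact: cabs_ge0.
have DB j : cabs (D0 0 j) <= B.
  by rewrite /B (bigD1 j) //= ler_wpDr // sumr_ge0 // => i _; exact: cabs_ge0.
clearbody B; pose K : R := (a' + b')%:R * (2 * B + 1) + 1.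
have K0 : 0 < K by rewrite ltr_wpDl // mulr_ge0 ?ler0n // addr_ge0 // mulr_ge0.
pose eta := Num.min 1 (g / (2 * K)).
have eta0 : 0 < eta by rewrite lt_min ltr01 divr_gt0 // mulr_gt0.
have eta1 : eta <= 1 by rewrite ge_min lexx.
have etaK : K * eta < g by apply: mul_half_lt => //; rewrite ge_min lexx orbT.
exists eta => // D DD.
have -> : hf D D - hf D0 D0 = hf (D - D0) D + hf D0 (D - D0).
  rewrite hfDl hfDr hfNl hfNr; move: (hf D D) (hf D0 D0) (hf D0 D) => x y z; ring.
have DD' j : cabs ((D - D0) 0 j) <= eta by rewrite !mxE.
have DB' j : cabs (D 0 j) <= B + 1.
  have -> : D 0 j = D0 0 j + (D 0 j - D0 0 j) by ring.
  by rewrite (le_trans (cabsD _ _)) // lerD // (le_trans (DD j)).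
apply: le_lt_trans etaK; rewrite (le_trans (cabsD _ _)) //.
have e0 := ltW eta0; have B1 : 0 <= B + 1 by rewrite addr_ge0.
have h1 := cabs_hf e0 B1 DD' DB'; have h2 := cabs_hf B0 e0 DB DD'.
apply: (le_trans (lerD h1 h2)).
have -> : K * eta = (a' + b')%:R * (eta * (B + 1)) + (a' + b')%:R * (B * eta) + eta.
  by rewrite /K; ring.
by rewrite ler_wpDr.
Qed.

Variables (F : Sp (a + b) -> Sp (a' + b')) (r M : R).
Hypothesis HF : quadric_map F r M.

Let r0 : 0 < r. Proof. exact: qm_r0 HF. Qed.
Let r1 : r <= 1. Proof. exact: qm_r1 HF. Qed.
Let M0 : 0 < M. Proof. exact: qm_M0 HF. Qed.
Let Fh : holmap r F. Proof. exact: qm_hol HF. Qed.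

Variable g : R.
Hypothesis g0 : 0 < g.
Hypothesis Fg : cdiff (fun t => (F (pline 0 (0, 1) t)).2) 0 (toC g).

Let small_radius : exists2 s : R, 0 < s & [/\ s <= 1, s <= r &
  forall (X : Sp (a + b)) u, psmall s X -> vsmall s u -> psmall (polr (a + b) r) (sh X u)].
Proof.
have q0 : 0 < polr (a + b) r by exact: polr_gt0.
have qr : polr (a + b) r <= r by exact: polr_le.
move: (polr _ _) q0 qr => q q0 qr.
have n0 : (0 : R) < 2 * (a + b).+1%:R by rewrite mulr_gt0 ?ltr0n.
have n1 : (1 : R) <= 2 * (a + b).+1%:R by rewrite -natrM ler1n.
have sq : q / (2 * (a + b).+1%:R) <= q by rewrite ler_pdivrMr // ler_peMr // ltW.
have s0 : 0 < q / (2 * (a + b).+1%:R) by exact: divr_gt0.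
have sE : 2 * (a + b).+1%:R * (q / (2 * (a + b).+1%:R)) = q by rewrite mulrC divfK ?gt_eqF.
move: (q / _) s0 sE sq => s s0 sE sq; have r1' := r1; exists s => //.
have s1 : s <= 1 by lra.
split=> // [|X u Xs us]; first lra.
by rewrite -sE; exact: sh_small.
Qed.

Let slice (X : Sp (a + b)) u := (F (sh X u)).1 - (F X).1.

Let slice_ex : exists2 s : R, 0 < s & forall X, psmall s X -> rr X X = 0 ->
  [/\ forall u e t j, vsmall s (u + t *: e) -> cder (fun v => slice X (u + v *: e) 0 j) t,
      forall u v, vsmall s u -> vsmall s v ->
        hf (slice X u) (slice X v) = rr (F (sh X u)) (F (sh X v)),
      forall u v, vsmall s u -> vsmall s v -> hf u v = 0 -> hf (slice X u) (slice X v) = 0 &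
      psmall r X].
Proof.
have [s s0 [s1 sr sP]] := small_radius; exists s => // X Xs XX.
have qr : polr (a + b) r <= r by exact: polr_le.
have seg := segre HF; move: (polr _ _) qr seg sP => q qr seg sP.
have X0 := sP X 0 Xs (vsmall0 _ s0); rewrite sh0 in X0.
have E u v : vsmall s u -> vsmall s v ->
    hf (slice X u) (slice X v) = rr (F (sh X u)) (F (sh X v)).
  move=> us vs; rewrite /slice hf_diff.
  have su := sP X u Xs us; have sv := sP X v Xs vs.
  have XuX : rr (sh X u) X = 0 by rewrite -{2}[X]sh0 rr_sh XX hf0r addr0.
  have XXv : rr X (sh X v) = 0 by rewrite -{1}[X]sh0 rr_sh XX hf0l addr0.
  rewrite (seg _ _ su X0 XuX) (seg _ _ X0 sv XXv) (seg _ _ X0 X0 XX).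
  by rewrite !subr0 addr0.
split=> //.
- move=> u e t j us; case: Fh => Fh1 _.
  have -> : (fun v => slice X (u + v *: e) 0 j) =
      (fun v => (F (qc (X.1 + u) e (X.2 + 2 * 'i * hf u X.1) (2 * 'i * hf e X.1) 0 v)).1 0 j
        - (F X).1 0 j).
    by apply/funext => v; rewrite /slice sh_qc !mxE.
  apply: dsub; last exact: dcst.
  by apply: Fh1; rewrite -sh_qc; apply: (psmallW qr); exact: sP.
- move=> u v us vs uv; rewrite E //; apply: seg; [exact: sP | exact: sP|].
  by rewrite rr_sh XX uv addr0.
- exact: psmallW qr X0.
Qed.

Hypothesis a_gt0 : (0 < a)%N.
Hypothesis a'_lt_2a : (a' < a + a)%N.
Hypothesis a'_lt_ab : (a' < a + b)%N.

(** The derivative T of the slice at X is conformal with a real factor c. Its positivity comes by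
    continuity from the value g at the origin, tested on a single vector e1 with [hf e1 e1 = -1]. *)
Lemma slice_conformal : exists2 s : R, 0 < s & forall X, psmall s X -> rr X X = 0 ->
  exists (k : C) (al : 'rV[C]_(a + b) -> C), forall u v, vsmall s u -> vsmall s v ->
    rr (F (sh X u)) (F (sh X v)) = k * al u * (al v)^* * hf u v.
Proof.
have [s1 s10 sl] := slice_ex.
have [T0 [T0' FT0]] := qm_diff HF (@psmall0 _ _ _ r0).
have levi := levi_form HF FT0 Fg.
pose e1 : 'rV[C]_(a + b) := delta_mx 0 (lshift b (Ordinal a_gt0)).
have he1 : hf e1 e1 = -1 by rewrite /e1 hf_delta mxE !eqxx conjC1.
have form (T : 'M[C]_(a + b, a' + b')) c : T *m sgmx a' b' *m adj T = c *: sgmx a b ->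
    hf (e1 *m T) (e1 *m T) = - c.
  move=> TT; rewrite hfE adjM !mulmxA -2!(mulmxA e1) TT -scalemxAr -scalemxAl mxE.
  by rewrite -hfE he1 mulrN1.
have [eta eta0 etaP] := hf_near (e1 *m T0) g0.
have [K [K0 KE]] : exists K, 0 < K /\ 576 * M / r ^+ 2 = K.
  by exists (576 * M / r ^+ 2); split; [exact: der_bound_gt0 | by []].
have n0 : (0 : R) < 160 * (a + b).+1%:R by rewrite mulr_gt0 ?ltr0n.
pose s := Num.min (s1 / (160 * (a + b).+1%:R)) (Num.min (r / 24) (eta / (2 * K))).
have s0 : 0 < s by rewrite !lt_min !divr_gt0 ?ltr0n // mulr_gt0.
have ss1 : s <= s1 / (160 * (a + b).+1%:R) by rewrite ge_min lexx.
have sr : s <= r / 24 by rewrite !ge_min lexx orbT.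
have sK : K * s < eta by apply: mul_half_lt => //; rewrite !ge_min lexx !orbT.
have s1s : s <= s1.
  apply: (le_trans ss1); rewrite ler_pdivrMr // ler_peMr ?(ltW s10) //.
  by rewrite -natrM ler1n.
clearbody s; exists s => // X Xs XX.
have [slc slE slo Xr] := sl X (psmallW s1s Xs) XX.
have [T1 [T2 FT]] := qm_diff HF Xr.
(* Chain rule for [sh X], whose last coordinate moves by 2 'i [hf u X.1], linearly in u. *)
pose T := T1 + (2 * 'i *: (sgmx a b *m adj X.1)) *m T2.
have uT u : u *m T = u *m T1 + (2 * 'i * hf u X.1) *: T2.
  rewrite /T mulmxDr; congr (_ + _); rewrite mulmxA -scalemxAr mulmxA hf_mx1.
  by rewrite scale_scalar_mx mul_scalar_mx.
have slT u j : cdiff (fun v => slice X (v *: u) 0 j) 0 ((u *m T) 0 j).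
  have -> : (fun v => slice X (v *: u) 0 j) =
     (fun v => (F (pline X (u, 2 * 'i * hf u X.1) v)).1 0 j + - (F X).1 0 j).
    apply/funext => v; rewrite /slice !mxE /sh /pline hfZ /=; congr ((F (_, _)).1 0 j - _).
    by move: (hf u X.1) => h; ring.
  rewrite uT -[X in cdiff _ _ X]addr0.
  apply: cdiffD; last exact: cdiff_cst.
  exact: (FT (u, 2 * 'i * hf u X.1)).
have [c cE] := conformal_derivative s10 slo slT.
have c0 : 0 < c.
  have cF := form T c cE.
  have cr : c = toC (complex.Re c).
    have : - c \is Num.real by rewrite -cF hf_real.
    by rewrite realN => cr; rewrite /toC RRe_real.
  have : cabs (hf (e1 *m T) (e1 *m T) - hf (e1 *m T0) (e1 *m T0)) < g.
    apply: etaP => j; apply: ltW; apply: le_lt_trans sK; rewrite -KE.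
    have r0' := r0; have r1' := r1.
    have sr12 : s < r / 12 by lra.
    have X1j : cabs (X.1 0 (lshift b (Ordinal a_gt0))) < s by case/andP: Xs => /forallP.
    pose d : Sp (a + b) := (e1, 2 * 'i * hf e1 X.1).
    pose d0 : Sp (a + b) := (e1, 0).
    have dC : cabs d.2 <= 2 * s.
      rewrite /d /= !cabsM cabs_nat cabsi mulr1 /e1 hf_delta cabsN cabs_conj; lra.
    have e1j i : cabs (e1 0 i) <= 1.
      by rewrite mxE; case: (_ && _); rewrite ?cabs0 ?cabs1.
    have d1 : ple 1 d by split=> //; lra.
    have d01 : ple 1 d0 by split=> //=; rewrite cabs0.
    have dd : ple (2 * s) (d.1 - d0.1, d.2 - d0.2).
      split=> [i|] /=; first by rewrite subrr mxE cabs0; lra.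
      by rewrite subr0.
    have h1 := FT d j; have h2 := FT0 d0 j.
    have -> : e1 *m T = d.1 *m T1 + d.2 *: T2 by exact: uT.
    have -> : e1 *m T0 = d0.1 *m T0 + d0.2 *: T0' by rewrite /= scale0r addr0.
    case: Fh => Fh1 _.
    have fM p : psmall r p -> cabs ((F p).1 0 j) <= M by case/(qm_bound HF) => + _; apply.
    exact: (derivative_continuous r0 r1 M0 (Fh1 j) fM s0 sr12 Xs d1 d01 dd h1 h2).
  rewrite cF (form T0 _ levi) opprK addrC cr -rmorphB cabs_toC.
  rewrite -[0 < _]/(toC 0 < _) toC_lt ltr_norml => /andP[]; lra.
have [al alP] := conformal_factor s10 c0 slc slo slT cE a'_lt_2a a'_lt_ab.
exists c^-1, al => u v us vs.
by rewrite -slE ?(vsmallW s1s) // alP ?(vsmallW ss1).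
Qed.

End Conformality.

(** * The polarized four-point identity *)

Section FourPoint.
Variables (R : realType) (a b a' b' : nat).
Local Notation C := (Cfield R).
Local Notation Sp q := ('rV[C]_q * C)%type.

Lemma hf_delta_pos (i : 'I_b) (x : 'rV[C]_(a + b)) :
  hf (delta_mx 0 (rshift a i)) x = (x 0 (rshift a i))^*.
Proof.
rewrite /hf /dot [X in _ - X]big1 => [|j _].
  rewrite subr0 (bigD1 i) //= big1 => [|j ji].
    by rewrite addr0 !mxE !eqxx mul1r.
  by rewrite !mxE eqxx /= (inj_eq (@rshift_inj _ _)) (negPf ji) mul0r.
by rewrite !mxE eqxx /= eq_lrshift mul0r.
Qed.

Lemma hf_delta_r (i : 'I_a) (x : 'rV[C]_(a + b)) :
  hf x (delta_mx 0 (lshift b i)) = - x 0 (lshift b i).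
Proof. by rewrite -hf_conj hf_delta rmorphN /= conjCK. Qed.

Lemma hf_delta_pos_r (i : 'I_b) (x : 'rV[C]_(a + b)) :
  hf x (delta_mx 0 (rshift a i)) = x 0 (rshift a i).
Proof. by rewrite -hf_conj hf_delta_pos conjCK. Qed.

(* The point over z in the Segre variety of X. *)
Definition over (z : 'rV[C]_(a + b)) (X : Sp (a + b)) : Sp (a + b) :=
  (z, X.2^* + 2 * 'i * hf z X.1).

Lemma overP (Z X : Sp (a + b)) : rr Z X = 0 -> Z = over Z.1 X.
Proof.
move=> /eqP; rewrite /rr subr_eq0 => /eqP E; rewrite /over E.
rewrite [LHS]surjective_pairing; congr (_, _); field; exact: neq0Ci.
Qed.

Lemma over_sh z (X : Sp (a + b)) : rr X X = 0 -> over z X = sh X (z - X.1).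
Proof.
move=> XX; have X2 : X.2 = X.2^* + 2 * 'i * hf X.1 X.1 by rewrite {1}(overP XX).
rewrite /over /sh {2}X2 hfDl hfNl; congr (_, _); first by rewrite addrC subrK.
by move: (hf z X.1) (hf X.1 X.1) => h1 h2; ring.
Qed.

Lemma over_qc z (A B : 'rV[C]_(a + b)) w0 w1 w2 s :
  over z (qc A B w0 w1 w2 (s^*)) =
  qc z 0 (w0^* + 2 * 'i * hf z A) (w1^* + 2 * 'i * hf z B) (w2^*) s.
Proof.
rewrite /over /qc scaler0 addr0 hfDr hfZr conjCK; congr (_, _).
rewrite /= expr2 !rmorphD !rmorphM /= conjCK.
by move: (hf z A) (hf z B) => h1 h2; ring.
Qed.

Lemma cross_identity (k a1 a2 c1 c2 k1 k2 k3 k4 r1 r2 r3 r4 h1 h2 h3 h4 : C) :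
  k1 = k * a1 * c1 * h1 -> k2 = k * a2 * c2 * h2 ->
  k3 = k * a1 * c2 * h3 -> k4 = k * a2 * c1 * h4 ->
  r3 = h3 -> r4 = h4 -> r1 = h1 -> r2 = h2 -> k1 * k2 * r3 * r4 - k3 * k4 * r1 * r2 = 0.
Proof. by move=> -> -> -> -> -> -> -> ->; ring. Qed.

Variables (F : Sp (a + b) -> Sp (a' + b')) (r M : R).
Hypothesis HF : quadric_map F r M.

Let r0 : 0 < r. Proof. exact: qm_r0 HF. Qed.
Let r1 : r <= 1. Proof. exact: qm_r1 HF. Qed.
Let Fh : holmap r F. Proof. exact: qm_hol HF. Qed.

Variable g : R.
Hypothesis g0 : 0 < g.
Hypothesis Fg : cdiff (fun t => (F (pline 0 (0, 1) t)).2) 0 (toC g).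
Hypothesis a_gt0 : (0 < a)%N.
Hypothesis a'_lt_2a : (a' < a + a)%N.
Hypothesis a'_lt_ab : (a' < a + b)%N.

Local Notation K Z W := (rr (F Z) (F W)).

Let cross (Z Z' W W' : Sp (a + b)) :=
  K Z W * K Z' W' * rr Z W' * rr Z' W - K Z W' * K Z' W * rr Z W * rr Z' W'.

(** For X = Y on the hyperquadric the factors k and [al] cancel between the two sides. Polarization
    is possible because Z and Z', which lie over Y, occur in first arguments and W and W', which lie
    over X, in second ones: along the curve all of them depend holomorphically on the parameter. *)
Lemma four_point : exists2 s : R, 0 < s & forall X Y Z Z' W W' : Sp (a + b),
  psmall s X -> psmall s Y -> rr X Y = 0 ->
  vsmall s Z.1 -> vsmall s Z'.1 -> vsmall s W.1 -> vsmall s W'.1 ->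
  rr Z Y = 0 -> rr Z' Y = 0 -> rr W X = 0 -> rr W' X = 0 ->
  K Z W * K Z' W' * rr Z W' * rr Z' W = K Z W' * K Z' W * rr Z W * rr Z' W'.
Proof.
have [s1 s10 sP] := slice_conformal HF g0 Fg a_gt0 a'_lt_2a a'_lt_ab.
have n0 : (0 : R) < 2 * (a + b).+1%:R by rewrite mulr_gt0 ?ltr0n.
have n1 : (1 : R) <= 2 * (a + b).+1%:R by rewrite -natrM ler1n.
pose s := Num.min (s1 / 2) (r / (2 * (a + b).+1%:R)).
have s0 : 0 < s by rewrite lt_min !divr_gt0 ?ltr0n.
have ss1 : s <= s1 / 2 by rewrite ge_min lexx.
have sr : 2 * (a + b).+1%:R * s <= r.
  by rewrite mulrC -ler_pdivlMr // ge_min lexx orbT.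
clearbody s.
have s_1 : s <= 1.
  have r1' := r1; suff : s <= 2 * (a + b).+1%:R * s by lra.
  by rewrite ler_peMl // ltW.
have rs : s <= r by apply: le_trans sr; rewrite ler_peMl // ltW.
have q0 : 0 < polr (a + b) s by exact: polr_gt0.
have qs : polr (a + b) s <= s by exact: polr_le.
exists (polr (a + b) s) => // X Y Z Z' W W' Xs Ys XY Zs Z's Ws W's ZY Z'Y WX W'X.
(* The first components stay fixed; only the last coordinates of the four points move with X and
   Y. *)
have pol z z' w w' : vsmall s z -> vsmall s z' -> vsmall s w -> vsmall s w' ->
    cross (over z Y) (over z' Y) (over w X) (over w' X) = 0.
  move=> zs z's ws w's.
  apply: (@polarization _ _ _ (fun X Y => cross (over z Y) (over z' Y) (over w X) (over w' X)) s)
    => //.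
  - move=> A B w0 w1 w2 t c ct ctc.
    have small x T : vsmall s x -> psmall s T -> psmall r (over x T).
      move=> xs /andP[T1 T2]; apply: (psmallW sr); apply/andP; split.
        by apply: (vsmallW _ xs); rewrite ler_peMl // ltW.
      by apply: cabs_shift; rewrite ?cabs_conj.
    have ccK s' : c s' = c ((s'^*)^*) by rewrite conjCK.
    have D (p q : nat) (G : Sp (a + b) -> Sp (p + q)) x y : holmap r G ->
        vsmall s x -> vsmall s y ->
        cder (fun s' => rr (G (over x (c (s'^*)))) (G (over y (c s')))) t.
      move=> Gh xs ys.
      have -> : (fun s' => rr (G (over x (c (s'^*)))) (G (over y (c s')))) =
        (fun s' => rr (G (over x (c (s'^*)))) (G (over y (c ((s'^*)^*))))).
        by apply/funext => s'; rewrite -ccK.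
      have -> : (fun s' => rr (G (over x (c (s'^*)))) (G (over y (c ((s'^*)^*))))) =
        (fun s' => rr (G (qc x 0 (w0^* + 2 * 'i * hf x A) (w1^* + 2 * 'i * hf x B) (w2^*) s'))
          (G (qc y 0 (w0^* + 2 * 'i * hf y A) (w1^* + 2 * 'i * hf y B) (w2^*) (s'^*)))).
        by apply/funext => s'; rewrite /c !over_qc.
      apply: (rr_cder Gh); rewrite -over_qc; apply: small => //.
      by rewrite conjCK.
    have DF x y : vsmall s x -> vsmall s y ->
        cder (fun s' => rr (F (over x (c (s'^*)))) (F (over y (c s')))) t by exact: D.
    have DI x y : vsmall s x -> vsmall s y ->
        cder (fun s' => rr (over x (c (s'^*))) (over y (c s'))) t.
      by apply: (D _ _ id); exact: holmap_id.
    rewrite /cross; apply: dsub; apply: dmul; try (by exact: DI); apply: dmul;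
      try (by exact: DI); apply: dmul; exact: DF.
  - move=> P Ps PP; rewrite !over_sh //.
    have Ps1 : psmall s1 P by apply: psmallW Ps; lra.
    have [k [al alP]] := sP P Ps1 PP.
    have us x : vsmall s x -> vsmall s1 (x - P.1).
      move=> xs; apply/forallP => j; rewrite !mxE (le_lt_trans (cabsB _ _)) //.
      have := forallP xs j; case/andP: Ps => /forallP/(_ j); lra.
    have shP u v : rr (sh P u) (sh P v) = hf u v by rewrite rr_sh PP add0r.
    exact: (cross_identity (alP _ _ (us z zs) (us w ws)) (alP _ _ (us z' z's) (us w' w's))
      (alP _ _ (us z zs) (us w' w's)) (alP _ _ (us z' z's) (us w ws))
      (shP _ _) (shP _ _) (shP _ _) (shP _ _)).
rewrite (overP ZY) (overP Z'Y) (overP WX) (overP W'X).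
apply/eqP; rewrite -subr_eq0; apply/eqP.
apply: pol; exact: (vsmallW qs).
Qed.

End FourPoint.

(** * Auxiliary points for specializing the four-point identity *)

Section Points.
Variables (R : realType) (a b : nat).
Local Notation C := (Cfield R).
Local Notation Sp q := ('rV[C]_q * C)%type.

Lemma near_bounds (x : C) (c : R) : 0 < c -> cabs (x - toC c) <= c / 4 ->
  3 / 4 * c <= cabs x /\ cabs x <= 5 / 4 * c.
Proof.
move=> c0 h; have cc : cabs (toC c : C) = c by rewrite cabs_toC gtr0_norm.
have h1 := cabsD (x - toC c) (toC c); have h2 := cabsB x (x - toC c).
rewrite subrK in h1; have E : x - (x - toC c) = toC c by ring.
rewrite E in h2; split; lra.
Qed.

Lemma quot_lower (x y v c k : R) : 0 < c -> 0 <= x -> 0 <= y -> x * y = v -> y <= k * c -> 0 < k ->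
  forall l, l * k * c ^+ 2 <= v -> l * c <= x.
Proof.
move=> c0 x0 y0 E yk k0 l lv; rewrite -(ler_pM2r (mulr_gt0 k0 c0)).
apply: (@le_trans _ _ v).
  by have -> : l * c * (k * c) = l * k * c ^+ 2 by ring.
by rewrite -E ler_wpM2l.
Qed.

Lemma quot_upper (x y v c k : R) : 0 < c -> 0 <= x -> x * y = v -> k * c <= y -> 0 < k ->
  forall l, v <= l * k * c ^+ 2 -> x <= l * c.
Proof.
move=> c0 x0 E yk k0 l lv; rewrite -(ler_pM2r (mulr_gt0 k0 c0)).
apply: (@le_trans _ _ v); first by rewrite -E ler_wpM2l.
by have -> : l * c * (k * c) = l * k * c ^+ 2 by ring.
Qed.

Lemma auxiliary_bounds (c L p1 p2 z x1 x2 v : R) : 0 < c ->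
  0 <= L -> 0 <= p1 -> 0 <= p2 -> 0 <= z ->
  L * z = v / 2 -> p1 * L = c ^+ 2 -> p2 * x2 <= 5 / 8 * c ^+ 2 + x1 * p1 ->
  3 / 4 * c <= z -> z <= 5 / 4 * c -> 3 / 4 * c ^+ 2 <= v -> v <= 5 / 4 * c ^+ 2 ->
  x1 <= c / 4 -> 3 / 4 * c <= x2 ->
  [/\ L <= 4 * c, p1 <= 4 * c & p2 <= 4 * c].
Proof.
move=> c0 L0 p10 p20 z0 N1 N2 N3 z1 z2 v1 v2 x1c x2c.
have Lup : L <= 5 / 6 * c by apply: (quot_upper c0 L0 N1 z1); lra.
have Llo : 3 / 10 * c <= L by apply: (quot_lower c0 L0 z0 N1 z2); lra.
have p1up : p1 <= 10 / 3 * c by apply: (quot_upper c0 p10 N2 Llo); lra.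
have x1p1 : x1 * p1 <= 5 / 6 * c ^+ 2.
  have -> : 5 / 6 * c ^+ 2 = c / 4 * (10 / 3 * c) by field.
  apply: (@le_trans _ _ (c / 4 * p1)); first exact: ler_wpM2r.
  by rewrite ler_wpM2l //; lra.
have p2up : p2 <= 35 / 18 * c by apply: (quot_upper c0 p20 erefl x2c); lra.
clear N1 N2 N3; split; lra.
Qed.

(** The equations express rr Z Y = 0, rr X Y = 0 and rr W X = 0 for the points of [auxiliary_points]
    and are solved in turn for L, p1 and p2. Each solution is a quotient of order c^2 / c, hence of
    order c. *)
Lemma auxiliary_numbers (c : R) (z w x1 x2 t : C) : 0 < c -> c <= 1 ->
  cabs (z - toC c) <= c / 4 -> cabs w <= c ^+ 2 / 4 ->
  cabs x1 <= c / 4 -> cabs (x2 - toC c) <= c / 4 -> cabs t <= c ^+ 2 / 4 ->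
  exists L p1 p2 : C, [/\ - z * L = (w - 'i * toC (c ^+ 2)) / (2 * 'i),
    p1^* * L = toC (c ^+ 2),
    - x1 * p1 + x2 * p2 = (t - 'i * toC (c ^+ 2)) / (2 * 'i) &
    [/\ cabs L <= 4 * c, cabs p1 <= 4 * c & cabs p2 <= 4 * c]].
Proof.
move=> c0 c1 zc wc x1c x2c tc.
have [z1 z2] := near_bounds c0 zc; have [y1 y2] := near_bounds c0 x2c.
have cc0 : 0 < c ^+ 2 by exact: exprn_gt0.
have cc : cabs ('i * toC (c ^+ 2) : C) = c ^+ 2.
  by rewrite cabsM cabsi mul1r cabs_toC gtr0_norm.
have tw (u : C) : cabs u <= c ^+ 2 / 4 ->
    3 / 4 * c ^+ 2 <= cabs (u - 'i * toC (c ^+ 2)) /\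
    cabs (u - 'i * toC (c ^+ 2)) <= 5 / 4 * c ^+ 2.
  move=> uc; have h1 := cabsB u ('i * toC (c ^+ 2)).
  have h2 := cabsB u (u - 'i * toC (c ^+ 2)).
  have E : u - (u - 'i * toC (c ^+ 2)) = 'i * toC (c ^+ 2) by ring.
  rewrite E in h2; split; lra.
have [w1 w2] := tw _ wc; have [t1 t2] := tw _ tc.
have i20 : (2 * 'i : C) != 0 by exact: i2_neq0.
have i0 : 'i != 0 :> C by exact: neq0Ci.
have zn : z != 0 by rewrite -cabs_gt0; lra.
have xn : x2 != 0 by rewrite -cabs_gt0; lra.
have en : toC (c ^+ 2) != 0 :> C by rewrite -cabs_gt0 cabs_toC gtr0_norm.
have wn : w - 'i * toC (c ^+ 2) != 0 by rewrite -cabs_gt0; lra.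
pose L := - (w - 'i * toC (c ^+ 2)) / (2 * 'i) / z.
have Ln : L != 0.
  by rewrite /L mulf_neq0 ?invr_eq0 // mulf_neq0 ?invr_eq0 // oppr_eq0.
pose p1 := (toC (c ^+ 2) / L)^*.
pose p2 := ((t - 'i * toC (c ^+ 2)) / (2 * 'i) + x1 * p1) / x2.
have E1 : - z * L = (w - 'i * toC (c ^+ 2)) / (2 * 'i).
  by rewrite /L; move: (toC (c ^+ 2)) => e; field; rewrite i0 zn.
have E2 : p1^* * L = toC (c ^+ 2) by rewrite /p1 conjCK divfK.
have E3 : - x1 * p1 + x2 * p2 = (t - 'i * toC (c ^+ 2)) / (2 * 'i).
  by rewrite /p2 [x2 * _]mulrC divfK // mulNr addrC addrK.
clearbody L p1 p2; exists L, p1, p2; split => //.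
have N1 : cabs L * cabs z = cabs (w - 'i * toC (c ^+ 2)) / 2.
  rewrite mulrC -[cabs z]cabsN -cabsM E1.
  by rewrite cabsM cabsV cabsM cabs_nat cabsi mulr1.
have N2 : cabs p1 * cabs L = c ^+ 2.
  by rewrite -(cabs_conj p1) -cabsM E2 cabs_toC gtr0_norm.
have N3 : cabs p2 * cabs x2 <= 5 / 8 * c ^+ 2 + cabs x1 * cabs p1.
  rewrite -!cabsM; have -> : p2 * x2 = (t - 'i * toC (c ^+ 2)) / (2 * 'i) + x1 * p1.
    by rewrite -E3; ring.
  rewrite (le_trans (cabsD _ _)) // lerD2r cabsM cabsV cabsM cabs_nat cabsi mulr1; lra.
exact: (auxiliary_bounds c0 (cabs_ge0 _) (cabs_ge0 _) (cabs_ge0 _) (cabs_ge0 _) N1 N2 N3 z1 z2 w1 w2 x1c y1).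
Qed.

(** The last coordinate - 'i c^2 puts X0 in the Segre varieties of X and Y at once. One coordinate
    of Y and two of X then meet the other three conditions, with solutions of order c since Z is
    near c e_1 and W near c e_2. The coordinates of X are at most 8 c < 9 c. *)
Lemma auxiliary_points (c s : R) (Z W : Sp (a + b)) (i1 : 'I_a) (i2 : 'I_b) :
  0 < c -> c <= 1 -> 9 * c <= s ->
  cabs (Z.1 0 (lshift b i1) - toC c) <= c / 4 -> cabs Z.2 <= c ^+ 2 / 4 ->
  cabs (W.1 0 (lshift b i1)) <= c / 4 -> cabs (W.1 0 (rshift a i2) - toC c) <= c / 4 ->
  cabs W.2 <= c ^+ 2 / 4 ->
  let X0 : Sp (a + b) := (0, 'i * toC (c ^+ 2)) in
  exists X Y, [/\ psmall s X, psmall s Y, rr X Y = 0 &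
    [/\ rr Z Y = 0, rr X0 Y = 0, rr W X = 0 & rr X0 X = 0]].
Proof.
move=> c0 c1 cs z1 w1 x1 x2 t1 X0.
have [L [p1 [p2 [E1 E2 E3 [L4 p14 p24]]]]] := auxiliary_numbers c0 c1 z1 w1 x1 x2 t1.
pose d1 : 'rV[C]_(a + b) := delta_mx 0 (lshift b i1).
pose d2 : 'rV[C]_(a + b) := delta_mx 0 (rshift a i2).
have cc : cabs (- ('i * toC (c ^+ 2)) : C) <= c.
  rewrite cabsN cabsM cabsi mul1r cabs_toC gtr0_norm ?exprn_gt0 //.
  by rewrite expr2 ler_piMr // ltW.
have ic : (- ('i * toC (c ^+ 2)) : C)^* = 'i * toC (c ^+ 2).
  by rewrite rmorphN rmorphM /= conjCi conj_toC mulNr opprK.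
have dk k (x : C) : cabs (x * (delta_mx 0 k : 'rV[C]_(a + b)) 0 k) <= cabs x.
  by rewrite mxE !eqxx mulr1.
have dj k j : cabs ((delta_mx 0 k : 'rV[C]_(a + b)) 0 j) <= 1.
  by rewrite mxE; case: (_ && _); rewrite ?cabs0 ?cabs1.
have i0 : 'i != 0 :> C by exact: neq0Ci.
exists (p1^* *: d1 + p2^* *: d2, - ('i * toC (c ^+ 2))), (L^* *: d1, - ('i * toC (c ^+ 2))).
have mx x k j : cabs x <= 4 * c -> cabs (x * (delta_mx 0 k : 'rV[C]_(a + b)) 0 j) <= 4 * c.
  move=> xc; rewrite cabsM; apply: le_trans xc; rewrite ler_piMr ?cabs_ge0 //.
have X0Y y : rr X0 (y, - ('i * toC (c ^+ 2))) = 0.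
  by rewrite /rr /= hf0l ic subrr mul0r subr0.
split.
- apply/andP; split; last by rewrite /=; apply: (le_lt_trans cc); lra.
  apply/forallP => j /=.
  have -> : (p1^* *: d1 + p2^* *: d2) 0 j = p1^* * d1 0 j + p2^* * d2 0 j by rewrite !mxE.
  rewrite (le_lt_trans (cabsD _ _)) //.
  have h1 : cabs (p1^* * d1 0 j) <= 4 * c by apply: mx; rewrite cabs_conj.
  have h2 : cabs (p2^* * d2 0 j) <= 4 * c by apply: mx; rewrite cabs_conj.
  lra.
- apply/andP; split; last by rewrite /=; apply: (le_lt_trans cc); lra.
  apply/forallP => j /=.
  have -> : (L^* *: d1) 0 j = L^* * d1 0 j by rewrite !mxE.
  have h1 : cabs (L^* * d1 0 j) <= 4 * c by apply: mx; rewrite cabs_conj.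
  lra.
- rewrite /rr /= ic hfZr conjCK hf_delta_r !mxE !eqxx /= eq_lrshift mulr0 addr0 mulr1.
  by rewrite mulrN [L * _]mulrC E2; move: (toC (c ^+ 2)) => e; field.
- split; [|exact: X0Y| |exact: X0Y].
    by rewrite /rr /= ic hfZr conjCK hf_delta_r mulrC E1 subrr.
  rewrite /rr /= ic hfDr !hfZr !conjCK hf_delta_r hf_delta_pos_r.
  apply/eqP; rewrite subr_eq0; apply/eqP; rewrite -E3; ring.
Qed.

End Points.

(** * Factorization of the kernel *)

Section Factorization.
Variables (R : realType) (a b a' b' : nat).
Local Notation C := (Cfield R).
Local Notation Sp q := ('rV[C]_q * C)%type.

Lemma ple_psmall q (s : R) (p d : Sp q) m t : 0 <= s -> ple s d -> cabs t <= m ->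
  ple (m * s) ((pline p d t).1 - p.1, (pline p d t).2 - p.2).
Proof.
move=> s0 [d1 d2] tm; split=> [j|] /=.
  rewrite addrC addKr mxE cabsM; apply: ler_pM; rewrite ?cabs_ge0 //; exact: d1.
by rewrite addrC addKr cabsM; apply: ler_pM; rewrite ?cabs_ge0.
Qed.

Lemma hermitian_identity (k k' k0 r1 r1' r2 r2' k1 k1' k2 k2' r r' r0 : C) :
  k^* = k' -> k0^* = k0 -> r1^* = r1' -> r2^* = r2' -> k1^* = k1' -> k2^* = k2' ->
  r^* = r' -> r0^* = r0 ->
  (k * k0 * r1 * r2 - k1 * k2 * r * r0)^* = k' * k0 * r2' * r1' - k2' * k1' * r' * r0.
Proof.
move=> <- e0 <- <- <- <- <- e1; rewrite rmorphB !rmorphM /= e0 e1.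
by congr (_ - _ * _ * _); [rewrite -mulrA [r1^* * _]mulrC mulrA | rewrite mulrC].
Qed.

Variables (F : Sp (a + b) -> Sp (a' + b')) (r M : R).
Hypothesis HF : quadric_map F r M.

Let r0 : 0 < r. Proof. exact: qm_r0 HF. Qed.
Let r1 : r <= 1. Proof. exact: qm_r1 HF. Qed.
Let M0 : 0 < M. Proof. exact: qm_M0 HF. Qed.
Let Fh : holmap r F. Proof. exact: qm_hol HF. Qed.
Let F0 : F 0 = 0. Proof. exact: qm_F0 HF. Qed.

Variable g : R.
Hypothesis g0 : 0 < g.
Hypothesis Fg : cdiff (fun t => (F (pline 0 (0, 1) t)).2) 0 (toC g).

Local Notation K Z W := (rr (F Z) (F W)).

(** At X0 the last component of F is close to g 'i e and the others are of order e, so K X0 X0 is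
    within 3 g e / 4 of - g e. *)
Lemma base_point : exists2 e0 : R, 0 < e0 & forall e, 0 < e -> e < e0 ->
  let X0 : Sp (a + b) := (0, 'i * toC e) in
  [/\ psmall r X0, exists2 k : R, k < 0 & K X0 X0 = toC k & K 0 X0 != 0].
Proof.
have g0' := g0; have gq : 0 < g / 4 by lra.
have [dl dl0 dlP] := Fg gq.
have [B [B0 BE]] : exists B, 0 < B /\ 12 * M / r = B.
  exists (12 * M / r); split; last by [].
  by rewrite divr_gt0 // mulr_gt0 // ltr0n.
pose p : R := (a' + b')%:R; have p0 : 0 <= p by exact: ler0n.
pose D := p * B ^+ 2 + 1.
have D0 : 0 < D by rewrite ltr_wpDl // mulr_ge0 // exprn_ge0 // ltW.
pose e0 := Num.min dl (Num.min (r / 6) (g / 2 / (2 * D))).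
have e00 : 0 < e0 by rewrite !lt_min dl0 !divr_gt0 ?ltr0n // mulr_gt0.
exists e0 => // e ep ee0 X0.
have edl : e < dl by apply: lt_le_trans ee0 _; rewrite ge_min lexx.
have er : e < r / 6 by apply: lt_le_trans ee0 _; rewrite !ge_min lexx orbT.
have eD : D * e < g / 2.
  apply: mul_half_lt => //; first by lra.
  by apply: ltW; apply: lt_le_trans ee0 _; rewrite !ge_min lexx !orbT.
clearbody e0.
have ce : cabs ('i * toC e : C) = e by rewrite cabsM cabsi mul1r cabs_toC gtr0_norm.
have r0' := r0; have r1' := r1.
have X0r : psmall r X0.
  by apply/andP; split; [exact: vsmall0 | rewrite /= ce; lra].
have X0d : ple e (X0.1 - (0 : Sp (a + b)).1, X0.2 - (0 : Sp (a + b)).2).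
  split=> [j|] /=; first by rewrite subr0 mxE cabs0 ltW.
  by rewrite subr0 ce.
have r2 : psmall (r / 2) (0 : Sp (a + b)) by apply: psmall0; lra.
have f1 j : cabs ((F X0).1 0 j) <= B * e.
  have fM q : psmall r q -> cabs ((F q).1 0 j) <= M by case/(qm_bound HF) => + _; apply.
  case: Fh => Fh1 _; have := lipschitz r0 M0 (Fh1 j) fM r2 ep er X0d.
  by rewrite BE F0 mxE subr0.
have gE : cabs ((F X0).2 - toC g * ('i * toC e)) <= g / 4 * e.
  have := dlP ('i * toC e); rewrite ce => /(_ edl).
  have -> : pline 0 (0, 1) (0 + 'i * toC e) = X0 :> Sp (a + b).
    by rewrite /pline /= scaler0 !add0r mulr1.
  have -> : pline 0 (0, 1) 0 = 0 :> Sp (a + b).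
    by rewrite /pline scale0r mul0r !addr0.
  by rewrite F0 subr0.
have ge0 : 0 < g * e by rewrite mulr_gt0.
split => //.
  pose k := complex.Re (K X0 X0).
  have kE : K X0 X0 = toC k.
    by rewrite /k /toC RRe_real //; apply/CrealP; exact: rr_conj.
  exists k => //.
  pose u := (F X0).2 - toC g * ('i * toC e); rewrite -/u in gE.
  have H1 : cabs (hf (F X0).1 (F X0).1) <= p * (B * e * (B * e)).
    by apply: cabs_hf => //; rewrite ltW // mulr_gt0.
  have H2 : toC k + toC (g * e) = hf (F X0).1 (F X0).1 - (u - u^*) / (2 * 'i).
    rewrite -kE toCM /rr /u; move: (hf _ _) ((F X0).2) => h w.
    rewrite rmorphB !rmorphM /= conjCi !conj_toC.
    by move: (toC g) (toC e) (w^*) => x y z; field; exact: neq0Ci.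
  have H3 : cabs (toC k + toC (g * e) : C) <= p * (B * e * (B * e)) + g / 4 * e.
    rewrite H2 (le_trans (cabsB _ _)) // lerD // cabsM cabsV cabsM cabs_nat cabsi mulr1.
    have := cabsB u (u^*); rewrite cabs_conj; lra.
  have H4 : p * (B * e * (B * e)) <= g / 2 * e.
    have -> : p * (B * e * (B * e)) = p * B ^+ 2 * e * e by ring.
    rewrite ler_wpM2r ?(ltW ep) // (le_trans _ (ltW eD)) // ler_wpM2r ?(ltW ep) //.
    by rewrite /D lerDl.
  have := le_trans H3 (lerD H4 (lexx _)).
  rewrite -toCD cabs_toC ler_norml => /andP[_].
  have -> : g / 2 * e + g / 4 * e = 3 / 4 * (g * e) by field.
  lra.
have g2 : (F X0).2 != 0.
  rewrite -cabs_gt0; have := cabsB (F X0).2 ((F X0).2 - toC g * ('i * toC e)).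
  have -> : (F X0).2 - ((F X0).2 - toC g * ('i * toC e)) = toC g * ('i * toC e) by ring.
  rewrite cabsM ce cabs_toC gtr0_norm //.
  have ge4 : g / 4 * e = 1 / 4 * (g * e) by field.
  rewrite ge4 in gE.
  lra.
rewrite /rr F0 /= hf0l !sub0r mulNr opprK mulf_neq0 ?conjC_eq0 //.
by rewrite invr_eq0 i2_neq0.
Qed.

Hypothesis a_gt0 : (0 < a)%N.
Hypothesis b_gt0 : (0 < b)%N.
Hypothesis a'_lt_2a : (a' < a + a)%N.
Hypothesis a'_lt_ab : (a' < a + b)%N.

(** The difference of the two sides of [four_point] for Z' = W' = X0. It is extended in Z by
    holomorphy and in W through [S_conj]. *)
Let S X0 Z W := K Z W * K X0 X0 * rr Z X0 * rr X0 W - K Z X0 * K X0 W * rr Z W * rr X0 X0.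

Let S_conj X0 Z W : (S X0 Z W)^* = S X0 W Z.
Proof. by apply: hermitian_identity; exact: rr_conj. Qed.

Let rr_cder_l p q (G : Sp (a + b) -> Sp (p + q)) P D Q t : holmap r G ->
  psmall r (pline P D t) -> psmall r Q -> cder (fun s => rr (G (pline P D s)) (G Q)) t.
Proof.
move=> Gh Pt Qr; have Q_qc s : Q = qc Q.1 0 Q.2 0 0 s.
  by rewrite /qc scaler0 !mulr0 !addr0 -surjective_pairing.
have -> : (fun s => rr (G (pline P D s)) (G Q)) = (fun s =>
    rr (G (qc P.1 D.1 P.2 D.2 0 s)) (G (qc Q.1 0 Q.2 0 0 (s^*)))).
  by apply/funext => s; rewrite -Q_qc plineE.
by apply: (rr_cder Gh); rewrite -?plineE -?Q_qc.
Qed.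

Let extend X0 P D Q : psmall r X0 -> psmall r Q ->
  (forall t, cabs t < 4 -> psmall r (pline P D t)) ->
  evt (fun t => S X0 (pline P D t) Q = 0) -> S X0 (pline P D 1) Q = 0.
Proof.
move=> X0r Qr PD h; apply: (@identity_theorem _ (fun t => S X0 (pline P D t) Q) 0 4).
- lra.
- move=> t; rewrite subr0 => /PD Pt.
  have DF P' : psmall r P' -> cder (fun s => rr (F (pline P D s)) (F P')) t.
    by move=> P'r; exact: (rr_cder_l Fh Pt P'r).
  have DI P' : psmall r P' -> cder (fun s => rr (pline P D s) P') t.
    by move=> P'r; apply: (@rr_cder_l _ _ id) => //; exact: holmap_id.
  rewrite /S; apply: dsub.
    apply: dmul; last exact: dcst.
    by apply: dmul (DI _ X0r); apply: dmul (DF _ Qr) _; exact: dcst.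
  apply: dmul; last exact: dcst.
  by apply: dmul (DI _ Qr); apply: dmul (DF _ X0r) _; exact: dcst.
- exact: evt_punctured.
- by rewrite subr0 cabs1; lra.
Qed.

Lemma factorization : exists (s e k : R), let X0 : Sp (a + b) := (0, 'i * toC e) in
  [/\ 0 < s, s < e, k < 0, psmall r X0 & [/\ K X0 X0 = toC k, K 0 X0 != 0 &
    forall Z W, psmall s Z -> psmall s W ->
      K Z W * toC k * rr Z X0 * rr X0 W = K Z X0 * K X0 W * rr Z W * rr X0 X0]].
Proof.
have [s s0 fp] := four_point HF g0 Fg a_gt0 a'_lt_2a a'_lt_ab.
have [e0 e00 bp] := base_point.
have r0' := r0; have r1' := r1.
pose c := Num.min (Num.min (1 / 2) (s / 9)) (Num.min (r / 10) (e0 / 2)).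
have c0 : 0 < c by rewrite !lt_min !divr_gt0.
have c1 : c <= 1 / 2 by rewrite !ge_min lexx.
have c2 : c <= s / 9 by rewrite !ge_min lexx orbT.
have c3 : c <= r / 10 by rewrite !ge_min lexx !orbT.
have c4 : c <= e0 / 2 by rewrite !ge_min lexx !orbT.
clearbody c.
have c1' : c <= 1 by lra.
have c2' : 9 * c <= s by lra.
have cc0 : 0 < c ^+ 2 by exact: exprn_gt0.
have ccc : c ^+ 2 <= c / 2.
  by have -> : c ^+ 2 = c * c by []; rewrite ler_wpM2l ?(ltW c0) //; lra.
have [X0r [k k0 kE] K0] := bp (c ^+ 2) cc0 (ltac:(lra)).
(* The radius c^2 / 2 is below the height c^2 of X0, so that rr Z X0 does not vanish and can be
   divided by later. *)
exists (c ^+ 2 / 2), (c ^+ 2), k => X0; split => //; try lra.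
split => // Z W Zs Ws.
(* The auxiliary points exist for Z near one such point, with a negative index, and W near another,
   with a positive index. From there S = 0 is carried along lines to the given Z and W, at t = 1. *)
pose P (i : 'I_(a + b)) : Sp (a + b) := (toC c *: delta_mx 0 i, 0).
pose D i (Z : Sp (a + b)) : Sp (a + b) := (Z.1 - (P i).1, Z.2 - (P i).2).
have PDZ i T : pline (P i) (D i T) 1 = T.
  rewrite /pline /D scale1r mul1r ![_ + (_ - _)]addrC !subrK.
  by rewrite -surjective_pairing.
have cE : cabs (toC c : C) = c by rewrite cabs_toC gtr0_norm.
have Pj i j : cabs ((P i).1 0 j) <= c.
  rewrite /= !mxE cabsM cE ler_piMr ?(ltW c0) //.
  by case: (_ && _); rewrite ?cabs0 ?cabs1.
have Dple i T : psmall (c ^+ 2 / 2) T -> ple (2 * c) (D i T).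
  move=> /andP[T1 T2]; split=> [j|] /=.
    rewrite (_ : (T.1 - (P i).1) 0 j = T.1 0 j - (P i).1 0 j); last by rewrite !mxE.
    rewrite (le_trans (cabsB _ _)) //.
    have := Pj i j; have := forallP T1 j; lra.
  rewrite subr0; lra.
have line i T t : psmall (c ^+ 2 / 2) T -> cabs t < 4 -> psmall r (pline (P i) (D i T) t).
  move=> Ts t4; have Ps : psmall (2 * c) (P i).
    apply/andP; split; last by rewrite /= cabs0; lra.
    by apply/forallP => j; have := Pj i j; lra.
  apply: psmallW (pline_small t Ps (Dple i T Ts)).
  have : cabs t * (2 * c) <= 4 * (2 * c) by rewrite ler_pM2r; lra.
  lra.
have near i T : psmall (c ^+ 2 / 2) T -> evt (fun t => let Y := pline (P i) (D i T) t in
    [/\ forall j, cabs (Y.1 0 j - (P i).1 0 j) <= c / 4, cabs Y.2 <= c ^+ 2 / 4 &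
      vsmall s Y.1 /\ psmall r Y]).
  move=> Ts; exists (c / 8); first by lra.
  move=> t tc Y; have c20 : 0 <= 2 * c by lra.
  have [h1 h2] := ple_psmall (P i) c20 (Dple i T Ts) (ltW tc).
  have E : c / 8 * (2 * c) = c ^+ 2 / 4 by field.
  have h1' j : cabs (Y.1 0 j - (P i).1 0 j) <= c ^+ 2 / 4.
    by have := h1 j; rewrite E (_ : (Y.1 - (P i).1) 0 j = Y.1 0 j - (P i).1 0 j) // !mxE.
  split; [|by move: h2; rewrite E /= subr0|split].
  - by move=> j; apply: (le_trans (h1' j)); lra.
  - apply/forallP => j; have -> : Y.1 0 j = (P i).1 0 j + (Y.1 0 j - (P i).1 0 j) by ring.
    rewrite (le_lt_trans (cabsD _ _)) //; have := h1' j; have := Pj i j; lra.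
  - by apply: line => //; lra.
have r2 T : psmall (c ^+ 2 / 2) T -> psmall r T by apply: psmallW; lra.
pose i1 := Ordinal a_gt0; pose i2 := Ordinal b_gt0.
have P1 : (P (lshift b i1)).1 0 (lshift b i1) = toC c by rewrite !mxE !eqxx mulr1.
have P2 : (P (rshift a i2)).1 0 (rshift a i2) = toC c by rewrite !mxE !eqxx mulr1.
have P3 : (P (rshift a i2)).1 0 (lshift b i1) = 0 by rewrite !mxE eqxx /= eq_lrshift mulr0.
suff : S X0 Z W = 0 by rewrite /S kE => /eqP; rewrite subr_eq0 => /eqP.
rewrite -(PDZ (lshift b i1) Z); apply: extend => //; [exact: r2 | by move=> t; exact: line |].
apply: evtW (near (lshift b i1) Z Zs) => t; move: (pline _ _ t) => Y [Y1 Y2 [Y3 Yr]].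
rewrite -S_conj; apply/eqP; rewrite conjC_eq0; apply/eqP.
rewrite -(PDZ (rshift a i2) W); apply: extend => //; first by move=> t'; exact: line.
apply: evtW (near (rshift a i2) W Ws) => t'; move: (pline _ _ t') => T [T1 T2 [T3 Tr]].
rewrite -S_conj; apply/eqP; rewrite conjC_eq0; apply/eqP.
have Y1' := Y1 (lshift b i1); rewrite P1 in Y1'.
have T1' := T1 (lshift b i1); rewrite P3 subr0 in T1'.
have T1'' := T1 (rshift a i2); rewrite P2 in T1''.
have [X [X' [Xs X's XX' [YX' X0X' TX X0X]]]] :=
  auxiliary_points c0 c1' c2' Y1' Y2 T1' T1'' T2.
have X0s : vsmall s X0.1 by exact: vsmall0.
by rewrite /S (fp X X' Y X0 T X0 Xs X's XX' Y3 X0s T3 X0s YX' X0X' TX X0X) subrr.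
Qed.

End Factorization.

(** * Automorphisms and the normal form *)

Section Differentiability.
Variables (R : realType).
Local Notation C := (Cfield R).
Local Notation Sp q := ('rV[C]_q * C)%type.

Lemma nbhs_psmall q (X : Sp q) (P : set (Sp q)) : nbhs X P <->
  exists2 s : R, 0 < s & forall p : Sp q, psmall s (p.1 - X.1, p.2 - X.2) -> P p.
Proof.
split=> [/nbhs_ballP[e /= e0 eP]|[s s0 sP]].
  have ee : e = toC (complex.Re e) by rewrite /toC RRe_real // gtr0_real.
  have re0 : 0 < complex.Re e by rewrite -toC_lt -ee.
  exists (complex.Re e) => // p /andP[p1 p2]; apply: eP; split.
    split=> // i j; rewrite (ord1 i) -ball_normE /= /ball_ distrC cabsE ee toC_lt.
    by have := forallP p1 j; rewrite !mxE.
  by rewrite -ball_normE /= /ball_ distrC cabsE ee toC_lt.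
apply/nbhs_ballP; exists (toC s); first by rewrite /= -toC0 toC_lt.
move=> p [[_ p1] p2]; apply: sP; apply/andP; split.
  apply/forallP => j; have := p1 0 j; rewrite -ball_normE /= /ball_ distrC cabsE toC_lt.
  by rewrite !mxE.
by move: p2; rewrite -ball_normE /= /ball_ distrC cabsE toC_lt.
Qed.

Lemma near0_psmall q (P : set (Sp q)) : (\forall p \near (0 : Sp q), P p) <->
  exists2 s : R, 0 < s & forall p, psmall s p -> P p.
Proof.
have E (p : Sp q) : (p.1 - (0 : Sp q).1, p.2 - (0 : Sp q).2) = p.
  by rewrite /= !subr0 -surjective_pairing.
have := nbhs_psmall 0 P.
by split=> [/H[s s0 sP]|[s s0 sP]]; [|apply/H]; exists s => // p ps; apply: sP;
  rewrite ?E // -[p]E.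
Qed.

Lemma differentiable_fst q (X : Sp q) : differentiable (fst : Sp q -> 'rV[C]_q) X.
Proof. by apply: linear_differentiable => x; exact: cvg_fst. Qed.

Lemma differentiable_snd q (X : Sp q) : differentiable (snd : Sp q -> C) X.
Proof. by apply: linear_differentiable => x; exact: cvg_snd. Qed.

Section Coordinates.
Variables (V : normedModType C) (x : V).

Definition dcoords q (f : V -> 'rV[C]_q) := forall j, differentiable (fun p => f p 0 j : C) x.

Lemma dcoords_diff q (f : V -> 'rV[C]_q) : differentiable f x -> dcoords f.
Proof.
move=> fx j; apply: (differentiable_comp (g := fun N : 'rV[C]_q => N 0 j : C) fx).
exact: differentiable_coord.
Qed.

Lemma diff_dcoords q (f : V -> 'rV[C]_q) : dcoords f -> differentiable f x.
Proof.
move=> fx; have -> : f = \sum_(j < q) (fun p => (f p 0 j : C) *: (delta_mx 0 j : 'rV[C]_q)).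
  by apply/funext => p; rewrite fct_sumE [LHS]row_sum_delta.
by apply: differentiable_sum => j; apply: differentiableZl.
Qed.

Lemma differentiable_add (f g : V -> C) : differentiable f x -> differentiable g x ->
  differentiable (fun p => f p + g p) x.
Proof. exact: differentiableD. Qed.

Lemma differentiable_mul (f g : V -> C) : differentiable f x -> differentiable g x ->
  differentiable (fun p => f p * g p) x.
Proof. exact: differentiableM. Qed.

Lemma dcoords_mulmx q p (f : V -> 'rV[C]_q) (A : 'M[C]_(q, p)) :
  dcoords f -> dcoords (fun y => f y *m A).
Proof.
move=> fx j; have -> : (fun y => (f y *m A) 0 j) =
    \sum_(i < q) (fun y => f y 0 i * A i j : C).
  by apply/funext => y; rewrite fct_sumE mxE.
by apply: differentiable_sum => i; apply: differentiable_mul.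
Qed.

Lemma dcoords_row_mx q p (f : V -> 'rV[C]_q) (g : V -> 'rV[C]_p) :
  dcoords f -> dcoords g -> dcoords (fun y => row_mx (f y) (g y)).
Proof.
move=> fx gx j; case: (split_ordP j) => i ->.
  by have -> : (fun y => row_mx (f y) (g y) 0 (lshift p i)) = (fun y => f y 0 i);
    [apply/funext => y; rewrite row_mxEl | exact: fx].
by have -> : (fun y => row_mx (f y) (g y) 0 (rshift q i)) = (fun y => g y 0 i);
  [apply/funext => y; rewrite row_mxEr | exact: gx].
Qed.

Lemma dcoords_lsubmx q p (f : V -> 'rV[C]_(q + p)) : dcoords f ->
  dcoords (fun y => lsubmx (f y)).
Proof.
move=> fx j; have -> : (fun y => lsubmx (f y) 0 j) = (fun y => f y 0 (lshift p j)).
  by apply/funext => y; rewrite mxE.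
exact: fx.
Qed.

Lemma dcoords_rsubmx q p (f : V -> 'rV[C]_(q + p)) : dcoords f ->
  dcoords (fun y => rsubmx (f y)).
Proof.
move=> fx j; have -> : (fun y => rsubmx (f y) 0 j) = (fun y => f y 0 (rshift q j)).
  by apply/funext => y; rewrite mxE.
exact: fx.
Qed.

Lemma dcoords_scale q (c : V -> C) (f : V -> 'rV[C]_q) : differentiable c x -> dcoords f ->
  dcoords (fun y => c y *: f y).
Proof.
move=> cx fx j; have -> : (fun y => (c y *: f y) 0 j) = (fun y => c y * f y 0 j).
  by apply/funext => y; rewrite mxE.
exact: differentiable_mul.
Qed.

Lemma dcoords_scalar (c : V -> C) : differentiable c x ->
  dcoords (fun y => (c y)%:M : 'rV[C]_1).
Proof.
move=> cx j; have -> // : (fun y => ((c y)%:M : 'rV[C]_1) 0 j) = c.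
by apply/funext => y; rewrite !ord1 mxE.
Qed.

Lemma differentiable_affine (c : V -> C) (u v : C) : differentiable c x ->
  differentiable (fun y => (c y + u) * v) x.
Proof.
move=> cx; apply: differentiable_mul; last exact: differentiable_cst.
by apply: differentiable_add cx _; exact: differentiable_cst.
Qed.

Lemma dcoords_hom a b (f : V -> Sp (a + b)) : differentiable f x ->
  dcoords (fun y => hom (f y)).
Proof.
move=> fx; have f1 : dcoords (fun y => (f y).1).
  by apply: dcoords_diff; exact: (differentiable_comp fx (differentiable_fst _)).
have f2 : differentiable (fun y => (f y).2) x.
  exact: (differentiable_comp fx (differentiable_snd _)).
apply: dcoords_row_mx; apply: dcoords_row_mx.
- by apply: dcoords_scalar; exact: differentiable_affine.
- exact: dcoords_lsubmx.
- by apply: dcoords_scalar; exact: differentiable_affine.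
- exact: dcoords_rsubmx.
Qed.

Lemma differentiable_den a b (y : V -> 'rV[C]_((1 + a) + (1 + b))) : dcoords y ->
  differentiable (fun p => den (y p)) x.
Proof.
move=> yx; apply: differentiable_mul; last exact: differentiable_cst.
apply: differentiableB.
  by apply: (dcoords_lsubmx (dcoords_lsubmx yx)).
by apply: (dcoords_lsubmx (dcoords_rsubmx yx)).
Qed.

Lemma differentiable_dehom a b (y : V -> 'rV[C]_((1 + a) + (1 + b))) : dcoords y ->
  den (y x) != 0 -> differentiable (fun p => dehom (y p)) x.
Proof.
move=> yx d0; have dV : differentiable (fun p => (den (y p))^-1) x.
  exact: differentiableV (differentiable_den yx) d0.
apply: differentiable_pair.
  apply: diff_dcoords; apply: dcoords_scale dV _.
  by apply: dcoords_row_mx; apply: dcoords_rsubmx; [exact: dcoords_lsubmx | exact: dcoords_rsubmx].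
apply: differentiable_mul dV; apply: differentiable_add.
  by apply: (dcoords_lsubmx (dcoords_lsubmx yx)).
by apply: (dcoords_lsubmx (dcoords_rsubmx yx)).
Qed.

Lemma differentiable_hf a b (f : V -> 'rV[C]_(a + b)) c : dcoords f ->
  differentiable (fun p => hf (f p) c) x.
Proof.
move=> fx; have -> : (fun p => hf (f p) c) = (fun p => (f p *m (sgmx a b *m adj c)) 0 0).
  by apply/funext => p; rewrite hf_colE.
exact: dcoords_mulmx.
Qed.

Lemma differentiable_rr a b (f : V -> Sp (a + b)) W : differentiable f x ->
  differentiable (fun p => rr (f p) W) x.
Proof.
move=> fx; apply: differentiableB.
  apply: differentiable_hf; apply: dcoords_diff.
  exact: (differentiable_comp fx (differentiable_fst _)).
apply: differentiable_affine.
exact: (differentiable_comp fx (differentiable_snd _)).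
Qed.

End Coordinates.

Lemma differentiable_cder (f : C -> C) z : differentiable f z -> cder f z.
Proof. by move=> /derivable1_diffP /cder_derivable. Qed.

Lemma differentiable_qc q (A B : 'rV[C]_q) w0 w1 w2 (t : C) :
  differentiable (fun s => qc A B w0 w1 w2 s) t.
Proof.
have d0 (c : C) : differentiable (fun=> c : C) t by exact: differentiable_cst.
have d1 : differentiable (id : C -> C) t.
  by apply/derivable1_diffP; apply/cder_derivable; exact: did.
apply: differentiable_pair.
  apply: diff_dcoords => j.
  have -> : (fun s : C => (A + s *: B) 0 j) = (fun s => A 0 j + s * B 0 j).
    by apply/funext => s; rewrite !mxE.
  by apply: differentiable_add; [|apply: differentiable_mul].
apply: differentiable_add; last by do 2! [apply: differentiable_mul => //].
by apply: differentiable_add => //; apply: differentiable_mul.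
Qed.

Lemma cdiff_direction q (f : Sp q -> C) X (d : Sp q) : differentiable f X ->
  cdiff (fun t => f (pline X d t)) 0 ('d f X d).
Proof.
move=> fX; have -> : 'd f X d = 'D_1 (fun t => f (pline X d t)) 0.
  rewrite -(deriveE d fX) /derive.
  apply: (congr1 (fun u : C -> C => lim (u @ 0^'))); apply/funext => h /=.
  rewrite /pline scale0r mul0r !addr0 -surjective_pairing; congr (_ *: (f _ - _)).
  by rewrite [_%:A]mulr1; apply: injective_projections; rewrite /= addrC.
apply: cderP; apply: differentiable_cder.
have E : (fun t => pline X d t) = (fun t => qc X.1 d.1 X.2 d.2 0 t).
  by apply/funext => t; rewrite plineE.
apply: (@differentiable_comp _ _ _ _ (fun t => pline X d t) f).
  by rewrite E; exact: differentiable_qc.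
by rewrite /pline scale0r mul0r !addr0 -surjective_pairing.
Qed.

Lemma differentiable_holmap q p (F : Sp q -> Sp p) (r : R) :
  (forall X, psmall r X -> differentiable F X) -> holmap r F.
Proof.
move=> Fd.
have H (f : Sp q -> C) : (forall X, psmall r X -> differentiable f X) -> hol1 r f.
  move=> fd A B w0 w1 w2 t /fd ft; apply: differentiable_cder.
  exact: (differentiable_comp (differentiable_qc A B w0 w1 w2 t) ft).
split=> [j|]; apply: H => X /Fd FX.
  apply: (@dcoords_diff _ _ _ (fun p => (F p).1)).
  exact: (differentiable_comp FX (differentiable_fst _)).
exact: (differentiable_comp FX (differentiable_snd _)).
Qed.

Lemma linear_coordinates q (D : {linear (Sp q : normedModType C) -> (C : normedModType C)})
    (d : Sp q) : D d = \sum_i d.1 0 i * D (delta_mx 0 i, 0) + d.2 * D (0, 1).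
Proof.
have dE : d = \sum_i d.1 0 i *: (delta_mx 0 i, 0) + d.2 *: (0, 1) :> Sp q.
  rewrite [LHS]surjective_pairing; apply: injective_projections => /=.
    rewrite scaler0 addr0 raddf_sum /= [LHS]row_sum_delta.
    by apply: eq_bigr => i _.
  rewrite [_%:A]mulr1 raddf_sum /= big1 ?add0r // => i _.
  exact: mulr0.
rewrite {1}dE linearD linear_sum; congr (_ + _); last by rewrite linearZ.
by apply: eq_bigr => i _; rewrite linearZ.
Qed.

Lemma differentiable_directions q p (F : Sp q -> Sp p) X : differentiable F X ->
  exists (T1 : 'M[C]_(q, p)) (T2 : 'rV[C]_p), forall d j,
    cdiff (fun t => (F (pline X d t)).1 0 j) 0 ((d.1 *m T1 + d.2 *: T2) 0 j).
Proof.
move=> FX; have Fj : dcoords X (fun p => (F p).1).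
  by apply: dcoords_diff; exact: (differentiable_comp FX (differentiable_fst _)).
pose f j (Y : Sp q) : C := (F Y).1 0 j.
have [g gE] : exists g, forall i j, g i j = 'd (f j) X (delta_mx 0 i, 0).
  by exists (fun i j => 'd (f j) X (delta_mx 0 i, 0)).
have [h hE] : exists h, forall j, h j = 'd (f j) X (0, 1) by exists (fun j => 'd (f j) X (0, 1)).
exists (\matrix_(i, j) g i j), (\row_j h j) => d j.
have -> : (d.1 *m (\matrix_(i, j) g i j) + d.2 *: (\row_j h j)) 0 j =
    \sum_i d.1 0 i * g i j + d.2 * h j.
  by rewrite !mxE; congr (_ + _); apply: eq_bigr => i _; rewrite mxE.
have E : \sum_i d.1 0 i * g i j + d.2 * h j = 'd (f j) X d.
  rewrite hE (eq_bigr (fun i => d.1 0 i * 'd (f j) X (delta_mx 0 i, 0))) => [|i _].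
    exact/esym/linear_coordinates.
  by rewrite gE.
rewrite E; exact: (cdiff_direction d (Fj j)).
Qed.

End Differentiability.

(** * Projective automorphisms *)

Section Normalization.
Variables (R : realType).
Local Notation C := (Cfield R).
Local Notation Sp q := ('rV[C]_q * C)%type.

Lemma denD a b (x y : 'rV[C]_((1 + a) + (1 + b))) : den (x + y) = den x + den y.
Proof. by rewrite /den !linearD /= !mxE -mulrDl opprD addrACA. Qed.

Lemma hom_affine a b (Z : Sp (a + b)) t :
  hom (t *: Z.1, t * Z.2) = (1 - t) *: hom (0 : Sp (a + b)) + t *: hom Z.
Proof.
rewrite /hom /= !linear0 !scale_row_mx !add_row_mx !scaler0 !add0r !linearZ /=.
have sD (x y : C) : x%:M + y%:M = (x + y)%:M :> 'M[C]_1.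
  by rewrite raddfD.
rewrite !scale_scalar_mx !sD.
move: (Z.2) => z.
by congr (row_mx (row_mx _%:M _) (row_mx _%:M _)); field.
Qed.

(** w kills [hom Z] for small Z, then for every Z since [hom] is affine on lines through 0, then
    every y with [den y != 0] by homogeneity, and finally every y after adding a multiple of
    [hom 0]. *)
Lemma hom_span a b (s : R) (w : 'cV[C]_((1 + a) + (1 + b))) : 0 < s ->
  (forall Z : Sp (a + b), psmall s Z -> hom Z *m w = 0) -> w = 0.
Proof.
move=> s0 sw; have w0 : hom (0 : Sp (a + b)) *m w = 0 by apply: sw; exact: psmall0.
have hw (Z : Sp (a + b)) : hom Z *m w = 0.
  have [t [t0 _ ts]] := evt_punctured (psmall_line Z s0) ltr01.
  rewrite subr0 cabs_gt0 in t0.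
  have := sw _ ts; rewrite /pline !add0r hom_affine mulmxDl -!scalemxAl w0 scaler0 add0r.
  by move=> /eqP; rewrite scaler_eq0 (negPf t0) => /eqP.
have dw (y : 'rV[C]_((1 + a) + (1 + b))) : den y != 0 -> y *m w = 0.
  move=> d0; have := hw (dehom y); rewrite hom_dehom // -scalemxAl => /eqP.
  by rewrite scaler_eq0 invr_eq0 (negPf d0) => /eqP.
have yw (y : 'rV[C]_((1 + a) + (1 + b))) : y *m w = 0.
  have := dw (y + (1 - den y) *: hom (0 : Sp (a + b))).
  rewrite denD denZ den_hom mulr1 addrC subrK oner_neq0 => /(_ isT).
  by rewrite mulmxDl -scalemxAl w0 scaler0 addr0.
by apply/row_matrixP => i; rewrite rowE yw row0.
Qed.

Lemma nbhs_neq0 (z : C) : z != 0 -> nbhs z [set y : C | y != 0].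
Proof.
move=> z0; apply/nbhs_ballP; exists `|z|; first by rewrite /= normr_gt0.
move=> y; rewrite -ball_normE /= /ball_; apply: contraTneq => ->.
by rewrite subr0 ltxx.
Qed.

(** Gi and its inverse G act in the affine chart, and scalars are lost in [dehom]. The domains are
    the complements of the hyperplanes sent to infinity. *)
Lemma projective_automorphism p q (G Gi : 'M[C]_((1 + p) + (1 + q))) :
  G *m Gi = 1%:M -> Gi *m G = 1%:M ->
  (forall x y, hf (x *m Gi) (y *m Gi) = hf x y) ->
  den (hom (0 : Sp (p + q)) *m Gi) != 0 ->
  let gamma := fun Z : Sp (p + q) => dehom (hom Z *m Gi) in
  gamma 0 = 0 ->
  local_biholomorphism0 (gamma : (Sp (p + q) : normedModType C) -> (Sp (p + q) : normedModType C)) /\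
  \forall Z \near (0 : Sp (p + q)), rr Z Z = 0 -> rr (gamma Z) (gamma Z) = 0.
Proof.
move=> GGi GiG Gihf d0 gamma g0.
pose A := [set Z : Sp (p + q) | den (hom Z *m Gi) != 0].
pose B := [set Z : Sp (p + q) | den (hom Z *m G) != 0].
have dd (H : 'M[C]_((1 + p) + (1 + q))) (x : Sp (p + q)) :
    dcoords x (fun Z : (Sp (p + q) : normedModType C) => hom Z *m H).
  apply: dcoords_mulmx; apply: (@dcoords_hom _ _ _ _ _ id).
  exact: (@linear_differentiable _ _ _ idfun x (fun x => cvg_id)).
have op (H : 'M[C]_((1 + p) + (1 + q))) :
    open [set Z : Sp (p + q) | den (hom Z *m H) != 0].
  rewrite openE => x /= dx.
  have /differentiable_continuous dc := differentiable_den (dd H x).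
  have n0 : nbhs (den (hom x *m H)) [set y : C | y != 0].
    exact: nbhs_neq0.
  exact: (dc _ n0).
have trans (H H' : 'M[C]_((1 + p) + (1 + q))) (Z : Sp (p + q)) : H *m H' = 1%:M ->
    den (hom Z *m H) != 0 ->
    hom (dehom (hom Z *m H)) *m H' = (den (hom Z *m H))^-1 *: hom Z.
  by move=> HH dz; rewrite hom_dehom // -scalemxAl -mulmxA HH mulmx1.
have back (H H' : 'M[C]_((1 + p) + (1 + q))) (Z : Sp (p + q)) : H *m H' = 1%:M ->
    den (hom Z *m H) != 0 ->
    den (hom (dehom (hom Z *m H)) *m H') != 0 /\ dehom (hom (dehom (hom Z *m H)) *m H') = Z.
  move=> HH dz; rewrite (trans H H' Z HH dz) denZ den_hom mulr1 invr_eq0.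
  split; first exact: dz.
  rewrite dehomZ ?invr_eq0 //.
  have -> : dehom (hom Z) = Z; last by [].
  rewrite /hom dehom_row_mx; last by field.
  by rewrite hsubmxK [RHS]surjective_pairing; congr (_, _); field.
split.
  split=> //; exists A, B, (fun Z => dehom (hom Z *m G)); split.
  - split; [exact: op | exact: op | exact: d0 |].
    by have [+ _] := back _ _ 0 GiG d0; rewrite -/(gamma 0) g0.
  - by move=> x Ax; apply: differentiable_dehom => //; exact: dd.
  - by move=> x Bx; apply: differentiable_dehom => //; exact: dd.
  - by move=> x Ax; exact: back.
  - by move=> x Bx; exact: back.
apply: (filterS (P := A)); last by apply: open_nbhs_nbhs; split => //; exact: op.
move=> Z Az; rewrite -[rr Z Z]hf_hom -[rr (gamma Z) (gamma Z)]hf_hom => ZZ.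
by rewrite /gamma (hom_dehom Az) hfZ hfZr Gihf ZZ !mulr0.
Qed.

End Normalization.

(** * Normal form by Witt's theorem *)

Section NormalForm.
Variables (R : realType) (a b m k : nat).
Local Notation C := (Cfield R).
Local Notation Sp q := ('rV[C]_q * C)%type.

Lemma isometry_inverse p q (G : 'M[C]_(p + q)) : G *m sgmx p q *m adj G = sgmx p q ->
  exists Gi : 'M[C]_(p + q), [/\ G *m Gi = 1%:M, Gi *m G = 1%:M &
    forall x y : 'rV_(p + q), hf (x *m Gi) (y *m Gi) = hf x y].
Proof.
move=> GJ; pose Gi := sgmx p q *m adj G *m sgmx p q.
have GGi : G *m Gi = 1%:M by rewrite /Gi !mulmxA GJ sgmxK.
clearbody Gi.
have GiG := mulmx1C GGi.
have E : Gi *m sgmx p q *m adj Gi = sgmx p q.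
  by rewrite -{1}GJ !mulmxA GiG mul1mx -mulmxA -adjM GiG adj1 mulmx1.
exists Gi; split; [exact: GGi | exact: GiG | move=> x y].
by rewrite hfE adjM !mulmxA -2!(mulmxA x) E -hfE.
Qed.

Lemma normal_form0 : normal_form k (0 : Sp (a + b)) (0 : 'rV[C]_m) = 0.
Proof.
rewrite /normal_form /= !linear0.
have -> : \row_j [seq (0 : 'rV[C]_m) 0 i | i : 'I_m]`_j = 0 :> 'rV[C]_k.
  apply/rowP => j; rewrite !mxE; have [jm|jm] := ltnP j m.
    by rewrite (nth_row 0 (Ordinal jm)) mxE.
  by rewrite nth_row_out.
by rewrite !row_mx0.
Qed.

Variables (F : Sp (a + b) -> Sp ((a + m) + (b + k))) (r M : R).
Hypothesis HF : quadric_map F r M.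
Hypothesis Fdiff : forall X : Sp (a + b), psmall r X ->
  differentiable (F : (Sp (a + b) : normedModType C) -> (Sp ((a + m) + (b + k)) : normedModType C)) X.

Variable g : R.
Hypothesis g0 : 0 < g.
Hypothesis Fg : cdiff (fun t => (F (pline 0 (0, 1) t)).2) 0 (toC g).
Hypothesis ma : (m < a)%N.
Hypothesis mb : (m < b)%N.

Local Notation K Z W := (rr (F Z) (F W)).

Let scaled_isometry : exists (s : R) (h : Sp (a + b) -> C), 0 < s /\
  forall Z, psmall s Z -> [/\ psmall r Z, h Z != 0, differentiable (h : (Sp (a + b) : normedModType C) -> C) Z &
    forall W, psmall s W -> K Z W = h Z * (h W)^* * rr Z W].
Proof.
have r0 := qm_r0 HF.
have a0 : (0 < a)%N by apply: leq_ltn_trans ma.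
have b0 : (0 < b)%N by apply: leq_ltn_trans mb.
have h1 : (a + m < a + a)%N by rewrite ltn_add2l.
have h2 : (a + m < a + b)%N by rewrite ltn_add2l.
have [s [e [l [s0 se l0 X0r [X0l K0 Kf]]]]] := factorization HF g0 Fg a0 b0 h1 h2.
set X0 : Sp (a + b) := (0, 'i * toC e) in X0r X0l K0 Kf.
have e0 : 0 < e by exact: lt_trans se.
(* Solving [factorization] for K Z W, with rr X0 X0 = - e and l = K X0 X0, leaves the constant e /
   (- l). It is positive, so its square root can be shared equally between h Z and the conjugate of
   h W. *)
pose c := Num.sqrt (e / - l).
have el0 : 0 < e / - l by rewrite divr_gt0 // oppr_gt0.
have c0 : 0 < c by rewrite sqrtr_gt0.
have cc : c * c = e / - l by rewrite -expr2 sqr_sqrtr // ltW.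
have cn : toC c != 0 :> C by rewrite -cabs_gt0 cabs_toC gtr0_norm.
have ln : toC l != 0 :> C by rewrite -cabs_gt0 cabs_toC ltr0_norm // oppr_gt0.
have en : toC e != 0 :> C by rewrite -cabs_gt0 cabs_toC gtr0_norm.
have rr0 : rr X0 X0 = - toC e.
  rewrite /rr /X0 /= hf0l rmorphM /= conjCi conj_toC; move: (toC e) => x.
  by field; exact: neq0Ci.
have rrn Z : psmall s Z -> rr Z X0 != 0.
  move=> /andP[_ Z2]; rewrite /rr /X0 /= hf0r sub0r oppr_eq0.
  rewrite mulf_neq0 ?invr_eq0 ?i2_neq0 // rmorphM /= conjCi conj_toC.
  rewrite -cabs_gt0; have := cabsB (Z.2 - - 'i * toC e) Z.2.
  have -> : Z.2 - - 'i * toC e - Z.2 = 'i * toC e by ring.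
  rewrite cabsM cabsi mul1r cabs_toC gtr0_norm //; lra.
have KX0 Z : psmall r Z ->
    differentiable ((fun Z => K Z X0) : (Sp (a + b) : normedModType C) -> C) Z.
  by move=> /Fdiff FZ; exact: differentiable_rr.
have [s2 s20 s2P] : exists2 s2 : R, 0 < s2 & forall Z, psmall s2 Z -> K Z X0 != 0.
  apply/near0_psmall; have /KX0/differentiable_continuous dc := @psmall0 R (a + b) _ r0.
  exact: (dc _ (nbhs_neq0 K0)).
pose s1 := Num.min s (Num.min s2 r).
have s10 : 0 < s1 by rewrite !lt_min s0 s20.
have s1s : s1 <= s by rewrite ge_min lexx.
have s1s2 : s1 <= s2 by rewrite !ge_min lexx orbT.
have s1r : s1 <= r by rewrite !ge_min lexx !orbT.
clearbody s1 c.
exists s1, (fun Z => toC c * K Z X0 / rr Z X0); split; first exact: s10.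
move=> Z Zs.
have Zr := psmallW s1r Zs; have n1 := rrn _ (psmallW s1s Zs).
have conj_quot (x y z : C) : (x * y / z)^* = x^* * y^* / z^*.
  by rewrite rmorphM fmorphV rmorphM.
split; first exact: Zr.
- by rewrite mulf_neq0 ?invr_eq0 // mulf_neq0 // s2P // (psmallW s1s2).
- apply: differentiable_mul.
    by apply: differentiable_mul (KX0 _ Zr); exact: differentiable_cst.
  apply: differentiableV; last exact: n1.
  apply: (@differentiable_rr _ _ _ _ _ id).
  exact: (@linear_differentiable _ _ _ idfun Z (fun x => cvg_id)).
- move=> W Ws; have n2 := rrn _ (psmallW s1s Ws).
  have E := Kf Z W (psmallW s1s Zs) (psmallW s1s Ws); rewrite rr0 in E.
  have cj : (toC c * K W X0 / rr W X0)^* = toC c * K X0 W / rr X0 W.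
    by rewrite conj_quot conj_toC !rr_conj.
  have n3 : rr X0 W != 0 by rewrite -rr_conj conjC_eq0.
  rewrite cj; move: (rr Z X0) (rr X0 W) (K Z X0) (K X0 W) (rr Z W) (K Z W) n1 n3 E.
  have cc' : toC c * toC c = toC e / - toC l :> C by rewrite -toCM cc toCM toCV toCN.
  move=> r1 r2 k1 k2 r3 k0 n1 n3 E.
  have -> : toC c * k1 / r1 * (toC c * k2 / r2) * r3 = toC c * toC c * k1 * k2 * r3 / (r1 * r2).
    by field; rewrite n1 n3.
  rewrite cc'; apply: (mulIf ln); apply: (mulIf n1); apply: (mulIf n3); rewrite E.
  move: (toC e) (toC l) ln en => x y yn xn.
  by field; rewrite n1 n3 yn.
Qed.

Lemma normalization :
  exists gamma : Sp ((a + m) + (b + k)) -> Sp ((a + m) + (b + k)),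
    local_biholomorphism0 (gamma : (Sp _ : normedModType C) -> (Sp _ : normedModType C)) /\
    (\forall Z \near (0 : Sp ((a + m) + (b + k))), rr Z Z = 0 -> rr (gamma Z) (gamma Z) = 0) /\
    exists psi : Sp (a + b) -> 'rV[C]_m, \forall Z \near (0 : Sp (a + b)),
      differentiable (psi : (Sp (a + b) : normedModType C) -> 'rV[C]_m) Z /\
      gamma (F Z) = normal_form k Z (psi Z).
Proof.
have [s [h [s0 hP]]] := scaled_isometry.
pose S := {Z : Sp (a + b) | psmall s Z}.
pose sg0 : S := exist _ 0 (@psmall0 R (a + b) _ s0).
pose e (sg : S) := hom (val sg).
(* The sizes are grouped as (1 + a) + m and (1 + b) + k: the extra homogeneous coordinates belong to
   the blocks that the normal form preserves. *)
pose v (sg : S) : 'rV[C]_(((1 + a) + m) + ((1 + b) + k)) :=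
  (h (val sg))^-1 *: hom (F (val sg)).
have ve sg tau : hf (v sg) (v tau) = hf (e sg) (e tau).
  rewrite /v /e; case: sg tau => [Z Zs] [W Ws] /=.
  have [_ hZ _ /(_ W Ws) KE] := hP Z Zs; have [_ hW _ _] := hP W Ws.
  rewrite (hf_hom Z W) -[RHS]/(rr Z W).
  have <- : (h Z)^-1 * ((h W)^-1)^* * K Z W = rr Z W.
    have -> : ((h W)^-1)^* = ((h W)^*)^-1 by rewrite fmorphV.
    rewrite KE; have hW' : (h W)^* != 0 by rewrite conjC_eq0.
    by move: (h Z) ((h W)^*) (rr Z W) hZ hW' => x y z xn yn; field; rewrite xn yn.
  by rewrite -[K Z W]hf_hom -mulrA -hfZr -hfZ.
have espan (w : 'cV[C]_((1 + a) + (1 + b))) : (forall sg, e sg *m w = 0) -> w = 0.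
  move=> ew; apply: (hom_span s0) => Z Zs; exact: (ew (exist _ Z Zs)).
have e0 : e sg0 != 0.
  apply/eqP => E; have := den_hom (0 : Sp (a + b)).
  by rewrite -[hom 0]/(e sg0) E -(scale0r 0) denZ mul0r => /esym/eqP; rewrite oner_eq0.
have [G [GJ Gv]] := isometric_normal_form ve espan e0.
have [Gi [GGi GiG Gihf]] := isometry_inverse GJ.
have main Z : psmall s Z -> exists psi : 'rV[C]_m,
    [/\ hom (F Z) *m Gi = h Z *: (row_mx (row_mx (lsubmx (hom Z)) psi)
          (row_mx (rsubmx (hom Z)) (\row_j [seq psi 0 i | i : 'I_m]`_j))) &
      Z = 0 -> psi = 0].
  move=> Zs; have [psi [vE p0]] := Gv (exist _ Z Zs).
  have [_ hZ _ _] := hP Z Zs.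
  exists psi; split; last first.
    move=> Z0; apply: p0; apply: val_inj; exact: Z0.
  have -> : hom (F Z) = h Z *: v (exist _ Z Zs).
    by rewrite /v /= scalerA mulfV // scale1r.
  by rewrite vE -scalemxAl -mulmxA GGi mulmx1.
pose gamma (Z : Sp ((a + m) + (b + k))) := dehom (hom Z *m Gi).
have gF Z : psmall s Z -> exists psi : 'rV[C]_m,
    [/\ hom (F Z) *m Gi = h Z *: (row_mx (row_mx (lsubmx (hom Z)) psi)
          (row_mx (rsubmx (hom Z)) (\row_j [seq psi 0 i | i : 'I_m]`_j))),
      gamma (F Z) = normal_form k Z psi, den (hom (F Z) *m Gi) != 0 & Z = 0 -> psi = 0].
  move=> Zs; have [psi [E p0]] := main Z Zs; have [_ hZ _ _] := hP Z Zs.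
  have [E1 E2] := dehom_normal_form k Z psi hZ.
  exists psi; split; [exact: E | by rewrite /gamma E; exact: E1 | | exact: p0].
  by rewrite E E2; exact: hZ.
have F0 := qm_F0 HF.
have [psi0 [_ g00 d0 /(_ erefl) p0]] := gF 0 (@psmall0 R (a + b) _ s0).
rewrite F0 in g00 d0; rewrite p0 normal_form0 in g00.
have [gbi gM] := projective_automorphism GGi GiG Gihf d0 g00.
exists gamma; split; first exact: gbi.
split; first exact: gM.
(* psi was so far chosen point by point; read off as a block of [hom (F Z) *m Gi] divided by h Z, it
   is differentiable. *)
exists (fun Z => (h Z)^-1 *: rsubmx (lsubmx (hom (F Z) *m Gi : 'rV_(((1 + a) + m) + ((1 + b) + k))))).
apply/near0_psmall; exists s => // Z Zs.
have [Zr hZ hd _] := hP Z Zs; split.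
  apply: diff_dcoords; apply: dcoords_scale; first exact: differentiableV hd hZ.
  apply: dcoords_rsubmx; apply: dcoords_lsubmx; apply: dcoords_mulmx.
  by apply: (@dcoords_hom _ _ _ _ _ (fun y => F y)); exact: Fdiff.
have [psi [E gE _ _]] := gF Z Zs.
rewrite gE; congr normal_form; rewrite E scale_row_mx row_mxKl scale_row_mx row_mxKr.
by rewrite scalerA mulVf // scale1r.
Qed.

End NormalForm.

(** * From hyperquadrics to Hermitian forms *)

Section Core.
Variables (R : realType).
Local Notation C := (Cfield R).
Local Notation Sp q := ('rV[C]_q * C)%type.

(** T is injective on the two coordinate subspaces on which the form is definite; their images are
    definite of the same sign and dimension, which inertia bounds. *)
Lemma signature_le a b a' b' (T : 'M[C]_(a + b, a' + b')) (g : R) : 0 < g ->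
  T *m sgmx a' b' *m adj T = toC g *: sgmx a b -> (a <= a')%N /\ (b <= b')%N.
Proof.
move=> g0 TT; have g0' : 0 < toC g :> C by rewrite -toC0 toC_lt.
have form (x : 'rV[C]_(a + b)) : hf (x *m T) (x *m T) = toC g * hf x x.
  rewrite hfE adjM !mulmxA -2!(mulmxA x) TT -scalemxAr -scalemxAl mxE.
  by rewrite -hfE.
have free k (P : 'M[C]_(k, a + b)) :
    (forall u : 'rV_k, hf (u *m P) (u *m P) = 0 -> u = 0) -> row_free (P *m T).
  move=> h; apply: inj_row_free => u; rewrite mulmxA => uT; apply: h.
  have := form (u *m P); rewrite uT hf0l => /esym/eqP; rewrite mulf_eq0 (gt_eqF g0').
  by move/eqP.
pose P1 : 'M[C]_(a, a + b) := row_mx 1%:M 0.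
pose P2 : 'M[C]_(b, a + b) := row_mx 0 1%:M.
have u1 (u : 'rV_a) : hf (u *m P1) (u *m P1) = - dot u u.
  by rewrite /P1 mul_mx_row mulmx1 mulmx0 /hf row_mxKl row_mxKr [dot 0 0]big1 ?sub0r // => i _; rewrite mxE mul0r.
have u2 (u : 'rV_b) : hf (u *m P2) (u *m P2) = dot u u.
  by rewrite /P2 mul_mx_row mulmx1 mulmx0 /hf row_mxKl row_mxKr [dot 0 0]big1 ?subr0 // => i _; rewrite mxE mul0r.
split.
  apply: (@inertia_nonpos _ a' b' a (P1 *m T)).
    by apply: free => u; rewrite u1 => /eqP; rewrite oppr_eq0 => /eqP/dot_eq0.
  move=> u; rewrite mulmxA form u1 mulrN oppr_le0; apply: mulr_ge0; first exact: ltW.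
  exact: dot_ge0.
apply: (@inertia_nonneg _ a' b' b (P2 *m T)).
  by apply: free => u; rewrite u2 => /dot_eq0.
move=> u; rewrite mulmxA form u2; apply: mulr_ge0; first exact: ltW.
exact: dot_ge0.
Qed.

Section Map.
Variables (a b a' b' : nat) (U : set (Sp (a + b))) (F : Sp (a + b) -> Sp (a' + b')).
Hypothesis openU : open U.
Hypothesis U0 : U 0.
Hypothesis holF : forall x, U x ->
  differentiable (F : (Sp (a + b) : normedModType C) -> (Sp (a' + b') : normedModType C)) x.
Hypothesis F0 : F 0 = 0.
Hypothesis FM : forall p, U p -> rr p p = 0 -> rr (F p) (F p) = 0.

Lemma quadric_map_near0 : exists r, quadric_map F r 1 /\ forall X : Sp (a + b), psmall r X ->
  differentiable (F : (Sp (a + b) : normedModType C) -> (Sp (a' + b') : normedModType C)) X.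
Proof.
have /near0_psmall[s s0 sU] : nbhs (0 : Sp (a + b)) U by apply: open_nbhs_nbhs; split.
have /near0_psmall[s2 s20 s2F] : \forall p \near (0 : Sp (a + b)), psmall 1 (F p).
  have /differentiable_continuous Fc := holF U0.
  have n1 : nbhs (F 0) [set p : Sp (a' + b') | psmall 1 p].
    by rewrite F0; apply/near0_psmall; exists 1.
  exact: (Fc _ n1).
pose r := Num.min s (Num.min s2 1).
have r0 : 0 < r by rewrite !lt_min s0 s20 ltr01.
have rs : r <= s by rewrite ge_min lexx.
have rs2 : r <= s2 by rewrite !ge_min lexx orbT.
have r1 : r <= 1 by rewrite !ge_min lexx !orbT.
clearbody r.
have Fd X : psmall r X -> differentiable
  (F : (Sp (a + b) : normedModType C) -> (Sp (a' + b') : normedModType C)) X.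
  by move=> Xr; apply: holF; apply: sU; exact: psmallW Xr.
exists r; split; last exact: Fd.
split.
- exact: r0.
- exact: r1.
- exact: ltr01.
- exact: differentiable_holmap Fd.
- exact: F0.
- move=> p /(psmallW rs2)/s2F/andP[p1 p2]; split=> [j|]; last exact: ltW.
  by apply: ltW; exact: (forallP p1).
- move=> X Xr; apply: FM; apply: sU; exact: psmallW Xr.
- by move=> X Xr; exact: differentiable_directions (Fd X Xr).
Qed.

Lemma transversal_derivative : 0 < derive1 (fun w : C => (F (0, w)).2) 0 ->
  exists2 g : R, 0 < g & cdiff (fun t => (F (pline 0 (0, 1) t)).2) 0 (toC g).
Proof.
have [r [HF Fd]] := quadric_map_near0.
have E : (fun t => (F (pline 0 (0, 1) t)).2) = (fun w : C => (F (0, w)).2).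
  by apply/funext => t; rewrite /pline /= scaler0 !add0r mulr1.
have : cder (fun w : C => (F (0, w)).2) 0.
  rewrite -E; apply: (@hol1_pline _ _ r (fun X => (F X).2)).
    by case: (qm_hol HF).
  by rewrite /pline scale0r mul0r !addr0; apply: psmall0; exact: qm_r0 HF.
move/cderP; rewrite derive1E; set d := derive _ _ _ => dP d0; clearbody d.
have dE : d = toC (complex.Re d) by rewrite /toC RRe_real // gtr0_real.
exists (complex.Re d); first by rewrite -toC_lt -dE.
by rewrite -dE E.
Qed.

End Map.

Lemma hyperquadric_rr a b (p : Sp (a + b)) :
  @hyperquadric R (a + b).+1 a p <-> rr p p = 0.
Proof.
have E : - (\sum_(j < a + b | (j < a)%N) `|p.1 0 j| ^+ 2)
    + \sum_(j < a + b | (a <= j)%N) `|p.1 0 j| ^+ 2 = hf p.1 p.1.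
  rewrite !big_split_ord /= [LHS]addrC /hf /dot; congr (_ - _).
    rewrite big_pred0 ?add0r => [|i]; last by rewrite leqNgt ltn_ord.
    by apply: eq_big => i; rewrite ?leq_addr // mxE normCK.
  rewrite addrC big_pred0 ?add0r => [|i]; last by rewrite ltnNge leq_addr.
  by apply: eq_big => i; rewrite ?ltn_ord // mxE normCK.
have I : 'Im p.2 = (p.2 - p.2^*) / (2 * 'i).
  rewrite ImE; apply: (mulIf (i2_neq0 R)); rewrite divfK ?i2_neq0 //.
  have -> : 'i * (p.2^* - p.2) / 2 * (2 * 'i) = ('i * 'i) * (p.2^* - p.2) by field.
  by rewrite ii mulN1r opprB.
rewrite /hyperquadric /rr -I; split=> [/= h|/eqP].
  by apply/eqP; rewrite subr_eq0 eq_sym; apply/eqP; rewrite -E.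
by rewrite subr_eq0 => /eqP h /=; rewrite -E in h; rewrite h.
Qed.

Lemma size_coords (q : nat) (x : 'rV[C]_q) : size (coords x) = q.
Proof. by rewrite /coords size_map size_enum_ord. Qed.

Lemma pad_cat p q (x : 'rV[C]_p) s : pad (p + q) (coords x ++ s) = row_mx x (pad q s).
Proof.
apply/rowP => j; rewrite [LHS]mxE nth_cat size_coords; case: (split_ordP j) => i ->.
  by rewrite row_mxEl /=; exact: nth_row.
by rewrite row_mxEr mxE /= addKn.
Qed.

Lemma coords_row_mx p q (x : 'rV[C]_p) (y : 'rV[C]_q) :
  coords (row_mx x y) = coords x ++ coords y.
Proof.
apply: (@eq_from_nth _ 0); first by rewrite size_cat !size_coords.
move=> i; rewrite size_coords => ip; rewrite nth_cat size_coords.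
rewrite (nth_row (row_mx x y) (Ordinal ip)).
case: (split_ordP (Ordinal ip)) => j E; rewrite {1}E; have /= iE := congr1 val E.
  by rewrite row_mxEl iE; apply/esym; exact: nth_row.
by rewrite row_mxEr iE addKn; apply/esym; exact: nth_row.
Qed.

Lemma pad_normal_form p m q k (x : 'rV[C]_p) (y : 'rV[C]_q) (psi : 'rV[C]_m) :
  pad ((p + m) + (q + k)) (coords x ++ coords psi ++ coords y ++ coords psi) =
  row_mx (row_mx x psi) (row_mx y (\row_j [seq psi 0 i | i : 'I_m]`_j)).
Proof. by rewrite catA -coords_row_mx pad_cat pad_cat. Qed.

Lemma coords_take p q (z : 'rV[C]_(p + q)) : take p (coords z) = coords (lsubmx z).
Proof. by rewrite -[in LHS](hsubmxK z) coords_row_mx take_size_cat // size_coords. Qed.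

Lemma coords_drop p q (z : 'rV[C]_(p + q)) : drop p (coords z) = coords (rsubmx z).
Proof. by rewrite -[in LHS](hsubmxK z) coords_row_mx drop_size_cat // size_coords. Qed.

Lemma normal_form_on_hyperquadric a b m k (U : set (Sp (a + b)))
    (F : Sp (a + b) -> Sp ((a + m) + (b + k))) : open U -> U 0 ->
  (forall x, U x -> differentiable
     (F : (Sp (a + b) : normedModType C) -> (Sp ((a + m) + (b + k)) : normedModType C)) x) ->
  F 0 = 0 ->
  (forall p, U p -> rr p p = 0 -> rr (F p) (F p) = 0) ->
  0 < derive1 (fun w : C => (F (0, w)).2) 0 -> (m < a)%N -> (m < b)%N ->
  exists gamma : Sp ((a + m) + (b + k)) -> Sp ((a + m) + (b + k)),
    @Aut0 R ((a + m) + (b + k)).+1 (a + m) gamma /\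
    exists psi : Sp (a + b) -> 'rV[C]_m, exists2 s : R, 0 < s &
      forall Z, psmall s Z ->
        differentiable (psi : (Sp (a + b) : normedModType C) -> 'rV[C]_m) Z /\
        gamma (F Z) = normal_form k Z (psi Z).
Proof.
move=> openU U0 holF F0 FM dg ma mb.
have [r [HF Fd]] := quadric_map_near0 openU U0 holF F0 FM.
have [g g0 Fg] := transversal_derivative openU U0 holF F0 FM dg.
have [gamma [gbi [gM [psi psiP]]]] := normalization HF Fd g0 Fg ma mb.
exists gamma; split.
  split; first exact: gbi.
  apply: filterS gM => p gp /hyperquadric_rr/gp h; exact/hyperquadric_rr.
by exists psi; apply/near0_psmall.
Qed.

Lemma signature_on_hyperquadric a b a' b' (U : set (Sp (a + b)))
    (F : Sp (a + b) -> Sp (a' + b')) : open U -> U 0 ->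
  (forall x, U x -> differentiable
     (F : (Sp (a + b) : normedModType C) -> (Sp (a' + b') : normedModType C)) x) ->
  F 0 = 0 ->
  (forall p, U p -> rr p p = 0 -> rr (F p) (F p) = 0) ->
  0 < derive1 (fun w : C => (F (0, w)).2) 0 -> (a <= a')%N /\ (b <= b')%N.
Proof.
move=> openU U0 holF F0 FM dg.
have [r [HF Fd]] := quadric_map_near0 openU U0 holF F0 FM.
have [g g0 Fg] := transversal_derivative openU U0 holF F0 FM dg.
have [T1 [T2 FT]] := qm_diff HF (@psmall0 _ _ _ (qm_r0 HF)).
exact: signature_le g0 (levi_form HF FT Fg).
Qed.

End Core.

(** * Exchange of signs *)

Section Swap.
Variables (R : realType).
Local Notation C := (Cfield R).
Local Notation Sp q := ('rV[C]_q * C)%type.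

(* Exchanging the two groups of coordinates and the sign of w turns the case
   of a negative derivative into the positive one. *)
Definition swp p q (Z : Sp (p + q)) : Sp (q + p) := (row_mx (rsubmx Z.1) (lsubmx Z.1), - Z.2).

Lemma swpK p q (Z : Sp (p + q)) : swp (swp Z) = Z.
Proof. by rewrite /swp /= row_mxKl row_mxKr hsubmxK opprK -surjective_pairing. Qed.

Lemma swp0 p q : swp (0 : Sp (p + q)) = 0.
Proof. by rewrite /swp /= !linear0 row_mx0. Qed.

Lemma rr_swp p q (Z : Sp (p + q)) : rr (swp Z) (swp Z) = - rr Z Z.
Proof.
rewrite /rr /hf /swp /= row_mxKl row_mxKr rmorphN /=.
move: (dot _ _) (dot _ _) (Z.2^*) => x y z; field; exact: neq0Ci.
Qed.

Lemma psmall_swp p q (s : R) (Z : Sp (p + q)) : psmall s Z -> psmall s (swp Z).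
Proof.
move=> /andP[Z1 Z2]; apply/andP; split; last by rewrite /= cabsN.
apply/forallP => j /=; case: (split_ordP j) => i ->.
  by rewrite row_mxEl mxE; exact: (forallP Z1).
by rewrite row_mxEr mxE; exact: (forallP Z1).
Qed.

Lemma differentiable_swp p q (Z : Sp (p + q)) :
  differentiable (@swp p q : (Sp (p + q) : normedModType C) -> (Sp (q + p) : normedModType C)) Z.
Proof.
have Z1 := dcoords_diff (differentiable_fst Z).
apply: differentiable_pair.
  apply: diff_dcoords; apply: dcoords_row_mx; [exact: dcoords_rsubmx | exact: dcoords_lsubmx].
by apply: differentiableN; exact: differentiable_snd.
Qed.

Lemma derive1_swp p q p' q' (F : Sp (p + q) -> Sp (p' + q')) :
  differentiable (F : (Sp (p + q) : normedModType C) -> (Sp (p' + q') : normedModType C)) 0 ->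
  derive1 (fun w : C => (F (swp (0 : 'rV[C]_(q + p), w))).2) 0 =
  - derive1 (fun w : C => (F (0, w)).2) 0.
Proof.
move=> FX; have qE : (fun w : C => (F (0, w)).2) = (fun w => (F (qc 0 0 0 1 0 w)).2).
  by apply/funext => w; rewrite /qc !(scaler0, mulr0, addr0, add0r, mulr1).
have /cderP : cder (fun w : C => (F (0, w)).2) 0.
  rewrite qE; apply: differentiable_cder.
  apply: (differentiable_comp (f := fun w => F (qc 0 0 0 1 0 w)) _ (differentiable_snd _)).
  apply: (differentiable_comp (differentiable_qc _ _ _ _ _ _)).
  by rewrite /qc !(scaler0, mulr0, addr0, add0r, mul0r).
rewrite -derive1E => /(@cdiff_scale _ _ _ (-1)) /cdiff_unique; rewrite mulrN1 => <-.
rewrite derive1E; apply: (congr1 (fun f : C -> C => derive f 0 1)); apply/funext => w.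
by rewrite /swp /= !linear0 row_mx0 mulrN1.
Qed.

End Swap.

Theorem theorem1p1 (R : realType) (n N l l' : nat)
    (U : set (Cspace R n)) (F : Cspace R n -> Cspace R N)
    (hn : (1 < n)%N) (hN : (n < N)%N)
    (hl : (2 * l <= n - 1)%N) (hl' : (2 * l' <= N - 1)%N)
    (openU : open U) (connU : connected U) (U0 : U 0)
    (holF : holomorphic_on U F) (F0 : F 0 = 0)
    (FH : forall p, U p -> hyperquadric l p -> hyperquadric l' (F p)) :
  let dgdw0 : Cfield R := derive1 (fun w : Cfield R => (F (0, w)).2) 0 in
  (0 < dgdw0 ->
     (l <= l')%N /\ (n - l <= N - l')%N /\
     ((l' < 2 * l)%N ->
      exists gamma : Cspace R N -> Cspace R N, Aut0 l' gamma /\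
      exists psi : Cspace R n -> 'rV[Cfield R]_(l' - l),
        \forall p \near (0 : Cspace R n),
          differentiable psi p /\
          gamma (F p) =
            (pad N.-1 (take l (coords p.1) ++ coords (psi p)
                       ++ drop l (coords p.1) ++ coords (psi p)),
             p.2)))
  /\
  (dgdw0 < 0 ->
     (n - 1 - l <= l')%N /\ (l <= N - 1 - l')%N /\
     ((l' < n - 1)%N ->
      exists gamma : Cspace R N -> Cspace R N, Aut0 l' gamma /\
      exists psi : Cspace R n -> 'rV[Cfield R]_(l' - (n - 1 - l)),
        \forall p \near (0 : Cspace R n),
          differentiable psi p /\
          gamma (F p) =
            (pad N.-1 (drop l (coords p.1) ++ coords (psi p)
                       ++ take l (coords p.1) ++ coords (psi p)),
             - p.2))).
Proof.
(* After the substitution [n.-1] and [N.-1] are convertible to [l + b] and [l' + b'], the sizes on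
   which the forms act. *)
have [b nE] : exists b, n = (l + b).+1 by exists (n - 1 - l)%N; lia.
have [b' NE] : exists b', N = (l' + b').+1 by exists (N - 1 - l')%N; lia.
subst n N => dgdw0.
(* In both cases the bound on l' amounts to m < l, and m < b follows from this. *)
have lb : (l <= b)%N by lia.
have FM (p : 'rV[Cfield R]_(l + b) * Cfield R) :
    U p -> rr p p = 0 -> rr (F p : 'rV_(l' + b') * Cfield R) (F p) = 0.
  by move=> Up pp; apply/hyperquadric_rr; apply: FH => //; exact/hyperquadric_rr.
split=> dg.
  have [ll bb] := @signature_on_hyperquadric _ l b l' b' U F openU U0 holF F0 FM dg.
  split; [by [] | split; [lia|]] => l'2.
  have [m l'E] : exists m, l' = (l + m)%N by exists (l' - l)%N; lia.
  have [k b'E] : exists k, b' = (b + k)%N by exists (b' - b)%N; lia.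
  subst l' b'; rewrite addKn.
  have ml : (m < l)%N by lia.
  have mb : (m < b)%N by lia.
  have [gamma [gA [psi [s s0 psiP]]]] :=
    @normal_form_on_hyperquadric _ l b m k U F openU U0 holF F0 FM dg ml mb.
  exists gamma; split; first exact: gA.
  exists psi; apply/(near0_psmall (q := l + b)); exists s => // p /psiP[h1 h2]; split; first exact: h1.
  rewrite h2 /normal_form; congr (_, _).
  by rewrite (coords_take (q := b)) (coords_drop (q := b)) pad_normal_form.
(* Only the source is exchanged. Its signature becomes (b, l) while the target keeps (l', b'), so
   the normal form lists z_{l+1}, ..., z_{n-1} first. *)
pose F' (Z : 'rV[Cfield R]_(b + l) * Cfield R) : 'rV[Cfield R]_(l' + b') * Cfield R := F (swp Z).
pose U' := @swp R b l @^-1` U.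
have openU' : open U'.
  apply: open_comp openU => x _; exact: differentiable_continuous (differentiable_swp x).
have U'0 : U' 0 by rewrite /U' /preimage /= swp0.
have holF' x : U' x -> differentiable (F' : (('rV[Cfield R]_(b + l) * Cfield R)%type : normedModType _)
    -> (('rV[Cfield R]_(l' + b') * Cfield R)%type : normedModType _)) x.
  move=> Ux; exact: (differentiable_comp (differentiable_swp x) (holF _ Ux)).
have F'0 : F' 0 = 0 by rewrite /F' swp0.
have FM' p : U' p -> rr p p = 0 -> rr (F' p) (F' p) = 0.
  by move=> Up pp; apply: FM Up _; rewrite rr_swp pp oppr0.
have dg' : 0 < derive1 (fun w : Cfield R => (F' (0, w)).2) 0.
  rewrite (derive1_swp (p := l) (q := b) (p' := l') (q' := b') (F := F)); first by rewrite oppr_gt0.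
  exact: holF.
have [bl' lb'] := @signature_on_hyperquadric _ b l l' b' U' F' openU' U'0 holF' F'0 FM' dg'.
have cE : ((l + b).+1 - 1 - l)%N = b by lia.
rewrite cE; split; [by [] | split; [lia|]] => l'n.
have [m l'E] : exists m, l' = (b + m)%N by exists (l' - b)%N; lia.
have [k b'E] : exists k, b' = (l + k)%N by exists (b' - l)%N; lia.
subst l' b'; rewrite addKn.
have ml : (m < l)%N by lia.
have mb : (m < b)%N by lia.
have [gamma [gA [psi [s s0 psiP]]]] :=
  @normal_form_on_hyperquadric _ b l m k U' F' openU' U'0 holF' F'0 FM' dg' mb ml.
exists gamma; split; first exact: gA.
exists (fun p : 'rV[Cfield R]_(l + b) * Cfield R => psi (swp p)).
apply/(near0_psmall (q := l + b)); exists s => // p /psmall_swp/psiP[h1 h2]; split.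
  exact: (differentiable_comp (differentiable_swp p) h1).
move: h2; rewrite /F' swpK => ->; rewrite /normal_form; congr (_, _).
rewrite (coords_take (q := b)) (coords_drop (q := b)) pad_normal_form.
by rewrite row_mxKl row_mxKr.
Qed.
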